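(* Let $\Gamma\in\mathcal S$ have $n$ vertices and let $\varphi$ be an embedding into $\mathbb Z^n$ such that exactly one index is of type (9) and every other index is of type (4) or (7). Then $\Gamma\in\mathcal W\cup\mathcal N\cup\mathcal M\cup\mathcal A\cup\mathcal B$.
   Context: A plumbing tree is a finite tree $\Gamma$ each of whose vertices $v$ carries an integer decoration $d(v)$. $\Gamma$ is minimal if no vertex has decoration $-1$. For $n\ge 1$ let $(\mathbb Z^n,Q_n)$ be the lattice with basis $E_1,\dots,E_n$ and $Q_n(E_i,E_j)=-\delta_{ij}$, and let $K=\sum_{i=1}^n E_i$. A plumbing tree $\Gamma$ on $n$ vertices is a symplectic plumbing tree if there is a map $\varphi$ (an embedding) from its vertex set to $\mathbb Z^n$ such that: for distinct vertices $v_1,v_2$, $Q_n(\varphi(v_1),\varphi(v_2))$ is $1$ if they are adjacent and $0$ otherwise; $Q_n(\varphi(v),\varphi(v))=d(v)$ for every $v$; and $Q_n(\varphi(v),K)+Q_n(\varphi(v),\varphi(v))=-2$ for every $v$. $\mathcal S$ is the set of minimal, connected symplectic plumbing trees. Index types: write $\varphi(v)=\sum_i a_{v,i}E_i$; for an index $i$ consider the multiset of nonzero coefficients $a_{v,i}$ as $v$ ranges over all vertices. Index $i$ is of type (1) if this multiset is $\{1\}$, (2) if $\{-1\}$, (3) if $\{-2\}$, (4) if $\{1,-1\}$, (5) if $\{1,-2\}$, (6) if $\{-1,-1\}$, (7) if $\{1,-1,-1\}$, (9) if $\{1,-1,-1,-1\}$, and (10) if it is empty. (W) For $p,q,r\ge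 0$, $\Gamma_{p,q,r}$ is the tree with a central vertex of decoration $-4$ and three legs (chains starting at a vertex adjacent to the center): $q$ vertices of decoration $-2$ followed by an end vertex $-(p+3)$; $r$ vertices $-2$ followed by an end vertex $-(q+3)$; $p$ vertices $-2$ followed by an end vertex $-(r+3)$. $\mathcal W=\{\Gamma_{p,q,r}:p,q,r\ge0\}$. (N) For $p\ge1$, $q,r\ge 0$, $\Delta_{p,q,r}$ has a central vertex $-3$ with three legs: a single vertex $-(p+2)$; $r$ vertices $-2$ followed by an end vertex $-(q+4)$; and (from the center) $q$ vertices $-2$, one vertex $-3$, $p-1$ vertices $-2$, and an end vertex $-(r+3)$. For $q,r\ge0$, $\Delta_{0,q,r}$ has a central vertex $-3$ with legs: a single vertex $-2$; $q$ vertices $-2$ followed by an end vertex $-(r+4)$; $r$ vertices $-2$ followed by an end vertex $-(q+4)$. $\mathcal N=\{\Delta_{p,q,r}:p,q,r\ge 0\}$. (M) For $p,r\ge1$, $q\ge0$, $\Lambda_{p,q,r}$ has a central vertex $-2$ with legs: a single vertex $-(p+2)$; a single vertex $-(r+3)$; and (from the center) $q$ vertices $-2$, one vertex $-3$, $r-1$ vertices $-2$, one vertex $-3$, $p-1$ vertices $-2$, and an end vertex $-(q+4)$. For $q\ge0,r\ge1$, $\Lambda_{0,q,r}$ has a central vertex $-2$ with legs: a single vertex $-2$; a single vertex $-(r+3)$; and $q$ vertices $-2$, one vertex $-3$, $r-1$ vertices $-2$, an end vertex $-(q+5)$. For $p\ge1,q\ge0$, $\Lambda_{p,q,0}$ has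 a central vertex $-2$ with legs: a single vertex $-(p+2)$; a single vertex $-3$; and $q$ vertices $-2$, one vertex $-4$, $p-1$ vertices $-2$, an end vertex $-(q+4)$. $\mathcal M=\{\Lambda_{p,q,r}: p,q,r\ge0,\ (p,r)\neq(0,0)\}$. (A,B) If $u$ is a vertex of decoration $-1$, blowing up $u$ means adding a new vertex of decoration $-1$ adjacent only to $u$ and decreasing $d(u)$ by $1$; blowing up an edge $uw$ means deleting that edge, adding a new vertex of decoration $-1$ adjacent exactly to $u$ and $w$, and decreasing $d(u)$ and $d(w)$ by $1$. Let $T_a,T_b$ be the trees with a central vertex of decoration $-1$ and three leaves of decorations $(-3,-3,-3)$, $(-4,-4,-2)$ respectively. $\mathcal A$ is the set of trees obtained from $T_a$ by a finite (possibly empty) sequence of blow-ups, each of which blows up the current unique $(-1)$-vertex or an edge emanating from it, followed by changing the decoration of the unique $(-1)$-vertex to $-4$; $\mathcal B$ is defined in the same way starting from $T_b$ with final decoration $-3$. *)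

(* Defs.v *)
From mathcomp Require Import all_boot all_order all_algebra.
Set Implicit Arguments. Unset Strict Implicit. Unset Printing Implicit Defensive.
Import Order.TTheory GRing.Theory Num.Theory.
Local Open Scope ring_scope.

Definition is_plumbing_tree (n : nat) (e : rel 'I_n) : Prop :=
  (0 < n)%N /\ symmetric e /\ irreflexive e /\
  (forall u v : 'I_n, connect e u v) /\
  #|[set uv : 'I_n * 'I_n | e uv.1 uv.2 && (uv.1 < uv.2)%N]| = n.-1.

Definition is_minimal (n : nat) (d : 'I_n -> int) : Prop :=
  forall v, d v != -1.

Definition Qn (n : nat) (x y : 'I_n -> int) : int := - \sum_(i < n) x i * y i.
Definition Kvec (n : nat) : 'I_n -> int := fun _ => 1.

(* phi v i = coefficient a_{v,i} of E_i in phi(v). *)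
Definition is_symplectic_embedding (n : nat) (e : rel 'I_n) (d : 'I_n -> int)
    (phi : 'I_n -> 'I_n -> int) : Prop :=
  [/\ forall v1 v2, v1 != v2 -> Qn (phi v1) (phi v2) = (if e v1 v2 then 1 else 0),
      forall v, Qn (phi v) (phi v) = d v
    & forall v, Qn (phi v) (@Kvec n) + Qn (phi v) (phi v) = -2].

Definition index_coeffs (n : nat) (phi : 'I_n -> 'I_n -> int) (i : 'I_n) : seq int :=
  [seq phi v i | v <- enum 'I_n & phi v i != 0].

Definition index_type4 n (phi : 'I_n -> 'I_n -> int) i :=
  perm_eq (index_coeffs phi i) [:: 1; -1].
Definition index_type7 n (phi : 'I_n -> 'I_n -> int) i :=
  perm_eq (index_coeffs phi i) [:: 1; -1; -1].
Definition index_type9 n (phi : 'I_n -> 'I_n -> int) i :=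
  perm_eq (index_coeffs phi i) [:: 1; -1; -1; -1].

(* ---------- Concrete decorated graphs on vertices 0..pg_n-1 ---------- *)

Record pgraph := PG { pg_n : nat; pg_adj : nat -> nat -> bool; pg_dec : nat -> int }.

Definition iso_to (n : nat) (e : rel 'I_n) (d : 'I_n -> int) (G : pgraph) : Prop :=
  pg_n G = n /\
  exists f : 'I_n -> nat,
    [/\ injective f, forall v, (f v < n)%N,
        forall u v, pg_adj G (f u) (f v) = e u v
      & forall v, pg_dec G (f v) = d v].

(* Tree with a central vertex 0 (decoration c) and three legs whose
   decorations, listed from the center outwards, are l1, l2, l3.
   Vertices: 0 center; leg1 = 1..s1; leg2 = 1+s1..s1+s2; leg3 = 1+s1+s2..n-1. *)
Definition star3 (c : int) (l1 l2 l3 : seq int) : pgraph :=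
  let s1 := size l1 in let s2 := size l2 in
  let N := (1 + s1 + s2 + size l3)%N in
  let is_start v := [|| v == 1%N, v == (1 + s1)%N | v == (1 + s1 + s2)%N] in
  let par v := if is_start v then 0%N else v.-1 in
  PG N
     (fun u v => [&& (u < N)%N, (v < N)%N, u != v &
                   ((u != 0%N) && (par u == v)) || ((v != 0%N) && (par v == u))])
     (fun v => if v == 0%N then c else nth 0 (l1 ++ l2 ++ l3) v.-1).

Definition m2chain (k : nat) : seq int := nseq k (-2).

Definition Gamma_pqr (p q r : nat) : pgraph :=
  star3 (-4) (m2chain q ++ [:: - (p%:Z + 3)])
             (m2chain r ++ [:: - (q%:Z + 3)])
             (m2chain p ++ [:: - (r%:Z + 3)]).

Definition Delta_pqr (p q r : nat) : pgraph :=
  if (0 < p)%N then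
    star3 (-3) [:: - (p%:Z + 2)]
               (m2chain r ++ [:: - (q%:Z + 4)])
               (m2chain q ++ [:: -3] ++ m2chain p.-1 ++ [:: - (r%:Z + 3)])
  else
    star3 (-3) [:: -2]
               (m2chain q ++ [:: - (r%:Z + 4)])
               (m2chain r ++ [:: - (q%:Z + 4)]).

(* (M), defined for (p,r) <> (0,0) *)
Definition Lambda_pqr (p q r : nat) : pgraph :=
  if (0 < p)%N && (0 < r)%N then
    star3 (-2) [:: - (p%:Z + 2)] [:: - (r%:Z + 3)]
          (m2chain q ++ [:: -3] ++ m2chain r.-1 ++ [:: -3] ++ m2chain p.-1
                     ++ [:: - (q%:Z + 4)])
  else if (p == 0)%N then
    star3 (-2) [:: -2] [:: - (r%:Z + 3)]
          (m2chain q ++ [:: -3] ++ m2chain r.-1 ++ [:: - (q%:Z + 5)])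
  else
    star3 (-2) [:: - (p%:Z + 2)] [:: -3]
          (m2chain q ++ [:: -4] ++ m2chain p.-1 ++ [:: - (q%:Z + 4)]).

Definition in_W n (e : rel 'I_n) (d : 'I_n -> int) : Prop :=
  exists p q r : nat, iso_to e d (Gamma_pqr p q r).
Definition in_N n (e : rel 'I_n) (d : 'I_n -> int) : Prop :=
  exists p q r : nat, iso_to e d (Delta_pqr p q r).
Definition in_M n (e : rel 'I_n) (d : 'I_n -> int) : Prop :=
  exists p q r : nat, ((p, r) != (0%N, 0%N)) /\ iso_to e d (Lambda_pqr p q r).

Definition unique_m1 (G : pgraph) (u : nat) : Prop :=
  [/\ (u < pg_n G)%N, pg_dec G u = -1 &
      forall v, (v < pg_n G)%N -> pg_dec G v = -1 -> v = u].

Definition blowup_vertex (G : pgraph) (u : nat) : pgraph :=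
  let N := pg_n G in
  PG N.+1
     (fun x y => [|| pg_adj G x y, (x == N) && (y == u) | (x == u) && (y == N)])
     (fun x => if x == N then -1 else if x == u then pg_dec G u - 1 else pg_dec G x).

Definition blowup_edge (G : pgraph) (u w : nat) : pgraph :=
  let N := pg_n G in
  PG N.+1
     (fun x y => [|| pg_adj G x y && ~~ (((x == u) && (y == w)) || ((x == w) && (y == u))),
                     (x == N) && ((y == u) || (y == w)) |
                     (y == N) && ((x == u) || (x == w))])
     (fun x => if x == N then -1
               else if (x == u) || (x == w) then pg_dec G x - 1 else pg_dec G x).

Inductive blowups (G0 : pgraph) : pgraph -> Prop :=
  | bl_refl : blowups G0 G0
  | bl_vertex G u : blowups G0 G -> unique_m1 G u -> blowups G0 (blowup_vertex G u)
  | bl_edge G u w : blowups G0 G -> unique_m1 G u -> (w < pg_n G)%N ->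
                    pg_adj G u w -> blowups G0 (blowup_edge G u w).

Definition redecorate (G : pgraph) (u : nat) (k : int) : pgraph :=
  PG (pg_n G) (pg_adj G) (fun x => if x == u then k else pg_dec G x).

Definition T_a : pgraph := star3 (-1) [:: -3] [:: -3] [:: -3].
Definition T_b : pgraph := star3 (-1) [:: -4] [:: -4] [:: -2].

Definition in_A n (e : rel 'I_n) (d : 'I_n -> int) : Prop :=
  exists (G : pgraph) (u : nat),
    [/\ blowups T_a G, unique_m1 G u & iso_to e d (redecorate G u (-4))].
Definition in_B n (e : rel 'I_n) (d : 'I_n -> int) : Prop :=
  exists (G : pgraph) (u : nat),
    [/\ blowups T_b G, unique_m1 G u & iso_to e d (redecorate G u (-3))].

(* Main.v *)
(* By adjunction and the index types, phi v = E_{s v} - sum_{j in S v} E_j with s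
   a bijection.  Identify indices with vertices and call v a parent of j when j is
   in S v: every vertex has one or two parents, except j0 (type 9), which has
   three, and Q(phi v, phi w) counts the arrows between v and w minus their common
   children.

   A vertex u of decoration -2 with S u = {x} and x <> j0 can be removed by
   contracting the edge ux, which again gives such a configuration.  If no such u
   exists, the three parents of j0 are joined by arrows pairwise, and this forces
   one of three configurations: T_a and T_b (with the decoration of the center
   changed to -4 and -3), and Delta_{1,0,0}.

   Conversely, when the contraction of u is undone, u inherits the parents of x
   and x keeps at most one of them besides u; a parent w that is not kept cannot
   have a common child with x unless there is an arrow from x to w.  Hence the
   insertion of u is nearly forced, and five explicit families of parent relations
   are closed under it.  Three of them are stars with three legs (W, N and M); in
   the other two the parent relation is the proximity relation of infinitely near
   points, so that they arise by blowing up, which gives A and B. *)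
Require Import Defs.
From mathcomp Require Import all_boot all_order all_algebra.
From mathcomp Require Import zify.
Import Order.TTheory GRing.Theory Num.Theory.
Set Implicit Arguments. Unset Strict Implicit. Unset Printing Implicit Defensive.

(** * Embeddings as relations *)

(** An index with [p] parents brings [p] arrows and cancels one for each of the [p(p-1)/2] pairs of
    its parents. It leaves [p(3-p)/2] edges: one for [p = 1] or [p = 2], none for [p = 3]. A single
    index of type (9) thus makes [#|V| - 1] edges, the least that connectedness allows. So
    contraction has to preserve only nonnegativity and connectedness, and the stars are recognized
    at the end from their edges, without inspecting non-edges.

    What forces [x] to keep a parent [w] is a common child of [w] and [x] together with the absence
    of an arrow from [x] to [w]. Two parents forced in this way exclude an expansion. In the first
    two families the argument breaks down at the core when all legs have length one, for then the
    last core vertex points to the ends of the legs. This freedom is the origin of the unbounded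
    branching in A and B. In the third family [c] hangs below [z], has no parent in the core, and no
    free family arises.

    The final decorations -4 and -3 record that the last exceptional vertex has three children in A
    and two in B. *)

Section Config.
Variable T : finType.
Implicit Types (M : rel T) (V : {set T}) (u v w x y z j : T) (l L : seq T).

Definition par M j := [set w | M w j].
Definition ch M v := [set j | M v j].
Definition cm M v w := #|ch M v :&: ch M w|.
(* The intersection number Q_n(phi v, phi w) for v != w, when [M v w] says that
   the index with coefficient 1 in phi w has coefficient -1 in phi v. *)
Definition q M v w := (M v w + M w v - cm M v w)%N.
Definition adj M v w := (v != w) && (0 < q M v w)%N.

(* That all q v w are at most 1 and that the graph is a tree need not be
   required: both follow by counting, see [sum_q] and [rooted_tree]. *)
Record config V M j0 : Prop := Config {
  cfg_sub : forall v w, M v w -> (v \in V) && (w \in V);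
  cfg_irr : irreflexive M;
  cfg_ch : forall v, v \in V -> exists j, M v j;
  cfg_nneg : forall v w, v != w -> (cm M v w <= M v w + M w v)%N;
  cfg_j0 : j0 \in V;
  cfg_par0 : #|par M j0| = 3;
  cfg_par : forall j, j \in V -> j != j0 -> (0 < #|par M j| <= 2)%N;
  cfg_conn : forall v w, v \in V -> w \in V -> connect (adj M) v w }.

Lemma cmC M v w : cm M v w = cm M w v.
Proof. by rewrite /cm setIC. Qed.

Lemma qC M v w : q M v w = q M w v.
Proof. by rewrite /q cmC addnC. Qed.

Lemma adjC M : symmetric (adj M).
Proof. by move=> v w; rewrite /adj eq_sym qC. Qed.

Lemma sum_pred (P : pred T) : (\sum_w (P w : nat) = #|[set w | P w]|)%N.
Proof. by rewrite -sum1dep_card [RHS]big_mkcond; apply: eq_bigr => w _; case: (P w). Qed.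

Lemma sum_mem V : (\sum_w (w \in V : nat) = #|V|)%N.
Proof. by rewrite sum_pred; apply: eq_card => w; rewrite inE. Qed.

Lemma cmE M v w : cm M v w = (\sum_j (M v j * M w j))%N.
Proof.
rewrite /cm -sum1_card [LHS]big_mkcond; apply: eq_bigr => j _.
by rewrite !inE; case: (M v j); case: (M w j).
Qed.

(** * Double counting of arrows and common children; spanning trees *)

Section Counting.
Variables (V : {set T}) (M : rel T) (j0 : T).
Hypothesis cf : config V M j0.

(** By [cfg_nneg] the truncated subtraction in [q] is a true one off the diagonal. *)
Lemma q_cm v w : v != w -> (q M v w + cm M v w = M v w + M w v)%N.
Proof. by move=> vw; rewrite /q subnK // (cfg_nneg cf). Qed.

Lemma par_out j : j \notin V -> #|par M j| = 0.
Proof.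
move=> jV; apply/eqP; rewrite cards_eq0; apply/eqP/setP => w; rewrite !inE.
by apply/negbTE/negP => /(cfg_sub cf); rewrite (negbTE jV) andbF.
Qed.

Lemma ch_out v : v \notin V -> #|ch M v| = 0.
Proof.
move=> jV; apply/eqP; rewrite cards_eq0; apply/eqP/setP => w; rewrite !inE.
by apply/negbTE/negP => /(cfg_sub cf); rewrite (negbTE jV).
Qed.

(** Sum [q_cm] over [w] and count the common children child by child: a child [j] of [v] is shared
    with [#|par M j| - 1] other vertices. *)
Lemma degree v :
  (\sum_(w | w != v) q M v w + \sum_(j in ch M v) #|par M j|.-1
     = #|ch M v| + #|par M v|)%N.
Proof.
have E : (\sum_(w | w != v) (q M v w + cm M v w) =
          \sum_(w | w != v) (M v w + M w v))%N.
  by apply: eq_bigr => w wv; rewrite q_cm // eq_sym.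
have -> : (\sum_(j in ch M v) #|par M j|.-1 = \sum_(w | w != v) cm M v w)%N.
  under [RHS]eq_bigr do rewrite cmE.
  rewrite exchange_big big_mkcond /=; apply: eq_bigr => j _.
  rewrite inE; case: ifP => vj; last by rewrite big1.
  rewrite -(sum_pred (fun w => M w j)) (bigD1 v) //= vj /=.
  by apply: eq_bigr => w _; rewrite mul1n.
rewrite -big_split /= E big_split /= -!sum_pred; congr (_ + _)%N.
  by rewrite [RHS](bigD1 v) //= (cfg_irr cf).
by rewrite [RHS](bigD1 v) //= (cfg_irr cf).
Qed.

Lemma sum_ch_par : (\sum_v #|ch M v| = \sum_j #|par M j|)%N.
Proof.
under eq_bigr do rewrite -(sum_pred (fun j => M _ j)).
rewrite exchange_big /=; apply: eq_bigr => j _.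
by rewrite (sum_pred (fun w => M w j)).
Qed.

(** Summing [degree] over [v], an index with [p] parents contributes [2p - p(p-1) = p(3-p)]. This is
    2 for [p = 1, 2] and 0 for [p = 3], so exactly the share of [j0] is missing. *)
Lemma sum_q : (\sum_v \sum_(w | w != v) q M v w + 2 = 2 * #|V|)%N.
Proof.
have D : (\sum_v \sum_(w | w != v) q M v w + \sum_j #|par M j| * #|par M j|.-1
      = 2 * \sum_j #|par M j|)%N.
  have -> : (\sum_j #|par M j| * #|par M j|.-1
      = \sum_v \sum_(j in ch M v) #|par M j|.-1)%N.
    under [RHS]eq_bigr do rewrite big_mkcond.
    rewrite exchange_big /=; apply: eq_bigr => j _.
    rewrite -(sum_pred (fun v => M v j)) big_distrl /=; apply: eq_bigr => v _.
    by rewrite inE; case: (M v j); rewrite ?mul1n ?mul0n.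
  rewrite -big_split /=; under eq_bigr do rewrite degree.
  by rewrite big_split /= sum_ch_par mul2n addnn.
have E : (\sum_j #|par M j| * #|par M j|.-1 + 2 * #|V| = 2 * \sum_j #|par M j| + 2)%N.
  (* The defect of [j0] is spread out as a sum over all [j], so that [E] can be checked term by
     term. *)
  have E2 : (\sum_j 2 * (j == j0) = 2)%N.
    by rewrite (bigD1 j0) //= eqxx big1 // => j /negbTE->.
  rewrite -[X in (_ = _ + X)%N]E2 -sum_mem.
  rewrite !big_distrr /= -!big_split /=; apply: eq_bigr => j _.
  case: (eqVneq j j0) => [->|jj]; first by rewrite (cfg_par0 cf) (cfg_j0 cf).
  case: (boolP (j \in V)) => jV; last by rewrite par_out.
  have := cfg_par cf jV jj; case: #|par M j| => [|[|[|]]] //.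
lia.
Qed.

(* A spanning tree already accounts for the whole sum of the [q v w], so
   nothing is left outside of it. *)
Lemma rooted_tree r (p : T -> T) (rho : T -> nat) :
  r \in V ->
  (forall v, v \in V -> v != r ->
     [/\ p v \in V, (rho (p v) < rho v)%N & (0 < q M v (p v))%N]) ->
  forall v w, v \in V -> w \in V -> v != w ->
    q M v w = ((v != r) && (p v == w) || (w != r) && (p w == v)) :> nat.
Proof.
move=> rV H.
pose c v w := [&& v \in V, v != r & p v == w].
have cP v w : c v w -> [/\ v \in V, w \in V, (rho w < rho v)%N & (0 < q M v w)%N].
  by case/and3P => vV vr /eqP<-; case: (H v vV vr).
pose st v w : nat := c v w + c w v.
(* As [rho] strictly decreases along [c], no edge is counted in both directions and [st] is at most
   one. *)
have stq v w : v != w -> (st v w <= q M v w)%N.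
  rewrite /st => vw; case C1: (c v w); case C2: (c w v) => //.
  - by have [_ _ a _] := cP _ _ C1; have [_ _ b _] := cP _ _ C2; lia.
  - by have [] := cP _ _ C1.
  - by have [_ _ _] := cP _ _ C2; rewrite qC.
have S1 : (\sum_v \sum_(w | w != v) c v w = #|V|.-1)%N.
  rewrite (cardsD1 r) rV /= -sum_mem.
  apply: eq_bigr => v _; rewrite !inE /c.
  case: (boolP (v \in V)) => vV; last by rewrite andbF big1.
  case: (boolP (v != r)) => vr /=; last by rewrite big1.
  have [_ b _] := H v vV vr.
  rewrite (bigD1 (p v)) /= ?eqxx ?big1 // => [w /andP[_]|]; first by rewrite eq_sym => /negbTE->.
  by apply: contraTneq b => ->; rewrite ltnn.
have S2 : (\sum_v \sum_(w | w != v) c w v = #|V|.-1)%N.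
  rewrite -S1 (exchange_big_dep predT) //=; apply: eq_bigr => v _.
  by apply: eq_bigl => w; rewrite eq_sym.
have S3 : (\sum_v \sum_(w | w != v) (q M v w - st v w) = 0)%N.
  have : (\sum_v \sum_(w | w != v) (q M v w - st v w) + \sum_v \sum_(w | w != v) st v w
     = \sum_v \sum_(w | w != v) q M v w)%N.
    rewrite -big_split /=; apply: eq_bigr => v _; rewrite -big_split /=.
    by apply: eq_bigr => w wv; rewrite subnK // stq // eq_sym.
  have -> : (\sum_v \sum_(w | w != v) st v w = #|V|.-1 + #|V|.-1)%N.
    by rewrite -{1}S1 -S2 -big_split; apply: eq_bigr => v _; rewrite -big_split.
  have := sum_q; have : (0 < #|V|)%N by apply/card_gt0P; exists r.
  lia.
move=> v w vV wV vw.
have := stq v w vw; have : (q M v w - st v w = 0)%N.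
  move/eqP: S3; rewrite sum_nat_eq0 => /forall_inP/(_ v isT).
  by rewrite sum_nat_eq0 => /forall_inP/(_ w); rewrite eq_sym => /(_ vw)/eqP.
have -> : st v w = ((v != r) && (p v == w) || (w != r) && (p w == v)) :> nat; last by lia.
rewrite /st /c vV wV /=.
case C1: ((v != r) && _); case C2: ((w != r) && _) => //.
have [_ _ a _] : [/\ v \in V, w \in V, (rho w < rho v)%N & (0 < q M v w)%N] by apply: cP; rewrite /c vV.
have [_ _ b _] : [/\ w \in V, v \in V, (rho v < rho w)%N & (0 < q M w v)%N] by apply: cP; rewrite /c wV.
lia.
Qed.

(** Breadth-first search supplies the spanning tree for [rooted_tree]: [rho] is the distance from
    [r] and [p v] a neighbour on a lower level. *)
Lemma bfs r : r \in V -> exists (p : T -> T) (rho : T -> nat),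
  forall v, v \in V -> v != r ->
     [/\ p v \in V, (rho (p v) < rho v)%N & (0 < q M v (p v))%N].
Proof.
move=> rV.
pose lev := fix lev k := if k is k'.+1 then
    lev k' :|: [set v | [exists w in lev k', adj M w v]] else [set r].
have levE v : v \in V -> exists k, v \in lev k.
  move=> vV; have /connectP[s sP ->] := cfg_conn cf rV vV.
  suff G : forall s r' k, path (adj M) r' s -> r' \in lev k ->
      exists k', last r' s \in lev k' by apply: (G s r 0) => //; rewrite inE.
  elim=> [|y s' IH] r' k /=; first by move=> _ H; exists k.
  case/andP=> ry sP' rk; apply: (IH y k.+1) => //.
  by rewrite /= inE; apply/orP; right; rewrite inE; apply/existsP; exists r'; rewrite rk.
have [rho rhoP] : exists rho : T -> nat, forall v,
    v \in V -> v \in lev (rho v) /\ forall k, v \in lev k -> (rho v <= k)%N.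
  apply: (fin_all_exists (P := fun v (n : nat) => v \in V -> v \in lev n /\ forall k, v \in lev k -> (n <= k)%N)).
  move=> v; case: (boolP (v \in V)) => vV; last by exists 0.
  by case: (ex_minnP (levE v vV)) => m m1 m2; exists m.
have [p pP] : exists p : T -> T, forall v, v \in V -> v != r ->
     [/\ p v \in V, (rho (p v) < rho v)%N & (0 < q M v (p v))%N].
  apply: (fin_all_exists (P := fun v (w : T) => v \in V -> v != r -> [/\ w \in V, (rho w < rho v)%N & (0 < q M v w)%N])).
  move=> v; case: (boolP (v \in V)) => vV; last by exists r.
  have [] := rhoP v vV; case R: (rho v) => [|k] /=.
    by rewrite inE => /eqP->; exists r; rewrite eqxx.
  rewrite inE => /orP[A /(_ _ A)|]; first by rewrite ltnn.
  rewrite inE => /existsP[w /andP[wk /andP[wv qwv]]] _; exists w => _ _.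
  have wV : w \in V.
    move: qwv; rewrite /q; case A: (M w v); first by case/andP: (cfg_sub cf A).
    by case B: (M v w) => //; case/andP: (cfg_sub cf B).
  by split => //; [rewrite ltnS; apply: (rhoP w wV).2 | rewrite qC].
by exists p, rho.
Qed.

Lemma q_le1 v w : v \in V -> w \in V -> v != w -> (q M v w <= 1)%N.
Proof.
move=> vV wV vw; have [p [rho H]] := bfs (cfg_j0 cf).
by rewrite (rooted_tree (cfg_j0 cf) H) //; case: (_ || _).
Qed.

Lemma adj_closed (X : {set T}) r : r \in X -> r \in V ->
  (forall v w, v \in X -> adj M v w -> w \in X) -> forall v, v \in V -> v \in X.
Proof.
move=> rX rV H v vV; have /connectP[s sP ->] := cfg_conn cf rV vV.
elim: s r rX sP {rV} => //= y s IH r rX /andP[ry sP].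
exact: IH (H _ _ rX ry) sP.
Qed.

End Counting.
End Config.

(** * Contraction of a vertex of decoration -2 *)

Section Contraction.
Variable T : finType.

(* For u with the single child x (a vertex of decoration -2), the edge ux is
   contracted: E_x is dropped and E_u is renamed E_x. *)
Definition contract (M : rel T) u x : rel T :=
  fun w j => [&& w != u, j != u & if j == x then M w u else M w j].

Variables (V : {set T}) (M : rel T) (j0 u x : T).
Hypotheses (cf : config V M j0) (ux : forall j, M u j = (j == x)) (xj0 : x != j0).
Local Notation M' := (contract M u x).

Lemma ctr_xu : x != u.
Proof. by have := cfg_irr cf u; rewrite ux eq_sym => ->. Qed.

Lemma ctr_V : (u \in V) && (x \in V).
Proof. by apply: (cfg_sub cf); rewrite ux. Qed.

Lemma cm_u w : w != u -> cm M u w = M w x.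
Proof.
move=> wu; rewrite cmE (bigD1 x) //= ux eqxx mul1n big1 ?addn0 // => j /negbTE jx.
by rewrite ux jx.
Qed.

(** The only child [x] of [u] is not a child of itself, so nothing would cancel a second arrow and
    [q M u x] would be 2. *)
Lemma M_xu : M x u = false.
Proof.
have /andP[uV xV] := ctr_V; have xu := ctr_xu.
have := q_le1 cf uV xV; rewrite eq_sym xu => /(_ isT).
by rewrite /q cm_u // (cfg_irr cf) ux eqxx subn0; case: (M x u).
Qed.

(** Only [x] can be a common child of [u] and [w]. Read as a count, the parents of [u] are its
    neighbours other than [x] together with the parents of [x] other than [u]. *)
Lemma q_u w : w != u -> w != x -> (q M u w + M w x = M w u)%N.
Proof.
move=> wu wx; have := @q_cm _ _ _ _ cf u w; rewrite eq_sym wu => /(_ isT).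
by rewrite cm_u // ux (negbTE wx) add0n.
Qed.

Lemma q_ux : q M u x = 1.
Proof. by rewrite /q cm_u ?ctr_xu // ux eqxx M_xu (cfg_irr cf). Qed.

Lemma Mxu_sub w : w != u -> M w x -> M w u.
Proof.
move=> wu wx; case: (eqVneq w x) wx => [->|nx wx]; first by rewrite (cfg_irr cf).
by have := q_u wu nx; rewrite wx addn1; case: (M w u).
Qed.

Lemma M'xE w : M' w x = M w u.
Proof.
rewrite /contract eqxx ctr_xu /=; case: (eqVneq w u) => [->|//].
by rewrite (cfg_irr cf).
Qed.

Lemma M'E w j : j != x -> j != u -> M' w j = M w j.
Proof.
move=> jx ju; rewrite /contract (negbTE jx) ju /=; case: (eqVneq w u) => [->|//].
by rewrite ux (negbTE jx).
Qed.

Lemma M'_u w : M' w u = false.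
Proof. by rewrite /contract eqxx andbF. Qed.

Lemma M'u_ j : M' u j = false.
Proof. by rewrite /contract eqxx. Qed.

Lemma card_par_x : (#|par M x| <= 2)%N.
Proof. by have /andP[_ xV] := ctr_V; have /andP[] := cfg_par cf xV xj0. Qed.

Lemma par_x_uniq w w' : w != u -> w' != u -> M w x -> M w' x -> w = w'.
Proof.
move=> wu w'u wx w'x; apply/eqP; apply: contraT => ww'.
have : ([set u; w; w'] \subset par M x).
  by apply/subsetP => y; rewrite !inE => /orP[/orP[]|] /eqP-> //; rewrite ux.
move/subset_leq_card; rewrite -setUA !cardsU1 !inE cards1 ww' negb_or !(eq_sym u) wu w'u /=.
by have := card_par_x; lia.
Qed.

(** Dropping the index [x] loses no common child, because [x] has at most one parent besides [u];
    the child [u] only changes its name to [x]. *)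
Lemma cm_ctr v w : v != u -> w != u -> v != w -> cm M' v w = cm M v w.
Proof.
move=> vu wu vw; rewrite !cmE.
have D (F : T -> nat) : (\sum_j F j = F x + (F u + \sum_(j | (j != x) && (j != u)) F j))%N.
  by rewrite (bigD1 x) //= (bigD1 u) //= eq_sym ctr_xu.
rewrite !D !M'_u !M'xE muln0 add0n.
have -> : (M v x * M w x = 0)%N.
  case A: (M v x); case B: (M w x) => //.
  by have := par_x_uniq vu wu A B => E; rewrite E eqxx in vw.
rewrite add0n; congr (_ + _)%N; apply: eq_bigr => j /andP[jx ju].
by rewrite !M'E.
Qed.

Lemma q_ctr v w : v != u -> w != u -> v != x -> w != x -> v != w ->
  q M' v w = q M v w.
Proof. by move=> vu wu vx wx vw; rewrite /q cm_ctr // !M'E. Qed.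

(** On the graph this is edge contraction: replacing [M v x] by [M v u] adds exactly [q M u v], so
    the neighbours of [u] pass to [x]. *)
Lemma q_ctr_x v : v != u -> v != x -> (q M' v x = q M v x + q M u v)%N.
Proof.
move=> vu vx; rewrite /q cm_ctr ?ctr_xu // M'xE M'E //.
have := q_cm cf vx; have := q_u vu vx; rewrite /q; move: (cm M v x) (cm M u v); lia.
Qed.

(** The vertex [x] takes over the parents of [u], so it becomes the type (9) vertex if [u] was. *)
Lemma contract_config : config (V :\ u) M' (if j0 == u then x else j0).
Proof.
have /andP[uV xV] := ctr_V; have xu := ctr_xu.
have adj' v w : v != u -> w != u -> adj M v w -> adj M' v w.
  move=> vu wu /andP[vw vw1]; rewrite /adj vw /=.
  case: (eqVneq v x) vw1 => [E|vx]; case: (eqVneq w x) => [F|wx].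
  - by rewrite E F eqxx in vw.
  - by rewrite E qC (qC M') q_ctr_x // addn_gt0 => ->.
  - by rewrite F q_ctr_x // addn_gt0 => ->.
  - by rewrite q_ctr.
have adju w : w != u -> w != x -> adj M u w -> adj M' w x.
  move=> wu wx /andP[_ uw]; rewrite /adj wx q_ctr_x // addn_gt0 uw orbT //.
have parx : par M' x = par M u by apply/setP => w; rewrite !inE M'xE.
have parj j : j != x -> j != u -> par M' j = par M j.
  by move=> jx ju; apply/setP => w; rewrite !inE M'E.
split.
- move=> v w /and3P[vu wu]; rewrite !inE vu wu /=.
  by case: eqP => [->|_] /(cfg_sub cf) /andP[-> //]; rewrite xV.
- move=> v; rewrite /contract; case: eqP => //= vu; case: eqP => [->|_].
    exact: M_xu.
  exact: (cfg_irr cf).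
- move=> v; rewrite !inE => /andP[vu vV]; have [j vj] := cfg_ch cf vV.
  case: (eqVneq j x) vj => [-> vx|jx vj]; first by exists x; rewrite M'xE Mxu_sub.
  case: (eqVneq j u) vj => [-> vx|ju vj]; first by exists x; rewrite M'xE.
  by exists j; rewrite M'E.
- move=> v w vw; case: (eqVneq v u) => [->|vu].
    by rewrite cmE big1 // => j _; rewrite M'u_.
  case: (eqVneq w u) => [->|wu].
    by rewrite cmE big1 // => j _; rewrite M'u_ muln0.
  rewrite cm_ctr //.
  case: (eqVneq v x) => [E|vx]; case: (eqVneq w x) => [F|wx].
  + by rewrite E F eqxx in vw.
  + by rewrite E in vw *; rewrite M'xE M'E // (leq_trans (cfg_nneg cf vw)) // leq_add2l -q_u // leq_addl.
  + by rewrite F in vw *; rewrite M'xE M'E // (leq_trans (cfg_nneg cf vw)) // leq_add2r -q_u // leq_addl.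
  + by rewrite !M'E //; apply: (cfg_nneg cf).
- by case: eqP => [_|/eqP ju]; rewrite !inE ?xu ?xV // ju (cfg_j0 cf).
- case: eqP => [E|/eqP ju]; first by rewrite parx -E (cfg_par0 cf).
  by rewrite parj // 1?eq_sym // (cfg_par0 cf).
- move=> j; rewrite !inE => /andP[ju jV].
  case: (eqVneq j x) => [->|jx].
    rewrite parx; case: (eqVneq j0 u) => [_|ju0 _]; first by rewrite eqxx.
    by apply: (cfg_par cf) => //; rewrite eq_sym.
  rewrite parj //; case: (eqVneq j0 u) => [Eu _|_ jj0]; last exact: (cfg_par cf).
  by apply: (cfg_par cf) => //; rewrite Eu.
move=> v w; rewrite !inE => /andP[vu vV] /andP[wu wV].
have /connectP[s sP wE] := cfg_conn cf vV wV.
(* Paths are projected along [u] to [x]; a step between these two becomes constant. *)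
pose pi y := if y == u then x else y.
suff G : forall s v, path (adj M) v s -> connect (adj M') (pi v) (pi (last v s)).
  by have := G s v sP; rewrite -wE /pi (negbTE vu) (negbTE wu).
elim=> [|y s' IH] r /=; first by rewrite connect0.
case/andP=> ry /IH; apply: connect_trans; rewrite /pi.
have ryn : r != y by case/andP: ry.
case: (eqVneq r u) ry => [->|ru]; case: (eqVneq y u) => [->|yu] // ry.
- case: (eqVneq y x) => [->|yx] //.
  by apply: connect1; rewrite adjC adju.
- case: (eqVneq r x) => [->|rx] //.
  by apply: connect1; rewrite adju // adjC.
- by apply: connect1; apply: adj'.
Qed.

Lemma card_contract : #|V| = #|V :\ u|.+1.
Proof. by have /andP[uV _] := ctr_V; rewrite (cardsD1 u) uV. Qed.

(* Undoing a contraction, u takes over the parents of x, and x keeps at most one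
   of them: a parent w that x loses gives up the arrow that compensated a common
   child of w and x. *)
Lemma lost_parent w z : M' w x -> ~~ M w x -> M' w z -> M' x z -> M' x w.
Proof.
rewrite M'xE => wu wx wz xz.
have nwu : w != u by apply: contraTneq wu => ->; rewrite (cfg_irr cf).
have nwx : w != x by apply: contraTneq wu => ->; rewrite M_xu.
have zu : z != u by case/and3P: wz.
have zx : z != x by apply: contraTneq xz => ->; rewrite M'xE M_xu.
rewrite M'E // in wz; rewrite M'E // in xz; rewrite M'E //.
have := q_cm cf nwx; rewrite (negbTE wx) cmE (bigD1 z) //= wz xz mul1n addnCA add1n.
by case: (M x w).
Qed.

(** Two common children have to be compensated by arrows in both directions, and the arrow from [w]
    to [x] is gone. *)
Lemma lost_parent2 w z1 z2 : M' w x -> ~~ M w x -> z1 != z2 ->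
  M' w z1 -> M' x z1 -> M' w z2 -> M' x z2 -> False.
Proof.
rewrite M'xE => wu wx z12 wz1 xz1 wz2 xz2.
have nwx : w != x by apply: contraTneq wu => ->; rewrite M_xu.
have E z : M' w z -> M' x z -> M w z && M x z.
  move=> wz xz; have zu : z != u by case/and3P: wz.
  have zx : z != x by apply: contraTneq xz => ->; rewrite M'xE M_xu.
  by rewrite M'E // in wz; rewrite M'E // in xz; rewrite wz.
have /andP[a1 b1] := E _ wz1 xz1; have /andP[a2 b2] := E _ wz2 xz2.
have := q_cm cf nwx; rewrite (negbTE wx) cmE (bigD1 z1) //= (bigD1 z2) 1?eq_sym //=.
by rewrite a1 b1 a2 b2 !mul1n !add1n !addnS; case: (M x w).
Qed.

(** The two outcomes will correspond to the blow-up of a vertex and of an edge. *)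
Lemma par_x_cases : (forall w, M w x = (w == u)) \/
  exists2 w0, M' w0 x & forall w, M w x = (w == u) || (w == w0).
Proof.
case: (pickP (fun w => (w != u) && M w x)) => [w0 /andP[w0u w0x]|H].
  right; exists w0; first by rewrite M'xE Mxu_sub.
  move=> w; case: (eqVneq w u) => [->|wu] /=; first by rewrite ux eqxx.
  by apply/idP/eqP => [wx|-> //]; apply: par_x_uniq wu w0u wx w0x.
left=> w; have := H w; case: (eqVneq w u) => [->|_] //=; by rewrite ux eqxx.
Qed.

Lemma par_xE w : M w x -> w != u -> forall w', M w' x = (w' == u) || (w' == w).
Proof.
move=> wx wu; case: par_x_cases => [H|[w0 _ H] w']; first by rewrite H (negbTE wu) in wx.
by have := wx; rewrite H (negbTE wu) /= => /eqP->.
Qed.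

End Contraction.

(** * Irreducible configurations *)

Section SmallSets.
Variables (T : finType) (A : {set T}).

Lemma card2_mem x : #|A| = 2 -> x \in A ->
  exists2 y, y != x & forall j, (j \in A) = (j == x) || (j == y).
Proof.
move=> A2 xA; have /cards1P[y yE] : #|A :\ x| == 1.
  by have := cardsD1 x A; rewrite xA A2 add1n => -[<-].
have H j : (j \in A) = (j == x) || (j == y).
  have /setP/(_ j) := yE; rewrite !inE; case: (eqVneq j x) => //= -> _.
  by rewrite xA.
exists y => //; have /setP/(_ y) := yE.
by rewrite !inE eqxx => /andP[].
Qed.

Lemma card3_mem x : #|A| = 3 -> x \in A ->
  exists y z, uniq [:: x; y; z] /\ forall j, (j \in A) = [|| j == x, j == y | j == z].
Proof.
move=> A2 xA; have /cards2P[y [z [yz yE]]] : #|A :\ x| == 2.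
  by have := cardsD1 x A; rewrite xA A2 add1n => -[<-].
exists y, z; split.
  have /setP Ey := yE; have := Ey y; have := Ey z.
  rewrite !inE !eqxx orbT /= => /andP[zx _] /andP[yx _].
  by rewrite !negb_or yz ![x == _]eq_sym yx zx.
move=> j; have /setP/(_ j) := yE; rewrite !inE; case: (eqVneq j x) => //= -> _.
by rewrite xA.
Qed.

End SmallSets.

Section Families.
Variable T : finType.
Implicit Types (M : rel T) (V : {set T}) (u v w x y z j : T) (L : seq T).

Definition par2 M j a b := forall w, M w j = (w == a) || (w == b).
Definition par3 M j a b c := forall w, M w j = [|| w == a, w == b | w == c].

(* The parents of the three non-exceptional vertices over T_a (b = true) and
   T_b (b = false), where ce is the last exceptional vertex. *)
Definition tail (b : bool) M ce v1 v2 v3 :=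
  if b then [/\ par2 M v1 ce v3, par2 M v2 ce v1 & par2 M v3 ce v2]
  else [/\ par2 M v1 v2 v3, par2 M v2 ce v3 & par2 M v3 ce v2].

Section Terminal.
Variables (V : {set T}) (M : rel T) (j0 : T).
Hypothesis cf : config V M j0.

Lemma arrow v w j : v != w -> M v j -> M w j -> M v w || M w v.
Proof.
move=> vw vj wj; have := cfg_nneg cf vw; rewrite cmE (bigD1 j) //= vj wj.
by case: (M v w); case: (M w v).
Qed.

Lemma arrow2 v w j k : v != w -> j != k -> M v j -> M w j -> M v k -> M w k ->
  M v w && M w v.
Proof.
move=> vw jk vj wj vk wk; have := cfg_nneg cf vw.
rewrite cmE (bigD1 j) //= (bigD1 k) 1?eq_sym //= vj wj vk wk.
by case: (M v w); case: (M w v).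
Qed.

(** Arrows are counted from both ends; the extra 1 is the third parent of [j0]. The second sum is a
    slack, which lower bounds on the numbers of children will exhaust. *)
Lemma balance : (\sum_(v in V) #|ch M v| + \sum_(j in V | j != j0) (2 - #|par M j|)
   = (2 * #|V|).+1)%N.
Proof.
have -> : (\sum_(v in V) #|ch M v| = \sum_(j in V) #|par M j|)%N.
  have := sum_ch_par M; rewrite (bigID (mem V)) [in RHS](bigID (mem V)) /=.
  rewrite [X in (_ + X = _)%N]big1; last by move=> v /(ch_out cf).
  by rewrite [X in (_ = _ + X)%N]big1 ?addn0 // => v /(par_out cf).
rewrite (bigD1 j0 (cfg_j0 cf)) /= (cfg_par0 cf) -addnA -big_split /=.
rewrite (eq_bigr (fun=> 2)) => [|j /andP[jV jj]]; last first.
  by have /andP[_] := cfg_par cf jV jj; move=> ?; rewrite subnKC.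
rewrite sum_nat_const (cardsD1 j0 V) (cfg_j0 cf).
rewrite (@eq_card _ _ (mem (V :\ j0))); last by move=> j; rewrite !inE andbC.
by rewrite mulnDr muln1 mulnC.
Qed.

(** In [degree], each child of [v] with two parents cancels itself, and the child [j0] costs one
    more. *)
Lemma degree_regular v : (forall j, j \in V -> j != j0 -> #|par M j| = 2) ->
  (\sum_(w | w != v) q M v w + M v j0 = #|par M v|)%N.
Proof.
move=> reg; have := degree cf v.
have -> : (\sum_(j in ch M v) #|par M j|.-1 = #|ch M v| + M v j0)%N.
  have -> : (M v j0 : nat) = (\sum_(j in ch M v) (j == j0))%N.
    case: (boolP (M v j0)) => vj.
      by rewrite (bigD1 j0) ?inE //= eqxx big1 // => j /andP[_ /negbTE->].
    by rewrite big1 // => j; rewrite inE; case: eqP => // ->; rewrite (negbTE vj).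
  rewrite -sum1_card -big_split; apply: eq_bigr => j; rewrite inE => vj /=.
  have /andP[_ jV] := cfg_sub cf vj.
  by case: (eqVneq j j0) => [->|jj]; rewrite ?(cfg_par0 cf) // reg.
lia.
Qed.

(** A list of neighbours as long as the degree is complete; with [adj_closed] this determines the
    whole vertex set. *)
Lemma neighbours v (N : {set T}) w : (\sum_(w | w != v) q M v w <= #|N|)%N ->
  (forall y, y \in N -> adj M v y) -> adj M v w -> w \in N.
Proof.
move=> le nb /andP[vw qw]; apply: contraLR le => wN; rewrite -ltnNge.
rewrite (bigD1 w) 1?eq_sym //= -add1n; apply: (leq_add qw); rewrite -sum1_card.
rewrite [leqRHS](bigID (mem N)) /=; apply: leq_trans (leq_addr _ _).
rewrite [leqRHS](eq_bigl (mem N)) => [|y /=]; last first.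
  case: (boolP (y \in N)) => yN; rewrite ?andbF ?andbT //.
  have /andP[vy _] := nb _ yN; rewrite eq_sym vy /=.
  by apply: contraNneq wN => <-.
by apply: leq_sum => y /nb /andP[].
Qed.

Hypothesis term : forall u x, (forall j, M u j = (j == x)) -> x = j0.

(** Sharing [j0] with [v1] forces arrows from [b] and [c] to [v1]; then [b] and [c] share two
    children and point to each other. The children now number at least [1 + 3 + 3 + 2(#|V| - 3)],
    which is already the total in [balance]. So all inequalities are equalities, the degrees are
    known, and [j0] with its three neighbours is a full component. *)
Lemma terminal_leaf v1 : (forall j, M v1 j = (j == j0)) ->
  exists v2 v3, [/\ uniq [:: j0; v1; v2; v3], V = [set j0; v1; v2; v3],
    par3 M j0 v1 v2 v3 & tail false M j0 v1 v2 v3].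
Proof.
move=> S1; have v1j0 : M v1 j0 by rewrite S1.
have irr := cfg_irr cf.
have [b [c [ubc j0E]]] : exists b c, uniq [:: v1; b; c] /\ par3 M j0 v1 b c.
  have [|b [c [u3 H]]] := card3_mem (cfg_par0 cf) (x := v1); first by rewrite inE.
  by exists b, c; split => // w; have := H w; rewrite inE.
have [v1b v1c bc] : [/\ v1 != b, v1 != c & b != c].
  by move: ubc; rewrite /= !inE negb_or andbT => /andP[/andP[]].
have bj0 : M b j0 by rewrite j0E eqxx orbT.
have cj0 : M c j0 by rewrite j0E eqxx !orbT.
have neq v w : M v w -> v != w by apply: contraTneq => ->; rewrite irr.
have bv1 : M b v1 by have := arrow v1b v1j0 bj0; rewrite S1 (negbTE (neq _ _ bj0)).
have cv1 : M c v1 by have := arrow v1c v1j0 cj0; rewrite S1 (negbTE (neq _ _ cj0)).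
have v1n : v1 != j0 := neq _ _ v1j0.
have /andP[bc1 cb1] : M b c && M c b by apply: (arrow2 (j := j0) (k := v1)) => //; rewrite eq_sym.
have inV v w : M v w -> v \in V by case/(cfg_sub cf)/andP.
have v1V := inV _ _ v1j0; have bV := inV _ _ bj0; have cV := inV _ _ cj0.
(* By [term] the child of another one-child vertex would be [j0], so the vertex would be [b] or [c],
   but these also have the child [v1]. *)
have two v : v \in V -> v != v1 -> (2 <= #|ch M v|)%N.
  move=> vV vv1; rewrite ltnNge; apply/negP => le1.
  have [x vx] := cfg_ch cf vV.
  have : #|ch M v| == 1 by rewrite eqn_leq le1; apply/card_gt0P; exists x; rewrite inE.
  case/cards1P => x' /setP Sx.
  have Sv j : M v j = (j == x') by have := Sx j; rewrite !inE.
  have E := term Sv; subst x'.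
  have : M v j0 by rewrite Sv.
  rewrite j0E (negbTE vv1) /= => /orP[] /eqP E; subst v.
    by move: bv1; rewrite Sv (negbTE v1n).
  by move: cv1; rewrite Sv (negbTE v1n).
have sub3 v x y z : uniq [:: x; y; z] -> M v x -> M v y -> M v z -> [set x; y; z] \subset ch M v /\ #|[set x; y; z]| = 3.
  rewrite /= !inE negb_or andbT => /andP[/andP[xy xz] yz] vx vy vz; split.
    by apply/subsetP => w; rewrite !inE => /orP[/orP[]|] /eqP->.
  by rewrite -setUA !cardsU1 !inE cards1 negb_or xy xz yz.
have [sb cb3] : [set j0; v1; c] \subset ch M b /\ #|[set j0; v1; c]| = 3.
  by apply: sub3 => //; rewrite /= !inE negb_or v1c ![j0 == _]eq_sym v1n neq.
have [sc cc3] : [set j0; v1; b] \subset ch M c /\ #|[set j0; v1; b]| = 3.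
  by apply: sub3 => //; rewrite /= !inE negb_or v1b ![j0 == _]eq_sym v1n neq.
have lb : (3 <= #|ch M b|)%N by rewrite -cb3 subset_leq_card.
have lc : (3 <= #|ch M c|)%N by rewrite -cc3 subset_leq_card.
have l1 : #|ch M v1| = 1 by rewrite -(cards1 j0); apply: eq_card => j; rewrite !inE S1.
pose R := V :\: [set v1; b; c].
have cR : #|V| = (#|R| + 3)%N.
  rewrite -(cardsID [set v1; b; c] V) addnC; congr addn.
  have /setIidPr-> : [set v1; b; c] \subset V.
    by apply/subsetP => w; rewrite !inE => /orP[/orP[]|] /eqP->.
  by rewrite -setUA !cardsU1 !inE cards1 negb_or v1b v1c bc.
have split : (\sum_(v in V) #|ch M v| = #|ch M v1| + (#|ch M b| + (#|ch M c| + \sum_(v in R) #|ch M v|)))%N.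
  rewrite (bigD1 v1) //= (bigD1 b) /= ?bV 1?eq_sym // (bigD1 c) /= ?cV; last first.
    by rewrite ![c == _]eq_sym v1c bc.
  congr (_ + (_ + (_ + _)))%N; apply: eq_bigl => w; rewrite !inE.
  by case: (w \in V); case: (w == v1); case: (w == b); case: (w == c).
have sR : (2 * #|R| <= \sum_(v in R) #|ch M v|)%N.
  rewrite mulnC -sum_nat_const; apply: leq_sum => v; rewrite !inE !negb_or.
  by case/andP => /andP[/andP[vv1 _] _] vV; apply: two.
have bal := balance; rewrite split l1 cR in bal.
have reg : forall j, j \in V -> j != j0 -> #|par M j| = 2.
  move=> j jV jj; have /andP[_ le] := cfg_par cf jV jj.
  move: bal; rewrite [X in (_ + X)%N](bigD1 j) /=; last by rewrite jV.
  by clear -le lb lc sR; lia.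
have eb : #|ch M b| = 3 by clear -bal lb lc sR; lia.
have ec : #|ch M c| = 3 by clear -bal lb lc sR; lia.
have Sb j : M b j = [|| j == j0, j == v1 | j == c].
  have /setP/(_ j) : [set j0; v1; c] = ch M b by apply/eqP; rewrite eqEcard sb eb cb3.
  by rewrite !inE -orbA.
have Sc j : M c j = [|| j == j0, j == v1 | j == b].
  have /setP/(_ j) : [set j0; v1; b] = ch M c by apply/eqP; rewrite eqEcard sc ec cc3.
  by rewrite !inE -orbA.
have v1E : par2 M v1 b c.
  have := card2_mem (reg _ v1V v1n) (x := b); rewrite inE => /(_ bv1)[y yb H].
  have : c \in par M v1 by rewrite inE.
  rewrite H eq_sym (negbTE bc) /= => /eqP E w; have := H w; by rewrite inE -E.
have [w wc bE] : exists2 w, w != c & par2 M b c w.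
  have := card2_mem (reg _ bV (neq _ _ bj0)) (x := c); rewrite inE => /(_ cb1)[y yb H].
  by exists y => // z; have := H z; rewrite inE.
have [w' wb' cE] : exists2 w, w != b & par2 M c b w.
  have := card2_mem (reg _ cV (neq _ _ cj0)) (x := b); rewrite inE => /(_ bc1)[y yb H].
  by exists y => // z; have := H z; rewrite inE.
have wb : M w b by rewrite bE eqxx orbT.
have wc' : M w' c by rewrite cE eqxx orbT.
(* Whether [w] equals [j0] is not known yet. That [w] and [w'] do so only together is enough to find
   the neighbours of [j0], and the vertex set then gives [w = j0]. *)
have wj0 : w = j0 -> w' = j0.
  move=> E; apply/eqP; apply: contraT => w'j0.
  have : M b w' || M w' b by apply: (arrow (j := c)) => //; rewrite eq_sym.
  rewrite Sb (negbTE w'j0) (negbTE (neq _ _ wc')) orbF /= => /orP[/eqP E'|].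
    by move: wc'; rewrite E' S1 (negbTE (neq _ _ cj0)).
  by rewrite bE (negbTE (neq _ _ wc')) E (negbTE w'j0).
have wj0' : w' = j0 -> w = j0.
  move=> E; apply/eqP; apply: contraT => w'j0.
  have : M c w || M w c by apply: (arrow (j := b)) => //; rewrite eq_sym.
  rewrite Sc (negbTE w'j0) (negbTE (neq _ _ wb)) orbF /= => /orP[/eqP E'|].
    by move: wb; rewrite E' S1 (negbTE (neq _ _ bj0)).
  by rewrite cE (negbTE (neq _ _ wb)) E (negbTE w'j0).
have wsame : (w == j0) = (w' == j0) by apply/eqP/eqP.
have j0n v : M v j0 -> j0 != v by rewrite eq_sym; apply: neq.
have adj1 : adj M j0 v1.
  rewrite adjC /adj neq // /q cmE big1 => [|j _]; first by rewrite v1j0.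
  by rewrite S1; case: eqP => [->|]; rewrite ?irr ?muln0.
have adjb : adj M j0 b.
  rewrite adjC /adj neq // /q bj0 bE (negbTE (j0n _ cj0)) /= cmE (bigD1 c) //=.
  rewrite bc1 cE (negbTE (j0n _ bj0)) /= big1 ?addn0 => [|j jc].
    by rewrite ![j0 == _]eq_sym wsame; case: (_ == _).
  rewrite Sb (negbTE jc) orbF; case: (eqVneq j j0) => [->|_]; first by rewrite irr muln0.
  by case: eqP => // ->; rewrite v1E (negbTE (j0n _ bj0)) (negbTE (j0n _ cj0)).
have adjc : adj M j0 c.
  rewrite adjC /adj neq // /q cj0 cE (negbTE (j0n _ bj0)) /= cmE (bigD1 b) //=.
  rewrite cb1 bE (negbTE (j0n _ cj0)) /= big1 ?addn0 => [|j jc].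
    by rewrite ![j0 == _]eq_sym wsame; case: (_ == _).
  rewrite Sc (negbTE jc) orbF; case: (eqVneq j j0) => [->|_]; first by rewrite irr muln0.
  by case: eqP => // ->; rewrite v1E (negbTE (j0n _ bj0)) (negbTE (j0n _ cj0)).
have deg1 v : v \in V -> M v j0 -> adj M j0 v -> forall y, adj M v y -> y = j0.
  move=> vV vj av y; have D := degree_regular v reg; rewrite vj reg ?neq // in D.
  have: (\sum_(w | w != v) q M v w <= #|[set j0]|)%N by rewrite cards1; clear -D; lia.
  move/(neighbours) => H /H; rewrite inE => /(_ _)/eqP-> // z; rewrite inE => /eqP->.
  by rewrite adjC.
have cl v y : v \in [set j0; v1; b; c] -> adj M v y -> y \in [set j0; v1; b; c].
  rewrite ![v \in _]inE => /orP[/orP[/orP[]|]|] /eqP-> A; last first.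
  - by rewrite (deg1 _ _ _ _ _ A) // !inE eqxx.
  - by rewrite (deg1 _ _ _ _ _ A) // !inE eqxx.
  - by rewrite (deg1 _ _ _ _ _ A) // !inE eqxx.
  have D := degree_regular j0 reg; rewrite (cfg_par0 cf) irr addn0 in D.
  have N3 : #|[set v1; b; c]| = 3.
    by rewrite -setUA !cardsU1 !inE cards1 negb_or v1b v1c bc.
  have: (\sum_(w | w != j0) q M j0 w <= #|[set v1; b; c]|)%N by rewrite D N3.
  move/neighbours => H; have : y \in [set v1; b; c].
    by apply: H A => z; rewrite !inE => /orP[/orP[]|] /eqP->.
  by rewrite !inE => /orP[/orP[]|] ->; rewrite ?orbT.
have VX : V = [set j0; v1; b; c].
  apply/setP => v; apply/idP/idP.
    by apply: (adj_closed cf (r := j0)) => //; rewrite ?inE ?eqxx ?(cfg_j0 cf).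
  by rewrite !inE => /orP[/orP[/orP[]|]|] /eqP->; rewrite ?(cfg_j0 cf).
have wE : w = j0.
  have : w \in V by have := inV _ _ wb.
  rewrite VX !inE (negbTE wc) (negbTE (neq _ _ wb)) !orbF => /orP[/eqP //|/eqP E].
  by move: wb; rewrite E S1 (negbTE (neq _ _ bj0)).
exists b, c; split=> //.
  by rewrite /= !inE !negb_or v1b v1c bc !j0n.
split=> // y; first by rewrite bE wE orbC.
by rewrite cE wj0 // orbC.
Qed.

(** With two children everywhere, [balance] leaves one spare unit: a single vertex has three
    children, or a single index other than [j0] has one parent. In all cases the parents of [j0]
    form a cycle of arrows [a], [b], [c]. A third child of [a] gives Delta_{1,0,0}, a third child
    elsewhere gives T_a, and a missing parent is impossible. *)
Lemma terminal_no_leaf : (forall v, v \in V -> 2 <= #|ch M v|)%N ->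
  (exists v1 v2 v3, [/\ uniq [:: j0; v1; v2; v3], V = [set j0; v1; v2; v3],
     par3 M j0 v1 v2 v3 & tail true M j0 v1 v2 v3]) \/
  (exists a b c z, [/\ uniq [:: j0; a; b; c; z], V = [set j0; a; b; c; z], par3 M j0 a b c
     & [/\ par2 M a j0 c, par2 M z j0 a, par2 M c z b & par2 M b a z]]).
Proof.
move=> two; have irr := cfg_irr cf.
have neq v w : M v w -> v != w by apply: contraTneq => ->; rewrite irr.
have neq' v w : M v w -> w != v by rewrite eq_sym; apply: neq.
have inV v w : M v w -> v \in V by case/(cfg_sub cf)/andP.
have inV' v w : M v w -> w \in V by case/(cfg_sub cf)/andP.
have chV v : v \in V -> (\sum_(w in V | w != v) #|ch M w| + #|ch M v| + \sum_(j in V | j != j0) (2 - #|par M j|)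
   = (2 * #|V|).+1)%N.
  by move=> vV; rewrite -balance (bigD1 v vV) /= [X in (X + _)%N]addnC.
have low (P : pred T) : (2 * #|[set w in V | P w]| <= \sum_(w in V | P w) #|ch M w|)%N.
  rewrite mulnC -sum_nat_const [leqLHS](eq_bigl (fun w => (w \in V) && P w)).
    by apply: leq_sum => v /andP[vV _]; apply: two.
  by move=> w; rewrite inE.
have cV1 v : v \in V -> #|V| = #|[set w in V | w != v]|.+1.
  move=> vV; rewrite (cardsD1 v) vV add1n; congr _.+1.
  by apply: eq_card => w; rewrite !inE andbC.
(* A third child uses up the spare unit, which makes everything else rigid. *)
have big v : v \in V -> (3 <= #|ch M v|)%N ->
    [/\ #|ch M v| = 3, forall w, w \in V -> w != v -> #|ch M w| = 2
      & forall j, j \in V -> j != j0 -> #|par M j| = 2].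
  move=> vV v3; have E := chV v vV; have L := low (fun w => w != v); rewrite (cV1 v vV) in E.
  split; first by clear -v3 E L; lia.
    move=> w wV wv; move: E (low (fun y => (y != v) && (y != w))).
    rewrite (bigD1 w) /= ?wV //.
    have -> : #|[set w in V | w != v]| = #|[set y in V | (y != v) && (y != w)]|.+1.
      rewrite (cardsD1 w) inE wV wv add1n; congr _.+1.
      by apply: eq_card => y; rewrite !inE; case: (y \in V); rewrite /= ?andbT // ?andbF // andbC.
    under eq_bigl do rewrite -andbA.
    by have := two w wV; clear -v3; lia.
  move=> j jV jj; have /andP[_ le] := cfg_par cf jV jj.
  move: E; rewrite [X in (_ + X)%N](bigD1 j) /=; last by rewrite jV.
  by clear -le v3 L; lia.
have no3 v x y z : uniq [:: x; y; z] -> M v x -> M v y -> M v z -> (3 <= #|ch M v|)%N.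
  rewrite /= !inE negb_or andbT => /andP[/andP[xy xz] yz] vx vy vz.
  have <- : #|[set x; y; z]| = 3 by rewrite -setUA !cardsU1 !inE cards1 negb_or xy xz yz.
  by apply/subset_leq_card/subsetP => w; rewrite !inE => /orP[/orP[]|] /eqP->.
have [a [b [c [uabc j0E Sb ca]]]] : exists a b c, [/\ uniq [:: a; b; c], par3 M j0 a b c,
    forall j, M b j = (j == j0) || (j == c) & forall j, M c j = (j == j0) || (j == a)].
  have [a0 a0P] : exists a0, a0 \in par M j0.
    by apply/card_gt0P; rewrite (cfg_par0 cf).
  (* If one of the parents of [j0] has three children, it is chosen as [a]; the other two then have
     exactly two. *)
  have [a [aj0 aP]] : exists a, M a j0 /\ forall w, M w j0 -> w != a -> #|ch M w| = 2.
    case: (pickP [pred w | M w j0 & (3 <= #|ch M w|)%N]) => [a /andP[/= aj0 a3]|H].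
      exists a; split=> // w wj0 wa.
      by have [_ ->] := big a (inV _ _ aj0) a3 => //; apply: inV wj0.
    exists a0; rewrite inE in a0P; split=> // w wj0 _; have := H w; rewrite /= wj0 /=.
    by move/negbT; rewrite -ltnNge => lt; apply/eqP; rewrite eqn_leq -ltnS lt two // (inV _ _ wj0).
  (* The arrow from [b] to [c] fills up the children of [b], so [b] does not point to [a]. If [a]
     pointed to [c], then [a] and [b] would share [j0] and [c] and need both arrows. Hence [c]
     points to [a], which fills up the children of [c]. *)
  have G b c : uniq [:: a; b; c] -> par3 M j0 a b c -> M b c ->
      (forall j, M b j = (j == j0) || (j == c)) /\ (forall j, M c j = (j == j0) || (j == a)).
    move=> /=; rewrite !inE negb_or andbT => /andP[/andP[ab ac] nbc] j0E bc.
    have bj0 : M b j0 by rewrite j0E eqxx orbT.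
    have cj0 : M c j0 by rewrite j0E eqxx !orbT.
    have Sb j : M b j = (j == j0) || (j == c).
      have := card2_mem (aP b bj0 _) (x := j0); rewrite inE eq_sym => /(_ ab bj0)[y yj0 H].
      have : c \in ch M b by rewrite inE.
      rewrite H (negbTE (neq _ _ cj0)) /= => /eqP E.
      by have := H j; rewrite inE -E.
    split=> // j.
    have nba : M b a = false by rewrite Sb (negbTE (neq _ _ aj0)) (negbTE ac).
    have nac : M a c = false.
      apply/negP => Mac; have := arrow2 ab (neq' _ _ cj0) aj0 bj0 Mac bc.
      by rewrite nba andbF.
    have ca : M c a by have := arrow ac aj0 cj0; rewrite nac.
    have := card2_mem (aP c cj0 _) (x := j0); rewrite inE eq_sym => /(_ ac cj0)[y yj0 H].
    have : a \in ch M c by rewrite inE.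
    rewrite H (negbTE (neq _ _ aj0)) /= => /eqP E.
    by have := H j; rewrite inE -E.
  have [|b [c [u3 H]]] := card3_mem (cfg_par0 cf) (x := a); first by rewrite inE.
  have j0E : par3 M j0 a b c by move=> w; have := H w; rewrite inE.
  have bc : b != c by move: u3; rewrite /= !inE => /and3P[].
  have bj0 : M b j0 by rewrite j0E eqxx orbT.
  have cj0 : M c j0 by rewrite j0E eqxx !orbT.
  have [Mbc|Mcb] := orP (arrow bc bj0 cj0).
    by exists a, b, c; have [] := G b c u3 j0E Mbc.
  have u3' : uniq [:: a; c; b].
    move: u3; rewrite /= !inE !negb_or !andbT => /andP[/andP[-> ->]].
    by rewrite eq_sym.
  have j0E' : par3 M j0 a c b by move=> w; rewrite j0E; congr (_ || _); rewrite orbC.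
  by exists a, c, b; have [] := G c b u3' j0E' Mcb.
have [ab ac nbc] : [/\ a != b, a != c & b != c].
  by move: uabc; rewrite /= !inE negb_or andbT => /andP[/andP[]].
have aj0 : M a j0 by rewrite j0E eqxx.
have bj0 : M b j0 by rewrite j0E eqxx orbT.
have cj0 : M c j0 by rewrite j0E eqxx !orbT.
have Mbc : M b c by rewrite Sb eqxx orbT.
have Mca : M c a by rewrite ca eqxx orbT.
have nba : M b a = false by rewrite Sb (negbTE (neq _ _ aj0)) (negbTE ac).
have ncb : M c b = false by rewrite ca (negbTE (neq _ _ bj0)) eq_sym (negbTE ab).
have Mab : M a b by have := arrow ab aj0 bj0; rewrite nba orbF.
have nac : M a c = false.
  apply/negP => Mac; have := arrow2 ab (neq' _ _ cj0) aj0 bj0 Mac Mbc.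
  by rewrite nba andbF.
(* [w] and [b] share [c], and [b] points only to [j0] and [c], so the compensating arrow goes from
   [w] to [b]. The same argument runs along the whole cycle. *)
have c_b w : w != b -> w != j0 -> M w c -> M w b.
  move=> wb wj0 wc; have := arrow wb wc Mbc.
  by rewrite Sb (negbTE wj0) (negbTE (neq _ _ wc)) !orbF.
have a_c w : w != c -> w != j0 -> M w a -> M w c.
  move=> wb wj0 wc; have := arrow wb wc Mca.
  by rewrite ca (negbTE wj0) (negbTE (neq _ _ wc)) !orbF.
have aV := inV _ _ aj0; have bV := inV _ _ bj0; have cV := inV _ _ cj0; have j0V := cfg_j0 cf.
have other x y : M x y -> y != j0 -> (#|par M y| = 2) ->
    exists2 w, w != x & par2 M y x w.
  move=> xy yj0 y2; have := card2_mem y2 (x := x); rewrite inE => /(_ xy)[w wx H].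
  by exists w => // z; have := H z; rewrite inE.
have u3 : uniq [:: a; b; c] by [].
have [a3|a2] := leqP 3 #|ch M a|.
  (* The spare unit is spent at [a]: all other vertices have two children and all other indices two
     parents, so each second parent is pinned down by an arrow condition. *)
  right; have [ea others reg] := big a aV a3.
  have not3 w : w != a -> M w a -> M w b -> M w c -> False.
    move=> wa xa xb xc; have := no3 w a b c u3 xa xb xc.
    by rewrite others // (inV _ _ xa).
  have [z [zj0 zb Sa]] : exists z, [/\ z != j0, z != b & forall j, M a j = [|| j == j0, j == b | j == z]].
    have [|x [y [uxy H]]] := card3_mem ea (x := j0); first by rewrite inE.
    move: uxy; rewrite /= !inE negb_or andbT => /andP[/andP[jx jy] xy].
    have : b \in ch M a by rewrite inE.
    rewrite H (negbTE (neq _ _ bj0)) /= => /orP[] /eqP E.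
      exists y; split; rewrite ?E; first by rewrite eq_sym.
        by rewrite eq_sym.
      by move=> j; have := H j; rewrite inE.
    exists x; split; rewrite ?E //; first by rewrite eq_sym.
    by move=> j; have := H j; rewrite inE => ->; congr (_ || _); rewrite orbC.
  have Maz : M a z by rewrite Sa eqxx !orbT.
  have zc : z != c by apply: contraFneq nac => <-.
  have za := neq' _ _ Maz.
  have zV := inV' _ _ Maz.
  have [wa wac aE] := other _ _ Mca (neq _ _ aj0) (reg a aV (neq _ _ aj0)).
  have [wb wba bE] := other _ _ Mab (neq _ _ bj0) (reg b bV (neq _ _ bj0)).
  have [wc wcb cE] := other _ _ Mbc (neq _ _ cj0) (reg c cV (neq _ _ cj0)).
  have [wz wza zE] := other _ _ Maz zj0 (reg z zV zj0).
  have waE : wa = j0.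
    apply/eqP; apply: contraT => waj0; have wa1 : M wa a by rewrite aE eqxx orbT.
    have wa2 := a_c _ wac waj0 wa1.
    have wab : wa != b by apply: contraTneq wa1 => ->; rewrite nba.
    by case: (not3 wa (neq _ _ wa1) wa1 (c_b _ wab waj0 wa2) wa2).
  have wz1 : M wz z by rewrite zE eqxx orbT.
  have wzE : wz = j0.
    have : M a wz || M wz a by apply: (arrow (j := z)); rewrite // eq_sym.
    rewrite Sa aE waE (negbTE (neq _ _ wz1)) orbF => /orP[/orP[]|/orP[]] /eqP // E.
      by move: wz1; rewrite E Sb (negbTE zj0) (negbTE zc).
    by move: wz1; rewrite E ca (negbTE zj0) (negbTE za).
  have Mj0z : M j0 z by rewrite -wzE.
  have Mj0a : M j0 a by rewrite aE waE eqxx orbT.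
  have Sj0 j : M j0 j = (j == a) || (j == z).
    have := card2_mem (others j0 j0V (neq' _ _ aj0)) (x := a); rewrite inE => /(_ Mj0a)[y ya H].
    have : z \in ch M j0 by rewrite inE.
    by rewrite H (negbTE za) /= => /eqP->; have := H j; rewrite inE.
  have wb1 : M wb b by rewrite bE eqxx orbT.
  have wbE : wb = z.
    have : M a wb || M wb a by apply: (arrow (j := b)); rewrite // eq_sym.
    rewrite Sa aE waE (negbTE (neq _ _ wb1)) /= => /orP[/orP[]|/orP[]] /eqP // E.
    - by move: wb1; rewrite E Sj0 eq_sym (negbTE ab) eq_sym (negbTE zb).
    - by move: wb1; rewrite E ncb.
    - by move: wb1; rewrite E Sj0 eq_sym (negbTE ab) eq_sym (negbTE zb).
  have wc1 : M wc c by rewrite cE eqxx orbT.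
  have wcj0 : wc != j0.
    by apply: contraTneq wc1 => ->; rewrite Sj0 eq_sym (negbTE ac) eq_sym (negbTE zc).
  have wcE : wc = z.
    have := c_b _ wcb wcj0 wc1; rewrite bE wbE => /orP[] /eqP // E.
    by move: wc1; rewrite E nac.
  have Sz j : M z j = (j == b) || (j == c).
    have := card2_mem (others z zV za) (x := b); rewrite inE -{1}wbE => /(_ wb1)[y ya H].
    have : c \in ch M z by rewrite inE -wcE.
    by rewrite H eq_sym (negbTE nbc) /= => /eqP->; have := H j; rewrite inE.
  exists a, b, c, z; split.
  - rewrite /= !inE !negb_or ab ac nbc ![j0 == _]eq_sym zj0 (neq _ _ aj0) (neq _ _ bj0) (neq _ _ cj0).
    by rewrite ![_ == z]eq_sym za zb zc.
  - apply/setP => v; apply/idP/idP.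
      apply: (adj_closed cf (r := j0)) => // [|x y]; first by rewrite !inE eqxx.
      rewrite !inE -!orbA => X /andP[_]; rewrite /q => qxy.
      have {qxy} : M x y || M y x by move: qxy; case: (M x y); case: (M y x).
      by case/or4P: X => [|||/orP[]] /eqP->;
        rewrite ?(Sj0, Sa, Sb, ca, Sz, aE, bE, cE, zE, j0E) ?waE ?wbE ?wcE ?wzE;
        do ![case/orP]; move/eqP->; rewrite eqxx ?orbT.
    by rewrite !inE -!orbA => /or4P[|||/orP[]] /eqP->.
  - by [].
  - split=> // y; rewrite ?aE ?zE ?cE ?bE ?waE ?wzE ?wcE ?wbE //; by rewrite orbC.
have ea : #|ch M a| = 2 by apply/eqP; rewrite eqn_leq -ltnS a2 two.
have Sa j : M a j = (j == j0) || (j == b).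
  have := card2_mem ea (x := j0); rewrite inE => /(_ aj0)[y ya H].
  have : b \in ch M a by rewrite inE.
  by rewrite H (negbTE (neq _ _ bj0)) /= => /eqP->; have := H j; rewrite inE.
have b_a w : w != a -> w != j0 -> M w b -> M w a.
  move=> wb wj0 wc; have := arrow wb wc Mab.
  by rewrite Sa (negbTE wj0) (negbTE (neq _ _ wc)) !orbF.
have cmj0 v y : v != j0 -> y != j0 -> (forall j, M v j = (j == j0) || (j == y)) -> cm M v j0 = M j0 y.
  move=> vj0 yj0 Sv; rewrite cmE (bigD1 y) //= Sv eqxx orbT mul1n big1 ?addn0 // => j jy.
  by rewrite Sv (negbTE jy) orbF; case: eqP => // ->; rewrite irr.
have [[s sV s3]|all2] : (exists2 s, s \in V & (3 <= #|ch M s|)%N) \/ forall s, s \in V -> #|ch M s| = 2.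
  case: (pickP [pred s | (s \in V) && (3 <= #|ch M s|)%N]) => [s /andP[/= sV s3]|H].
    by left; exists s.
  right=> s sV; have := H s; rewrite /= sV /= => /negbT; rewrite -ltnNge => le.
  by apply/eqP; rewrite eqn_leq -ltnS le two.
  left; have [_ _ reg] := big s sV s3.
  have [wa wac aE] := other _ _ Mca (neq _ _ aj0) (reg a aV (neq _ _ aj0)).
  have [wb wba bE] := other _ _ Mab (neq _ _ bj0) (reg b bV (neq _ _ bj0)).
  have [wc wcb cE] := other _ _ Mbc (neq _ _ cj0) (reg c cV (neq _ _ cj0)).
  have wa1 : M wa a by rewrite aE eqxx orbT.
  have wb1 : M wb b by rewrite bE eqxx orbT.
  have wc1 : M wc c by rewrite cE eqxx orbT.
  (* Again the three second parents can only be [j0] simultaneously; that they are is seen once the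
     vertex set is known. *)
  have Iab : wa = j0 -> wb = j0.
    move=> E; apply/eqP; apply: contraT => wj0; have := b_a _ wba wj0 wb1.
    by rewrite aE E (negbTE wj0) orbF => /eqP E'; rewrite E' ncb in wb1.
  have Ibc : wb = j0 -> wc = j0.
    move=> E; apply/eqP; apply: contraT => wj0; have := c_b _ wcb wj0 wc1.
    by rewrite bE E (negbTE wj0) orbF => /eqP E'; rewrite E' nac in wc1.
  have Ica : wc = j0 -> wa = j0.
    move=> E; apply/eqP; apply: contraT => wj0; have := a_c _ wac wj0 wa1.
    by rewrite cE E (negbTE wj0) orbF => /eqP E'; rewrite E' nba in wa1.
  have Eb : (wb == j0) = (wa == j0) by apply/eqP/eqP; auto.
  have Ec : (wc == j0) = (wa == j0) by apply/eqP/eqP; auto.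
  have Mj0a : M j0 a = (wa == j0) by rewrite aE (negbTE (neq' _ _ cj0)) /= eq_sym.
  have Mj0b : M j0 b = (wa == j0) by rewrite bE (negbTE (neq' _ _ aj0)) /= eq_sym.
  have Mj0c : M j0 c = (wa == j0) by rewrite cE (negbTE (neq' _ _ bj0)) /= eq_sym.
  have adjx x y : M x j0 -> M y j0 -> (forall j, M x j = (j == j0) || (j == y)) ->
     M j0 x = (wa == j0) -> M j0 y = (wa == j0) -> adj M j0 x.
    move=> xj yj Sx Ex Ey; rewrite adjC /adj neq // /q (cmj0 x y) ?neq //.
    by rewrite xj Ex Ey; case: (_ == _).
  have adja := adjx _ _ aj0 bj0 Sa Mj0a Mj0b.
  have adjb := adjx _ _ bj0 cj0 Sb Mj0b Mj0c.
  have adjc := adjx _ _ cj0 aj0 ca Mj0c Mj0a.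
  have cl x y : x \in [set j0; a; b; c] -> adj M x y -> y \in [set j0; a; b; c].
    have L v : M v j0 -> adj M j0 v -> forall y, adj M v y -> y = j0.
      move=> vj0 av z avz; have := @neighbours v [set j0] z.
      have := degree_regular v reg; rewrite vj0 reg ?neq // ?(inV _ _ vj0) // cards1.
      rewrite addn1 => -[->] /(_ isT) H; apply/set1P; apply: H => // t.
      by rewrite inE => /eqP->; rewrite adjC.
    rewrite ![x \in _]inE => /orP[/orP[/orP[]|]|] /eqP-> A; last first.
    - by rewrite (L _ _ _ _ A) // !inE eqxx.
    - by rewrite (L _ _ _ _ A) // !inE eqxx.
    - by rewrite (L _ _ _ _ A) // !inE eqxx.
    have := @neighbours j0 [set a; b; c] y.
    have := degree_regular j0 reg; rewrite (cfg_par0 cf) irr addn0 => ->.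
    have -> : #|[set a; b; c]| = 3.
      by rewrite -setUA !cardsU1 !inE cards1 negb_or ab ac nbc.
    have H : forall t, t \in [set a; b; c] -> adj M j0 t.
      by move=> t; rewrite !inE => /orP[/orP[]|] /eqP->.
    by move/(_ isT H A); rewrite !inE => /orP[/orP[]|] ->; rewrite ?orbT.
  have VX : V = [set j0; a; b; c].
    apply/setP => v; apply/idP/idP.
      by apply: (adj_closed cf (r := j0)) => //; rewrite !inE eqxx.
    by rewrite !inE => /orP[/orP[/orP[]|]|] /eqP->.
  have waE : wa = j0.
    have : wa \in V := inV _ _ wa1.
    rewrite VX !inE (negbTE wac) (negbTE (neq _ _ wa1)) !orbF => /orP[/eqP //|/eqP E].
    by rewrite E nba in wa1.
  exists a, b, c; split=> //.
    by rewrite /= !inE !negb_or ab ac nbc !neq'.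
  split=> // y; rewrite ?aE ?bE ?cE ?waE ?Ibc ?Iab ?waE //; by rewrite orbC.
have no4 w : w != j0 -> M w a -> M w b -> M w c -> False.
  by move=> wj xa xb xc; have := no3 w a b c u3 xa xb xc; rewrite all2 // (inV _ _ xa).
(* Both arrows between [x] and [j0] are present, and only the common child [y] can bring [q] down to
   one. *)
have qs x y : M x j0 -> M y j0 -> (forall j, M x j = (j == j0) || (j == y)) -> M j0 x -> M j0 y.
  move=> xj yj Sx jx; have := q_le1 cf (inV _ _ xj) j0V (neq _ _ xj).
  by rewrite /q (cmj0 x y) ?neq // xj jx; case: (M j0 y).
have qa := qs _ _ aj0 bj0 Sa; have qb := qs _ _ bj0 cj0 Sb; have qc := qs _ _ cj0 aj0 ca.
have nj0 x : M j0 a || M j0 b || M j0 c = false.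
  apply/negP => H; have [x1 x2 x3] : [/\ M j0 a, M j0 b & M j0 c].
    by split; case/orP: H => [/orP[]|]; auto.
  by have := no3 j0 a b c u3 x1 x2 x3; rewrite all2.
have [/negbT nja /negbT njb] : M j0 a = false /\ M j0 b = false.
  by have := nj0 a; case: (M j0 a); case: (M j0 b).
(* A second parent of [a] would point to [c] and then to [b] as well, hence have three children. *)
have pa : #|par M a| = 1.
  apply/eqP/cards1P; exists c; apply/setP => w; rewrite !inE; apply/idP/eqP => [wa|-> //].
  apply/eqP; apply: contraT => wc; have wj0 : w != j0 by apply: contraNneq nja => <-.
  have wb : w != b by apply: contraTneq wa => ->; rewrite nba.
  by have w2 := a_c _ wc wj0 wa; case: (no4 w wj0 wa (c_b _ wb wj0 w2) w2).
have pb : #|par M b| = 1.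
  apply/eqP/cards1P; exists a; apply/setP => w; rewrite !inE; apply/idP/eqP => [wb|-> //].
  apply/eqP; apply: contraT => wa; have wj0 : w != j0 by apply: contraNneq njb => <-.
  have wc : w != c by apply: contraTneq wb => ->; rewrite ncb.
  by have w2 := b_a _ wa wj0 wb; case: (no4 w wj0 w2 wb (a_c _ wc wj0 w2)).
(* The single parents of [a] and [b] give a slack of two, but only one unit is available. *)
have := balance; rewrite [X in (_ + X)%N](bigD1 a) /=; last by rewrite aV neq.
rewrite [X in (_ + (_ + X))%N](bigD1 b) /=; last by rewrite bV neq //= eq_sym.
rewrite pa pb (eq_bigr (fun=> 2)) => [|v vV]; last by rewrite all2.
by rewrite sum_nat_const; clear; lia.
Qed.

End Terminal.
End Families.

(** * Families closed under expansion *)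

Section FamilyDefs.
Variable T : finType.
Implicit Types (M : rel T) (V : {set T}) (u v w x y z j : T) (L : seq T).

Definition par1 M j a := forall w, M w j = (w == a).
Definition vertices V L := uniq L /\ forall v, (v \in V) = (v \in L).

(** Repeated blow-up of the point where the last exceptional curve meets a fixed curve [w]. Within
    [L] each vertex but the last gets one child, while [w] gets all of [L]: hence legs of -2 whose
    length appears in the decoration of [w]. *)
Fixpoint chain M y L w : Prop :=
  if L is x :: L' then par2 M x y w /\ chain M x L' w else True.

(* Proximity of infinitely near points: each new point lies on the last
   exceptional curve y and possibly on one earlier curve D. *)
Fixpoint prox M E y L : Prop :=
  if L is x :: L' then
    (par1 M x y \/ exists2 D, D \in E & par2 M x y D) /\ prox M (y :: E) x L'
  else True.

(* W for C = [::], otherwise the trees Lambda_{p,q,0}. *)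
Definition fam1_at V M c0 C L1 L2 L3 :=
  let ce := last c0 C in
  let v1 := last c0 L1 in let v2 := last c0 L2 in let v3 := last c0 L3 in
  [/\ vertices V (c0 :: C ++ L1 ++ L2 ++ L3),
      [/\ 0 < size L1, 0 < size L2 & 0 < size L3]%N,
      par3 M c0 v1 v2 v3 /\ chain M c0 C v1,
      [/\ chain M ce L1 v3, chain M ce L2 v1 & chain M ce L3 v2]
    & C = [::] \/ size L2 = 1 /\ size L3 = 1].

(* The trees Delta_{0,q,r} for C = [::], otherwise Lambda_{0,q,r}. *)
Definition fam2_at V M c0 C v1 L2 L3 :=
  let ce := last c0 C in
  let v2 := last c0 L2 in let v3 := last c0 L3 in
  [/\ vertices V (c0 :: C ++ v1 :: L2 ++ L3),
      (0 < size L2)%N /\ (0 < size L3)%N,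
      [/\ par3 M c0 v1 v2 v3, chain M c0 C v2 & par2 M v1 v2 v3],
      chain M ce L2 v3 /\ chain M ce L3 v2
    & C = [::] \/ size L3 = 1].

(* The trees Delta_{p,q,r} with p > 0 for C = [::], otherwise Lambda_{p,q,r}
   with p, r > 0. *)
Definition fam3_at V M c0 C b La Lz Lc :=
  let ce := last c0 C in
  let a := last c0 La in let z := last c0 Lz in let c := last c0 Lc in
  [/\ vertices V (c0 :: C ++ b :: La ++ Lz ++ Lc),
      [/\ 0 < size La, 0 < size Lz & 0 < size Lc]%N,
      [/\ par3 M c0 a b c, chain M c0 C c & par2 M b a z],
      [/\ chain M ce La c, chain M ce Lz a & chain M z Lc b]
    & C = [::] \/ size La = 1].

(* A for b = true and B for b = false. *)
Definition famX_at b V M c0 C v1 v2 v3 :=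
  [/\ vertices V (c0 :: C ++ [:: v1; v2; v3]),
      par3 M c0 v1 v2 v3, prox M [:: v1; v2; v3] c0 C
    & tail b M (last c0 C) v1 v2 v3].

Definition fam V M :=
  [\/ exists c0 C L1 L2 L3, fam1_at V M c0 C L1 L2 L3,
      exists c0 C v1 L2 L3, fam2_at V M c0 C v1 L2 L3,
      exists c0 C b La Lz Lc, fam3_at V M c0 C b La Lz Lc
    | exists b c0 C v1 v2 v3, famX_at b V M c0 C v1 v2 v3].

Lemma par2C M j a b : par2 M j a b -> par2 M j b a.
Proof. by move=> H w; rewrite H orbC. Qed.

Lemma par2_l M j a b : par2 M j a b -> M a j.
Proof. by move=> ->; rewrite eqxx. Qed.

Lemma par2_r M j a b : par2 M j a b -> M b j.
Proof. by move=> ->; rewrite eqxx orbT. Qed.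

Lemma par3_1 M j a b c : par3 M j a b c -> M a j.
Proof. by move=> ->; rewrite eqxx. Qed.

Lemma par3_2 M j a b c : par3 M j a b c -> M b j.
Proof. by move=> ->; rewrite eqxx orbT. Qed.

Lemma par3_3 M j a b c : par3 M j a b c -> M c j.
Proof. by move=> ->; rewrite eqxx !orbT. Qed.

Lemma par2N M j a b w : par2 M j a b -> w != a -> w != b -> ~~ M w j.
Proof. by move=> -> /negbTE-> /negbTE->. Qed.

Lemma perm_vertices V u L L' : u \in V -> vertices (V :\ u) L ->
  perm_eq L' (u :: L) -> vertices V L'.
Proof.
move=> uV [Lu LV] p; split=> [|v].
  by rewrite (perm_uniq p) /= Lu -LV !inE eqxx.
by rewrite (perm_mem p) inE -LV !inE; case: eqP => [->|].
Qed.

Lemma chain_sub_par M y L w x : chain M y L w -> x \in L -> M w x.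
Proof.
elim: L y => //= h L IH y [yh c]; rewrite inE => /orP[/eqP->|]; last exact: (IH h c).
exact: par2_r yh.
Qed.

Lemma chain_hd M y L w : chain M y L w -> (0 < size L)%N ->
  exists2 z, z \in L & par2 M z y w.
Proof. by case: L => //= z L [zP _] _; exists z; rewrite ?inE ?eqxx. Qed.

Lemma chain_next M y L w d x : chain M y L w -> x \in L -> x != last d L ->
  exists2 z, z \in L & par2 M z x w.
Proof.
elim: L y d => //= h L IH y d [yh c]; rewrite inE => /orP[/eqP-> xl|xL xl].
  case: L c xl {IH} => [|z L] /=; first by rewrite eqxx.
  by case=> zP _ _; exists z => //; rewrite !inE eqxx orbT.
by have [z zL zP] := IH h h c xL xl; exists z => //; rewrite inE zL orbT.
Qed.

Lemma chain_last M y L w d : chain M y L w -> (0 < size L)%N ->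
  exists2 p, par2 M (last d L) p w & if L is [:: _] then p = y else p \in L.
Proof.
elim: L y d => //= h L IH y d [yh c] _.
case: L IH c => [|h' L] IH c; first by exists y.
have [p pP pL] := IH h h c isT; exists p => //.
by case: L pL {IH c pP} => [->|h'' L pL]; rewrite inE ?eqxx // pL orbT.
Qed.

Lemma chain_last_cons M y L w d : chain M y L w -> (0 < size L)%N ->
  exists2 p, par2 M (last d L) p w & p \in y :: L.
Proof.
move=> c s; have [p pP pL] := chain_last d c s; exists p => //; rewrite inE.
by case: L pL {c s pP} => [|h [|h' L]] => [->|->|->]; rewrite ?eqxx ?orbT.
Qed.

Lemma last_in d L : (0 < size L)%N -> last d L \in L.
Proof. by case: L => //= x L _; apply: mem_last. Qed.

Lemma prox_sub M E E' y L : {subset E <= E'} -> prox M E y L -> prox M E' y L.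
Proof.
elim: L E E' y => //= x L IH E E' y EE [xP c]; split; last first.
  by apply: IH c => D; rewrite !inE => /orP[->|/EE->]; rewrite ?orbT.
by case: xP => [|[D /EE DE DP]]; [left | right; exists D].
Qed.

Lemma chain_prox M E y L w : w \in E -> chain M y L w -> prox M E y L.
Proof.
elim: L E y => //= x L IH E y wE [xP c]; split; first by right; exists w.
by apply: IH c; rewrite inE wE orbT.
Qed.

Lemma chain_rcons M y L x w :
  chain M y (rcons L x) w <-> chain M y L w /\ par2 M x (last y L) w.
Proof.
elim: L y => [|h L IH] y /=; first by tauto.
by have := IH h; tauto.
Qed.

Lemma prox_rcons M E y L x : prox M E y (rcons L x) ->
  prox M E y L /\ (par1 M x (last y L) \/
     exists2 D, D \in E ++ belast y L & par2 M x (last y L) D).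
Proof.
elim: L E y => [|h L IH] E y /=; first by rewrite cats0; tauto.
case=> hP /IH [c xP]; split=> //; case: xP => [|[D DE DP]]; first by left.
right; exists D => //; move: DE.
by rewrite !mem_cat !inE -!orbA; case: (D == y); case: (D \in E).
Qed.

End FamilyDefs.

Ltac perm_count := apply/permP => ?; rewrite /= ?count_cat /= ?count_cat /=; clear; lia.

(** * Undoing a contraction: the parents kept by [x] *)

Section Expansion.
Variable T : finType.
Implicit Types (v w y z j : T) (L C : seq T).
Variables (V : {set T}) (M : rel T) (j0 u x : T).
Hypotheses (cf : config V M j0) (ux : forall j, M u j = (j == x)) (xj0 : x != j0).
Local Notation M' := (contract M u x).
Local Notation V' := (V :\ u).

Let cf' := contract_config cf ux xj0.

Lemma M'_nu w j : M' w j -> w != u.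
Proof. by case/and3P. Qed.

(** Contrapositive of [lost_parent]. Since [x] keeps at most one old parent, it determines all
    parents of [x]. *)
Lemma keep_par w z : M' w x -> M' w z -> M' x z -> ~~ M' x w -> par2 M x u w.
Proof.
move=> wx wz xz nxw; apply: (par_xE cf ux xj0); last exact: M'_nu wx.
by apply: contraR nxw => H; apply: (lost_parent cf ux wx H wz xz).
Qed.

(** For the case in which [x] does point to [w]: one common child is compensated by that arrow, so
    two are required. *)
Lemma keep_par_common w z1 z2 : z1 != z2 -> M' w x ->
  M' w z1 -> M' x z1 -> M' w z2 -> M' x z2 -> par2 M x u w.
Proof.
move=> z12 wx a1 b1 a2 b2; apply: (par_xE cf ux xj0); last exact: M'_nu wx.
by apply: contraT => H; case: (lost_parent2 cf ux wx H z12 a1 b1 a2 b2).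
Qed.

(** The source of all impossible expansions below: two distinct parents would both have to be
    kept. *)
Lemma keep_par_uniq w w' : M' w x -> par2 M x u w -> par2 M x u w' -> w = w'.
Proof.
by move=> /M'_nu wu /par2_r wx H; move: wx; rewrite H (negbTE wu) => /eqP.
Qed.

Lemma par2_keep j a b : j != x -> j != u -> par2 M' j a b -> par2 M j a b.
Proof. by move=> jx ju H w; rewrite -H M'E. Qed.

Lemma par1_keep j a : j != x -> j != u -> par1 M' j a -> par1 M j a.
Proof. by move=> jx ju H w; rewrite -H M'E. Qed.

Lemma par3_keep j a b c : j != x -> j != u -> par3 M' j a b c -> par3 M j a b c.
Proof. by move=> jx ju H w; rewrite -H M'E. Qed.

Lemma par2_u a b : par2 M' x a b -> par2 M u a b.
Proof. by move=> H w; rewrite -H (M'xE cf ux). Qed.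

Lemma par1_u a : par1 M' x a -> par1 M u a.
Proof. by move=> H w; rewrite -H (M'xE cf ux). Qed.

Lemma par3_u a b c : par3 M' x a b c -> par3 M u a b c.
Proof. by move=> H w; rewrite -H (M'xE cf ux). Qed.

Lemma chain_keep y L w : x \notin L -> u \notin L -> chain M' y L w -> chain M y L w.
Proof.
elim: L y => //= h L IH y; rewrite !inE !negb_or => /andP[xh xL] /andP[uh uL] [hP c].
by split; [apply: par2_keep; rewrite // eq_sym | apply: IH].
Qed.

Lemma chain_insert y A B w : x \notin A ++ B -> u \notin A ++ x :: B ->
  par2 M x u w -> chain M' y (A ++ x :: B) w -> chain M y (A ++ u :: x :: B) w.
Proof.
move=> + + xu; elim: A y => /= [|h A IH] y.
  by rewrite inE negb_or => xB /andP[_ uB] [xP c]; split; [apply: par2_u | split => //; apply: chain_keep].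
rewrite !inE !negb_or => /andP[xh xL] /andP[uh uL] [hP c].
by split; [apply: par2_keep; rewrite // eq_sym | apply: IH].
Qed.

Lemma prox_keep E y L : x \notin L -> u \notin L -> prox M' E y L -> prox M E y L.
Proof.
elim: L E y => //= h L IH E y; rewrite !inE !negb_or => /andP[xh xL] /andP[uh uL] [hP c].
split; last exact: IH.
case: hP => [hP|[D DE hP]]; [left | right; exists D => //].
  by apply: par1_keep; rewrite // eq_sym.
by apply: par2_keep; rewrite // eq_sym.
Qed.

(** Unlike in a chain nothing is forced here: whichever old parent [x] keeps precedes [u], so every
    choice is again a proximity relation. *)
Lemma prox_insert E y A B : x \notin A ++ B -> u \notin A ++ x :: B ->
  prox M' E y (A ++ x :: B) -> prox M E y (A ++ u :: x :: B).
Proof.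
elim: A E y => /= [|h A IH] E y.
  rewrite inE negb_or => xB /andP[_ uB] [xP c]; split.
    by case: xP => [/par1_u|[D DE /par2_u DP]]; [left | right; exists D].
  split; last by apply: prox_sub (prox_keep xB uB c) => D; rewrite !inE => ->; rewrite orbT.
  have [H|[w0 w0x H]] := par_x_cases cf ux xj0; [by left | right; exists w0 => //].
  rewrite inE; case: xP => [xP|[D DE xP]]; first by rewrite -xP w0x.
  by move: w0x; rewrite xP => /orP[->|/eqP->]; rewrite ?DE ?orbT.
rewrite !inE !negb_or => /andP[xh xL] /andP[uh uL] [hP c]; split; last exact: IH.
case: hP => [hP|[D DE hP]]; [left | right; exists D => //].
  by apply: par1_keep; rewrite // eq_sym.
by apply: par2_keep; rewrite // eq_sym.
Qed.

(* In a chain, the new vertex is forced to be inserted in front of x with x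
   keeping the common parent w of the chain: w and x have a common child. *)
Lemma chain_expand y L w d z : chain M' y L w -> x \in L -> ~~ M' x w ->
  M' (last d L) z -> M' w z -> par2 M x u w.
Proof.
move=> c xL nxw lz wz; have wx := chain_sub_par c xL.
have [E|xl] := eqVneq x (last d L); first by rewrite -E in lz; apply: (keep_par wx wz).
have [z' _ z'P] := chain_next c xL xl.
exact: keep_par wx (par2_r z'P) (par2_l z'P) nxw.
Qed.

End Expansion.

Definition apart (T : eqType) (A B : seq T) := forall x y, x \in A -> y \in B -> x != y.

Lemma apart_sym (T : eqType) (A B : seq T) : apart A B -> apart B A.
Proof. by move=> H x y xB yA; rewrite eq_sym; apply: H. Qed.

Lemma apart_cat (T : eqType) (A B C : seq T) : apart A (B ++ C) -> apart A B /\ apart A C.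
Proof. by move=> H; split=> x y xA yB; apply: H; rewrite // mem_cat yB ?orbT. Qed.

Lemma apart_notin (T : eqType) (A B : seq T) x : apart A B -> x \in A -> x \notin B.
Proof. by move=> H xA; apply/negP => /(H x x xA); rewrite eqxx. Qed.

Lemma uniq_apart (T : eqType) (A B : seq T) : uniq (A ++ B) ->
  [/\ uniq A, uniq B & apart A B].
Proof.
rewrite cat_uniq => /and3P[uA /hasPn H uB]; split=> // x y xA yB.
by apply: contraTneq xA => ->; apply: H.
Qed.

Lemma uniq_mid (T : eqType) (x : T) A B : uniq (A ++ x :: B) -> x \notin A ++ B.
Proof. by rewrite -[x :: B]cat1s uniq_catCA => /andP[]. Qed.

Lemma last_default (T : Type) (d d' : T) L : 0 < size L -> last d L = last d' L.
Proof. by case: L. Qed.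

Ltac perm_from H :=
  apply/permP => p; have /permP/(_ p) := H; rewrite /= ?count_cat /= ?count_cat /=; clear; lia.

(** * Expansion of the first family and of A and B *)

Section Growth.
Variable T : finType.
Implicit Types (v w y z j : T) (L C : seq T).
Variables (V : {set T}) (M : rel T) (j0 u x : T).
Hypotheses (cf : config V M j0) (ux : forall j, M u j = (j == x)) (xj0 : x != j0).
Local Notation M' := (contract M u x).
Local Notation V' := (V :\ u).

Lemma vertices_neq L j : vertices V' L -> j \in L -> j != u.
Proof. by case=> _ LV; rewrite -LV !inE => /andP[]. Qed.

Lemma leg_grow y L w : chain M' y L w -> x \in L -> uniq L -> u \notin L ->
  par2 M x u w ->
  exists L', [/\ chain M y L' w, perm_eq L' (u :: L), size L' = (size L).+1
     & forall d, last d L' = last d L].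
Proof.
move=> c xL uL nu xP; case/splitPr: xL c uL nu => A B c uL nu.
exists (A ++ u :: x :: B); split.
- by apply: (chain_insert cf ux) => //; apply: uniq_mid.
- by perm_count.
- by rewrite !size_cat /= !addnS.
- by move=> d; rewrite !last_cat.
Qed.

(** If [x] is [c0], then [u] inherits the three parents and becomes the type (9) vertex, so the core
    grows at its front; this is why [c0] may change. *)
Lemma core_grow c0 C a b c w : par3 M' c0 a b c -> chain M' c0 C w ->
  x \in c0 :: C -> uniq (c0 :: C) -> u \notin c0 :: C -> par2 M x u w ->
  exists c0' C', [/\ par3 M c0' a b c, chain M c0' C' w, last c0' C' = last c0 C
     & perm_eq (c0' :: C') (u :: c0 :: C)].
Proof.
move=> p3 ch; rewrite inE => /orP[/eqP xc|xC] /= /andP[c0C uC] nu xP.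
  rewrite -xc in p3 ch c0C nu *; exists u, (x :: C); split=> //.
    exact: (par3_u cf ux).
  split=> //; apply: (chain_keep ux) => //; move: nu; rewrite inE negb_or.
  by case/andP.
move: nu; rewrite inE negb_or => /andP[uc0 nu].
have [C' [C1 C2 _ C3]] := leg_grow ch xC uC nu xP.
exists c0, C'; split=> //.
  by apply: (par3_keep ux) => //; [apply: contraNneq c0C => -> | rewrite eq_sym].
by perm_from C2.
Qed.

Lemma prox_core_grow c0 C a b c : par3 M' c0 a b c -> prox M' [:: a; b; c] c0 C ->
  x \in c0 :: C -> uniq (c0 :: C) -> u \notin c0 :: C ->
  exists c0' C', [/\ par3 M c0' a b c, prox M [:: a; b; c] c0' C', last c0' C' = last c0 C
     & perm_eq (c0' :: C') (u :: c0 :: C)].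
Proof.
move=> p3 ch; rewrite inE => /orP[/eqP xc|xC] /= /andP[c0C uC].
  rewrite inE negb_or => /andP[uc0 nu].
  rewrite -xc in p3 ch c0C *; exists u, (x :: C); split=> //.
    exact: (par3_u cf ux).
  split; last by apply: prox_sub (prox_keep ux c0C nu ch) => D; rewrite [in X in _ -> X]inE orbC => ->.
  have [H|[w0 w0x H]] := par_x_cases cf ux xj0; [by left | right; exists w0 => //].
  by rewrite p3 in w0x; rewrite !inE.
rewrite inE negb_or => /andP[uc0 nu].
case/splitPr: xC ch uC nu c0C => A B ch uC nu c0C.
exists c0, (A ++ u :: x :: B); split.
- apply: (par3_keep ux) => //; last by rewrite eq_sym.
  by apply: contraNneq c0C => ->; rewrite mem_cat inE eqxx orbT.
- by apply: (prox_insert cf ux xj0) => //; apply: uniq_mid.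
- by rewrite /= !last_cat.
- by perm_count.
Qed.

(** The common child of [w] and [x] is the next core vertex, or [z] when [x] is the last one. *)
Lemma core_expand c0 C w z : chain M' c0 C w -> x \in c0 :: C -> M' w c0 ->
  ~~ M' x w -> M' (last c0 C) z -> M' w z -> par2 M x u w.
Proof.
move=> ch; rewrite inE => /orP[/eqP xc|xC] wc nxw lz wz; last first.
  exact: (chain_expand cf ux xj0 ch xC nxw lz wz).
rewrite -xc in ch wc lz; case: C ch lz => [|h C] /=.
  by move=> _ xz; apply: (keep_par cf ux xj0 wc wz).
by case=> hP _ _; apply: (keep_par cf ux xj0 wc (par2_r hP) (par2_l hP)).
Qed.

Lemma u_in_V : u \in V.
Proof. by have /andP[] := ctr_V cf ux. Qed.

Lemma x_in_V' : x \in V'.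
Proof.
by have /andP[_ xV] := ctr_V cf ux; rewrite !inE (ctr_xu cf ux).
Qed.

Lemma u_notin L : vertices V' L -> u \notin L.
Proof. by case=> _ LV; rewrite -LV !inE eqxx. Qed.

Section Fam1.

(** Cyclic symmetry exists only for an empty [C]; otherwise the core singles out [v1] as its second
    parent. *)
Lemma fam1_rot (W : {set T}) N c0 L1 L2 L3 :
  fam1_at W N c0 [::] L1 L2 L3 -> fam1_at W N c0 [::] L2 L3 L1.
Proof.
case=> [[uL LV] [s1 s2 s3] [p3 _] [c1 c2 c3] _]; split=> //; last by left.
  have p : perm_eq (c0 :: L2 ++ L3 ++ L1) (c0 :: L1 ++ L2 ++ L3).
    by rewrite perm_cons catA perm_catC.
  by split=> [|v]; rewrite ?(perm_uniq p) ?LV ?(perm_mem p).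
by split=> // w; rewrite p3 orbC -orbA.
Qed.

Lemma fam1_apart (W : {set T}) N c0 C L1 L2 L3 : fam1_at W N c0 C L1 L2 L3 ->
  [/\ apart (c0 :: C) L1, apart (c0 :: C) L2, apart (c0 :: C) L3 &
   [/\ apart L1 L2, apart L1 L3 & apart L2 L3]] /\
  [/\ uniq (c0 :: C), uniq L1, uniq L2 & uniq L3].
Proof.
case=> [[]]; rewrite -cat_cons => /uniq_apart[uC] /uniq_apart[u1] /uniq_apart[u2 u3 a23].
by move=> /apart_cat[a12 a13] /apart_cat[b1 /apart_cat[b2 b3]] *.
Qed.

Variables (c0 : T) (C L1 L2 L3 : seq T).
Hypothesis F : fam1_at V' M' c0 C L1 L2 L3.
Let v1 := last c0 L1.
Let v2 := last c0 L2.
Let v3 := last c0 L3.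
Let ce := last c0 C.

(** [v1] and [v3] share the child [c0], so [chain_expand] also covers the end vertex of the leg. *)
Lemma fam1_leg : x \in L1 -> exists L1', fam1_at V M c0 C L1' L2 L3.
Proof.
move=> xL; have [[a1 a2 a3 [a12 a13 a23]] [uC u1 u2 u3]] := fam1_apart F.
case: F => vs [s1 s2 s3] [p3 ch] [c1 c2 c3] alt.
have v3L := last_in c0 s3; have v2L := last_in c0 s2.
have xP : par2 M x u v3.
  apply: (chain_expand cf ux xj0 c1 xL _ (par3_1 p3) (par3_3 p3)).
  have [p pP pL] := chain_last c0 c3 s3; apply: (par2N pP); last exact: a12.
  case: (L3) pL v3L a13 => [|h [|h' L]] //= pL _ a13; last exact: a13.
  by rewrite pL eq_sym; apply: a1 => //; apply: mem_last.
have nu := u_notin vs.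
have n4 : [/\ u \notin c0 :: C, u \notin L1, u \notin L2 & u \notin L3].
  by move: nu; rewrite -cat_cons !mem_cat !negb_or => /and4P[].
have [n0 n1 n2 n3] := n4.
have xC := apart_notin (apart_sym a1) xL.
have x2 := apart_notin a12 xL.
have x3 := apart_notin a13 xL.
have [L1' [d1 d2 d3 d4]] := leg_grow c1 xL u1 n1 xP.
move: n0 xC; rewrite !inE !negb_or => /andP[uc0 uC'] /andP[xc0 xC'].
exists L1'; split.
- by apply: perm_vertices vs _; [exact: u_in_V | perm_from d2].
- by rewrite d3.
- by rewrite d4; split; [apply: (par3_keep ux) p3; rewrite eq_sym | apply: (chain_keep ux) ch].
- by rewrite d4; split; [ | apply: (chain_keep ux) c2 | apply: (chain_keep ux) c3].
- by [].
Qed.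

(** The last core vertex and [v1] share the first vertex of [L2]. The bound [1 < size L1] puts the
    predecessor of [v1] into the leg; in a leg of length one it is the last core vertex, which then
    points to [v1]. *)
Lemma fam1_core_par : x \in c0 :: C -> 1 < size L1 -> par2 M x u v1.
Proof.
move=> xC s; have [[a1 a2 a3 [a12 a13 a23]] [uC u1 u2 u3]] := fam1_apart F.
case: F => vs [s1 s2 s3] [p3 ch] [c1 c2 c3] alt.
have [z zL zP] := chain_hd c2 s2.
apply: (core_expand ch xC (par3_1 p3) _ (par2_l zP) (par2_r zP)).
have [p pP pL] := chain_last c0 c1 s1; apply: (par2N pP); last by apply: a3; rewrite // last_in.
by case: (L1) pL s a1 => [|h [|h' L]] //= pL _ a1; apply: a1.
Qed.

Lemma fam1_core : x \in c0 :: C -> 1 < size L1 -> size L2 = 1 -> size L3 = 1 ->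
  exists c0' C', fam1_at V M c0' C' L1 L2 L3.
Proof.
move=> xC s e2 e3; have xP := fam1_core_par xC s.
have [[a1 a2 a3 [a12 a13 a23]] [uC u1 u2 u3]] := fam1_apart F.
case: F => vs [s1 s2 s3] [p3 ch] [c1 c2 c3] alt.
have [n0 n1 n2 n3] : [/\ u \notin c0 :: C, u \notin L1, u \notin L2 & u \notin L3].
  by move: (u_notin vs); rewrite -cat_cons !mem_cat !negb_or => /and4P[].
have [c0' [C' [d1 d2 d3 d4]]] := core_grow p3 ch xC uC n0 xP.
have x1 := apart_notin a1 xC.
have x2 := apart_notin a2 xC.
have x3 := apart_notin a3 xC.
exists c0', C'; split=> //.
- by apply: perm_vertices vs _; [exact: u_in_V | perm_from d4].
- by rewrite !(@last_default _ c0' c0).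
- rewrite d3 !(@last_default _ c0' c0) //.
  by split; [apply: (chain_keep ux) c1 | apply: (chain_keep ux) c2 | apply: (chain_keep ux) c3].
- by right.
Qed.

End Fam1.

(** The center would have to keep both [v1] and [v2]. *)
Lemma fam1_two c0 L1 L2 L3 : fam1_at V' M' c0 [::] L1 L2 L3 -> x = c0 ->
  1 < size L1 -> 1 < size L2 -> False.
Proof.
move=> F xc l1 l2; have xC : x \in [:: c0] by rewrite inE xc.
have P1 := fam1_core_par F xC l1; have P2 := fam1_core_par (fam1_rot F) xC l2.
have [[_ _ _ [a12 _ _]] _] := fam1_apart F.
case: F => _ [s1 s2 _] [p3 _] _ _.
have M'1 : M' (last c0 L1) x by rewrite {2}xc (par3_1 p3).
have := a12 _ _ (last_in c0 s1) (last_in c0 s2).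
by rewrite (keep_par_uniq M'1 P1 P2) eqxx.
Qed.

(** Here [x = v2] shares [c0] with [v1] and the first vertex of [L3] with the last core vertex, and
    would keep both. A nonempty core is essential: otherwise its last vertex is [c0], to which [x]
    points. *)
Lemma fam1_no_leg2 c0 C L1 L2 L3 : fam1_at V' M' c0 C L1 L2 L3 ->
  C <> [::] -> x \in L2 -> False.
Proof.
move=> F nC xL; have [[a1 a2 a3 [a12 a13 a23]] [uC u1 u2 u3]] := fam1_apart F.
case: F => vs [s1 s2 s3] [p3 ch] [c1 c2 c3] [//|[e2 e3]].
have xE : last c0 L2 = x by case: (L2) e2 xL => [|h []] //= _; rewrite inE => /eqP.
rewrite xE in p3 c3.
have l1 := last_in c0 s1; have l3 := last_in c0 s3.
have v1x := chain_sub_par c2 xL.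
have P1 : par2 M x u (last c0 L1).
  apply: (keep_par cf ux xj0 v1x (par3_1 p3) (par3_2 p3)).
  have [p pP pL] := chain_last c0 c1 s1; apply: (par2N pP); last exact: a23.
  case: (L1) pL a12 => [|h [|h' L]] //= pL a12.
    by rewrite pL eq_sym; apply: a2 => //; apply: mem_last.
  by rewrite eq_sym; apply: a12.
have sC : 0 < size C by case: (C) nC.
have [p pP pL] := chain_last_cons c0 ch sC.
have ceC : last c0 C \in c0 :: C by apply: mem_last.
have [z3 z3L z3P] := chain_hd c3 s3.
have L2E : L2 = [:: x].
  by case: (L2) e2 xL => [|h []] //= _; rewrite inE => /eqP->.
have cex : M' (last c0 C) x by move: c2; rewrite L2E => -[/par2_l].
have P2 : par2 M x u (last c0 C).
  apply: (keep_par cf ux xj0 cex (par2_l z3P) (par2_r z3P)).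
  apply: (par2N pP); last by rewrite eq_sym; apply: a12.
  by rewrite eq_sym; apply: a2.
have := a1 _ _ ceC l1.
by rewrite (keep_par_uniq cex P2 P1) eqxx.
Qed.

(** Now [v2] and the last core vertex compete: [x = v3] shares with them [c0] and the first vertex
    of [L1]. *)
Lemma fam1_no_leg3 c0 C L1 L2 L3 : fam1_at V' M' c0 C L1 L2 L3 ->
  C <> [::] -> x \in L3 -> False.
Proof.
move=> F nC xL; have [[a1 a2 a3 [a12 a13 a23]] [uC u1 u2 u3]] := fam1_apart F.
case: F => vs [s1 s2 s3] [p3 ch] [c1 c2 c3] [//|[e2 e3]].
have xE : last c0 L3 = x by case: (L3) e3 xL => [|h []] //= _; rewrite inE => /eqP.
rewrite xE in p3 c1.
have l1 := last_in c0 s1; have l2 := last_in c0 s2.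
have v1x := chain_sub_par c3 xL.
have ceC : last c0 C \in c0 :: C by apply: mem_last.
have P1 : par2 M x u (last c0 L2).
  apply: (keep_par cf ux xj0 v1x (par3_2 p3) (par3_3 p3)).
  have [p pP pL] := chain_last c0 c2 s2; apply: (par2N pP); last by rewrite eq_sym; apply: a13.
  case: (L2) e2 pL => [|h [|h' L]] //= _ ->.
  by rewrite eq_sym; apply: a3.
have sC : 0 < size C by case: (C) nC.
have [p pP pL] := chain_last_cons c0 ch sC.
have [z3 z3L z3P] := chain_hd c1 s1.
have L3E : L3 = [:: x].
  by case: (L3) e3 xL => [|h []] //= _; rewrite inE => /eqP->.
have cex : M' (last c0 C) x by move: c3; rewrite L3E => -[/par2_l].
have P2 : par2 M x u (last c0 C).
  apply: (keep_par cf ux xj0 cex (par2_l z3P) (par2_r z3P)).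
  apply: (par2N pP); last by rewrite eq_sym; apply: a13.
  by rewrite eq_sym; apply: a3.
have := a2 _ _ ceC l2.
by rewrite (keep_par_uniq cex P2 P1) eqxx.
Qed.

Lemma fam1_fam c0 C L1 L2 L3 : fam1_at V M c0 C L1 L2 L3 -> fam V M.
Proof. by move=> F; constructor 1; exists c0, C, L1, L2, L3. Qed.

Lemma fam1_expand c0 C L1 L2 L3 : fam1_at V' M' c0 C L1 L2 L3 -> 1 < size L1 -> fam V M.
Proof.
move=> F l1; have xV := x_in_V'.
have [[[_ LV]] [s1 s2 s3] _ _ alt] := F; move: xV.
rewrite LV -cat_cons !mem_cat => /or4P[xC|xL|xL|xL].
- suff [e2 e3] : size L2 = 1 /\ size L3 = 1.
    by have [c0' [C' F']] := fam1_core F xC l1 e2 e3; apply: fam1_fam F'.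
  case: alt => // E; rewrite E in F xC; move: xC; rewrite inE => /eqP xc.
  split; apply/eqP; rewrite eqn_leq ?s2 ?s3 andbT leqNgt; apply/negP => l.
    exact: fam1_two F xc l1 l.
  exact: fam1_two (fam1_rot (fam1_rot F)) xc l l1.
- by have [L1' F'] := fam1_leg F xL; apply: fam1_fam F'.
- case: (C) F => [|h C'] F; last by case: (fam1_no_leg2 F _ xL).
  by have [L1' F'] := fam1_leg (fam1_rot F) xL; apply: fam1_fam F'.
- case: (C) F => [|h C'] F; last by case: (fam1_no_leg3 F _ xL).
  by have [L1' F'] := fam1_leg (fam1_rot (fam1_rot F)) xL; apply: fam1_fam F'.
Qed.

(** With three legs of length one the expansion at the core is no longer forced, so such a member is
    treated as one of A. *)
Lemma fam1_famA c0 C v1 v2 v3 (W : {set T}) N :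
  fam1_at W N c0 C [:: v1] [:: v2] [:: v3] -> famX_at true W N c0 C v1 v2 v3.
Proof.
case=> vs _ [p3 ch] /= [[p1 _] [p2 _] [p3' _]] _; split=> //.
by apply: chain_prox ch; rewrite inE eqxx.
Qed.

(** Backwards along the core: [v] shares each vertex with its predecessor, so there is an arrow
    between [v] and the predecessor. The one towards [v] is excluded, hence [v] is also a parent of
    the predecessor. *)
Lemma prox_chain (W : {set T}) (N : rel T) j E c0 C v : config W N j ->
  prox N E c0 C -> N v (last c0 C) -> (forall y, y \in belast c0 C -> ~~ N y v) ->
  v \notin c0 :: C -> chain N c0 C v.
Proof.
move=> cN; elim/last_ind: C => // C y IH.
case/prox_rcons=> pr yP; rewrite last_rcons belast_rcons => vy nv.
rewrite -rcons_cons mem_rcons inE negb_or => /andP[nvy nvC].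
have lC := mem_last c0 C.
have vl : v != last c0 C by apply: contraNneq nvC => ->.
have yl : par2 N y (last c0 C) v.
  case: yP => [H|[D _ H]]; first by rewrite H (negbTE vl) in vy.
  by move: vy; rewrite H (negbTE vl) => /= /eqP->.
apply/chain_rcons; split=> //; apply: IH => //; last first.
  by move=> z zC; apply: nv; rewrite lastI mem_rcons inE zC orbT.
by have := arrow cN vl vy (par2_l yl); rewrite (negbTE (nv _ lC)) orbF.
Qed.

Let cf' := contract_config cf ux xj0.

Lemma famA_rot (W : {set T}) N c0 C v1 v2 v3 :
  famX_at true W N c0 C v1 v2 v3 -> famX_at true W N c0 C v2 v3 v1.
Proof.
case=> [[uL LV] p3 pr [q1 q2 q3]]; split=> //.
- have p : perm_eq (c0 :: C ++ [:: v2; v3; v1]) (c0 :: C ++ [:: v1; v2; v3]).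
    by perm_count.
  by split=> [|v]; rewrite ?(perm_uniq p) ?LV ?(perm_mem p).
- by move=> w; rewrite p3 orbC -orbA.
- by apply: prox_sub pr => D; rewrite !inE orbC -orbA.
Qed.

Lemma fam_core_facts (W : {set T}) c0 C v1 v2 v3 :
  vertices W (c0 :: C ++ [:: v1; v2; v3]) ->
  [/\ uniq (c0 :: C), apart (c0 :: C) [:: v1; v2; v3] &
   [/\ v1 != v2, v1 != v3 & v2 != v3]].
Proof.
case; rewrite -cat_cons => /uniq_apart[uC /= + a] _.
by rewrite !inE negb_or andbT => /andP[/andP[]].
Qed.

Lemma belast_nlast c0 C y : uniq (c0 :: C) -> y \in belast c0 C -> y != last c0 C.
Proof.
rewrite lastI rcons_uniq => /andP[nl _] yC.
by apply: contraNneq nl => <-.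
Qed.

(** The tail refers only to the last core vertex, which an insertion into the core does not
    change. *)
Lemma famX_core b c0 C v1 v2 v3 : famX_at b V' M' c0 C v1 v2 v3 -> x \in c0 :: C -> fam V M.
Proof.
case=> vs p3 pr tl xC; have [uC a _] := fam_core_facts vs.
have nu : u \notin c0 :: C.
  by apply: contra (u_notin vs); rewrite -cat_cons mem_cat => ->.
have [c0' [C' [d1 d2 d3 d4]]] := prox_core_grow p3 pr xC uC nu.
have jn j : j \in [:: v1; v2; v3] -> j != x /\ j != u.
  move=> jL; split; first by rewrite eq_sym; apply: a.
  by apply: (vertices_neq vs); rewrite -cat_cons mem_cat jL orbT.
have [[x1 u1] [x2 u2] [x3 u3]] : [/\ v1 != x /\ v1 != u, v2 != x /\ v2 != u & v3 != x /\ v3 != u].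
  by split; apply: jn; rewrite !inE eqxx ?orbT.
constructor 4; exists b, c0', C', v1, v2, v3; split=> //.
  by apply: perm_vertices vs _; [exact: u_in_V | perm_from d4].
by rewrite d3; case: b tl => -[q1 q2 q3]; split; apply: (par2_keep ux).
Qed.

(** Expanding outside the core leaves the free family. As [x] keeps [v3], it cannot keep the last
    core vertex, so it must point to it, and [prox_chain] turns the core into a chain along [x]. The
    result is in the first family with first leg [[:: u; x]]. *)
Lemma famA_v1 c0 C v1 v2 v3 : famX_at true V' M' c0 C v1 v2 v3 -> x = v1 -> fam V M.
Proof.
case=> vs p3 pr [q1 q2 q3] xE; rewrite -xE {v1 xE} in vs p3 pr q1 q2.
have [uC a [n12 n13 n23]] := fam_core_facts vs.
have lC := mem_last c0 C.
have c1 : last c0 C != x by apply: a; rewrite // !inE eqxx.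
have c3 : last c0 C != v3 by apply: a; rewrite // !inE eqxx !orbT.
have P3 : par2 M x u v3.
  apply: (keep_par cf ux xj0 (par2_r q1) (par3_3 p3) (par3_1 p3)).
  by apply: (par2N q3); rewrite // eq_sym.
have xce : M' x (last c0 C).
  apply: contraT => H; have P := keep_par cf ux xj0 (par2_l q1) (par2_l q2) (par2_r q2) H.
  by rewrite (keep_par_uniq (par2_l q1) P P3) eqxx in c3.
have ch : chain M' c0 C x.
  apply: (prox_chain cf' pr xce) => [y yC|]; last first.
    by apply: (apart_notin (apart_sym a)); rewrite inE eqxx.
  apply: (par2N q1); first exact: belast_nlast.
  by apply: a; [rewrite lastI mem_rcons inE yC orbT | rewrite !inE eqxx !orbT].
have un := u_notin vs.
have jn j : j \in c0 :: C ++ [:: v2; v3] -> j != x /\ j != u.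
  move=> jL; split; last first.
    by apply: (vertices_neq vs); move: jL; rewrite !inE !mem_cat !inE => /or4P[] ->; rewrite ?orbT.
  move: jL; rewrite -cat_cons mem_cat => /orP[jC|]; first by apply: a; rewrite ?inE ?eqxx.
  by rewrite !inE => /orP[] /eqP->; rewrite eq_sym.
have xC : x \notin C by apply/negP => xC; have [] := jn x; rewrite ?eqxx // !inE mem_cat xC orbT.
have uC' : u \notin C by apply: contra un => H; rewrite inE mem_cat H orbT.
apply: (@fam1_fam c0 C [:: u; x] [:: v2] [:: v3]); split=> //=.
- by apply: perm_vertices vs _; [exact: u_in_V | perm_count].
- have [cx cu] := jn c0 (mem_head _ _).
  by split; [apply: (par3_keep ux) | apply: (chain_keep ux)].
- have [n2x n2u] : v2 != x /\ v2 != u by apply: jn; rewrite inE mem_cat !inE eqxx !orbT.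
  have [n3x n3u] : v3 != x /\ v3 != u by apply: jn; rewrite inE mem_cat !inE eqxx !orbT.
  split; split=> //; first exact: (par2_u cf ux).
    exact: (par2_keep ux).
  exact: (par2_keep ux).
- by right.
Qed.

Lemma famA_expand c0 C v1 v2 v3 : famX_at true V' M' c0 C v1 v2 v3 -> fam V M.
Proof.
move=> F; have [vs p3 pr [q1 q2 q3]] := F.
have := x_in_V'; have [_ ->] := vs; rewrite -cat_cons mem_cat => /orP[xC|].
  exact: famX_core F xC.
rewrite !inE => /or3P[] /eqP xE; first exact: famA_v1 F xE.
  exact: famA_v1 (famA_rot F) xE.
exact: famA_v1 (famA_rot (famA_rot F)) xE.
Qed.

Lemma famB_swap (W : {set T}) N c0 C v1 v2 v3 :
  famX_at false W N c0 C v1 v2 v3 -> famX_at false W N c0 C v1 v3 v2.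
Proof.
case=> [[uL LV] p3 pr [q1 q2 q3]]; split=> //.
- have p : perm_eq (c0 :: C ++ [:: v1; v3; v2]) (c0 :: C ++ [:: v1; v2; v3]).
    by perm_count.
  by split=> [|v]; rewrite ?(perm_uniq p) ?LV ?(perm_mem p).
- by move=> w; rewrite p3; congr (_ || _); rewrite orbC.
- by apply: prox_sub pr => D; rewrite !inE => /or3P[] ->; rewrite ?orbT.
by split=> //; apply: par2C.
Qed.

(** [x] shares [c0] with both of its parents and points to neither, so it would keep [v2] and
    [v3]. *)
Lemma famB_v1 c0 C v1 v2 v3 : famX_at false V' M' c0 C v1 v2 v3 -> x = v1 -> False.
Proof.
case=> vs p3 pr [q1 q2 q3] xE; rewrite -xE {v1 xE} in vs p3 pr q1.
have [uC a [n12 n13 n23]] := fam_core_facts vs.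
have lC := mem_last c0 C.
have c1 : last c0 C != x by apply: a; rewrite // !inE eqxx.
have P2 : par2 M x u v2.
  apply: (keep_par cf ux xj0 (par2_l q1) (par3_2 p3) (par3_1 p3)).
  by apply: (par2N q2); rewrite // eq_sym.
have P3 : par2 M x u v3.
  apply: (keep_par cf ux xj0 (par2_r q1) (par3_3 p3) (par3_1 p3)).
  by apply: (par2N q3); rewrite // eq_sym.
by rewrite (keep_par_uniq (par2_l q1) P2 P3) eqxx in n23.
Qed.

(** As for A, except that [x] points to [v3]; here the two common children [c0] and [v1] force [x]
    to keep it. *)
Lemma famB_v2 c0 C v1 v2 v3 : famX_at false V' M' c0 C v1 v2 v3 -> x = v2 -> fam V M.
Proof.
case=> vs p3 pr [q1 q2 q3] xE; rewrite -xE {v2 xE} in vs p3 pr q1 q2 q3.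
have [uC a [n12 n13 n23]] := fam_core_facts vs.
have lC := mem_last c0 C.
have c3 : last c0 C != v3 by apply: a; rewrite // !inE eqxx !orbT.
have c01 : c0 != v1 by apply: a; rewrite inE eqxx.
have P3 : par2 M x u v3.
  exact: (keep_par_common cf ux xj0 c01 (par2_r q2) (par3_3 p3) (par3_2 p3) (par2_r q1) (par2_l q1)).
have xce : M' x (last c0 C).
  apply: contraT => H; have P := keep_par cf ux xj0 (par2_l q2) (par2_l q3) (par2_r q3) H.
  by rewrite (keep_par_uniq (par2_l q2) P P3) eqxx in c3.
have ch : chain M' c0 C x.
  apply: (prox_chain cf' pr xce) => [y yC|]; last first.
    by apply: (apart_notin (apart_sym a)); rewrite !inE eqxx orbT.
  apply: (par2N q2); first exact: belast_nlast.
  by apply: a; [rewrite lastI mem_rcons inE yC orbT | rewrite !inE eqxx !orbT].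
have un := u_notin vs.
have jn j : j \in c0 :: C ++ [:: v1; v3] -> j != x /\ j != u.
  move=> jL; split; last first.
    by apply: (vertices_neq vs); move: jL; rewrite !inE !mem_cat !inE => /or4P[] ->; rewrite ?orbT.
  move: jL; rewrite -cat_cons mem_cat => /orP[jC|]; first by apply: a; rewrite ?inE ?eqxx ?orbT.
  by rewrite !inE => /orP[] /eqP->; rewrite // eq_sym.
have xC : x \notin C by apply/negP => xC; have [] := jn x; rewrite ?eqxx // !inE mem_cat xC orbT.
have uC' : u \notin C by apply: contra un => H; rewrite inE mem_cat H orbT.
have [cx cu] := jn c0 (mem_head _ _).
have [n1x n1u] : v1 != x /\ v1 != u by apply: jn; rewrite inE mem_cat !inE eqxx !orbT.
have [n3x n3u] : v3 != x /\ v3 != u by apply: jn; rewrite inE mem_cat !inE eqxx !orbT.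
constructor 2; exists c0, C, v1, [:: u; x], [:: v3]; split=> //=.
- by apply: perm_vertices vs _; [exact: u_in_V | perm_count].
- by split; [apply: (par3_keep ux) | apply: (chain_keep ux) | apply: (par2_keep ux)].
- split; split=> //; first exact: (par2_u cf ux).
  exact: (par2_keep ux).
- by right.
Qed.

Lemma famB_expand c0 C v1 v2 v3 : famX_at false V' M' c0 C v1 v2 v3 -> fam V M.
Proof.
move=> F; have [vs p3 pr [q1 q2 q3]] := F.
have := x_in_V'; have [_ ->] := vs; rewrite -cat_cons mem_cat => /orP[xC|].
  exact: famX_core F xC.
rewrite !inE => /or3P[] /eqP xE; first by case: (famB_v1 F xE).
  exact: famB_v2 F xE.
exact: famB_v2 (famB_swap F) xE.
Qed.

End Growth.

(** * Expansion of the second and third family; the induction *)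

Section Growth2.
Variable T : finType.
Implicit Types (v w y z j : T) (L C : seq T).
Variables (V : {set T}) (M : rel T) (j0 u x : T).
Hypotheses (cf : config V M j0) (ux : forall j, M u j = (j == x)) (xj0 : x != j0).
Local Notation M' := (contract M u x).
Local Notation V' := (V :\ u).

Lemma fam2_swap (W : {set T}) N c0 v1 L2 L3 :
  fam2_at W N c0 [::] v1 L2 L3 -> fam2_at W N c0 [::] v1 L3 L2.
Proof.
case=> [[uL LV] [s2 s3] [p3 _ p1] [c2 c3] _]; split=> //; last by left.
  have p : perm_eq (c0 :: v1 :: L3 ++ L2) (c0 :: v1 :: L2 ++ L3).
    by rewrite !perm_cons perm_catC.
  by split=> [|v]; rewrite ?(perm_uniq p) ?LV ?(perm_mem p).
split=> //; last exact: par2C.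
by move=> w; rewrite p3; congr (_ || _); rewrite orbC.
Qed.

Lemma fam2_apart (W : {set T}) N c0 C v1 L2 L3 : fam2_at W N c0 C v1 L2 L3 ->
  [/\ apart (c0 :: C) [:: v1], apart (c0 :: C) L2, apart (c0 :: C) L3 &
   [/\ apart [:: v1] L2, apart [:: v1] L3 & apart L2 L3]] /\
  [/\ uniq (c0 :: C), uniq L2 & uniq L3].
Proof.
case=> [[+ _]] _ _ _ _.
rewrite -cat_cons -[v1 :: _]cat1s => /uniq_apart[uC] /uniq_apart[u1] /uniq_apart[u2 u3 a23].
by move=> /apart_cat[a12 a13] /apart_cat[b1 /apart_cat[b2 b3]].
Qed.

Lemma fam2_famB (W : {set T}) N c0 C v1 v2 v3 :
  fam2_at W N c0 C v1 [:: v2] [:: v3] -> famX_at false W N c0 C v1 v2 v3.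
Proof.
case=> vs _ [p3 ch p1] /= [[p2 _] [p3' _]] _; split=> //.
by apply: chain_prox ch; rewrite !inE eqxx orbT.
Qed.

Lemma fam2_leg c0 C v1 L2 L3 : fam2_at V' M' c0 C v1 L2 L3 -> x \in L2 ->
  exists L2', fam2_at V M c0 C v1 L2' L3.
Proof.
move=> F xL; have [[a1 a2 a3 [a12 a13 a23]] [uC u2 u3]] := fam2_apart F.
case: F => vs [s2 s3] [p3 ch p1] [c2 c3] alt.
have v1L : v1 \in [:: v1] by rewrite inE.
have l3 := last_in c0 s3.
have xP : par2 M x u (last c0 L3).
  (* The ends of the two legs point at each other, so [keep_par] fails for the end [x] of [L2]; the
     leaf [v1] provides a second common child with the end of [L3]. *)
  have [E|xl] := eqVneq x (last c0 L2).
    rewrite -E in p3 p1.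
    apply: (keep_par_common cf ux xj0 _ (chain_sub_par c2 xL)
             (par3_3 p3) (par3_2 p3) (par2_r p1) (par2_l p1)).
    by apply: a1; rewrite ?inE eqxx.
  have [z zL zP] := chain_next c2 xL xl.
  apply: (keep_par cf ux xj0 (chain_sub_par c2 xL) (par2_r zP) (par2_l zP)).
  have [p pP] := chain_last_cons c0 c3 s3; rewrite inE => pL.
  apply: (par2N pP) => //; case/orP: pL => [/eqP->|pL]; last exact: a23.
  by rewrite eq_sym; apply: a2 => //; apply: mem_last.
have [n0 n1 n2 n3] : [/\ u \notin c0 :: C, u != v1, u \notin L2 & u \notin L3].
  move: (u_notin vs); rewrite -cat_cons -[v1 :: _]cat1s !mem_cat.
  by case/norP=> ? /norP[]; rewrite inE => ? /norP[].
have xC := apart_notin (apart_sym a2) xL.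
have x1 : x != v1 by rewrite eq_sym; apply: a12.
have x3 := apart_notin a23 xL.
have [L2' [d1 d2 d3 d4]] := leg_grow cf ux c2 xL u2 n2 xP.
move: n0 xC; rewrite !inE !negb_or => /andP[uc0 uC'] /andP[xc0 xC'].
exists L2'; split.
- by apply: perm_vertices vs _; [exact: (u_in_V cf ux) | perm_from d2].
- by rewrite d3.
- rewrite d4; split; first by apply: (par3_keep ux) p3; rewrite eq_sym.
    exact: (chain_keep ux) ch.
  by apply: (par2_keep ux) p1; rewrite eq_sym.
- by rewrite d4; split; [ | apply: (chain_keep ux) c3].
- by [].
Qed.

Lemma fam2_core_par c0 C v1 L2 L3 : fam2_at V' M' c0 C v1 L2 L3 ->
  x \in c0 :: C -> 1 < size L2 -> par2 M x u (last c0 L2).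
Proof.
move=> F xC s; have [[a1 a2 a3 [a12 a13 a23]] [uC u2 u3]] := fam2_apart F.
case: F => vs [s2 s3] [p3 ch p1] [c2 c3] alt.
have [z zL zP] := chain_hd c3 s3.
apply: (core_expand cf ux xj0 ch xC (par3_2 p3) _ (par2_l zP) (par2_r zP)).
have [p pP pL] := chain_last c0 c2 s2; apply: (par2N pP); last by apply: a3; rewrite // last_in.
by case: (L2) pL s a2 => [|h [|h' L]] //= pL _ a2; apply: a2.
Qed.

Lemma fam2_core c0 C v1 L2 L3 : fam2_at V' M' c0 C v1 L2 L3 ->
  x \in c0 :: C -> 1 < size L2 -> size L3 = 1 ->
  exists c0' C', fam2_at V M c0' C' v1 L2 L3.
Proof.
move=> F xC s e3; have xP := fam2_core_par F xC s.
have [[a1 a2 a3 [a12 a13 a23]] [uC u2 u3]] := fam2_apart F.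
case: F => vs [s2 s3] [p3 ch p1] [c2 c3] alt.
have [n0 n1 n2 n3] : [/\ u \notin c0 :: C, u != v1, u \notin L2 & u \notin L3].
  move: (u_notin vs); rewrite -cat_cons -[v1 :: _]cat1s !mem_cat.
  by case/norP=> ? /norP[]; rewrite inE => ? /norP[].
have [c0' [C' [d1 d2 d3 d4]]] := core_grow cf ux p3 ch xC uC n0 xP.
have x1 : x != v1 by apply: a1; rewrite ?inE.
have x2 := apart_notin a2 xC.
have x3 := apart_notin a3 xC.
exists c0', C'; split=> //.
- by apply: perm_vertices vs _; [exact: (u_in_V cf ux) | perm_from d4].
- rewrite !(@last_default _ c0' c0) //; split=> //.
  by apply: (par2_keep ux) p1; rewrite eq_sym.
- rewrite d3 !(@last_default _ c0' c0) //.
  by split; [apply: (chain_keep ux) c2 | apply: (chain_keep ux) c3].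
- by right.
Qed.

Lemma fam2_two c0 v1 L2 L3 : fam2_at V' M' c0 [::] v1 L2 L3 -> x = c0 ->
  1 < size L2 -> 1 < size L3 -> False.
Proof.
move=> F xc l2 l3; have xC : x \in [:: c0] by rewrite inE xc.
have P1 := fam2_core_par F xC l2; have P2 := fam2_core_par (fam2_swap F) xC l3.
have [[_ _ _ [_ _ a23]] _] := fam2_apart F.
case: F => _ [s2 s3] [p3 _ _] _ _.
have M'1 : M' (last c0 L2) x by rewrite {2}xc (par3_2 p3).
have := a23 _ _ (last_in c0 s2) (last_in c0 s3).
by rewrite (keep_par_uniq M'1 P1 P2) eqxx.
Qed.

Lemma fam2_no_leaf c0 C v1 L2 L3 : fam2_at V' M' c0 C v1 L2 L3 -> x = v1 -> False.
Proof.
move=> F xv; have [[a1 a2 a3 [a12 a13 a23]] [uC u2 u3]] := fam2_apart F.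
case: F => vs [s2 s3] [p3 ch p1] [c2 c3] alt.
rewrite -xv in p3 p1 a1 a12 a13; have xL : x \in [:: x] by rewrite inE.
have lC := mem_last c0 C; have l2 := last_in c0 s2; have l3 := last_in c0 s3.
have P2 : par2 M x u (last c0 L2).
  apply: (keep_par cf ux xj0 (par2_l p1) (par3_2 p3) (par3_1 p3)).
  have [p pP] := chain_last_cons c0 c2 s2; rewrite inE => /orP pL.
  apply: (par2N pP); last exact: a13.
  by case: pL => [/eqP->|pL]; [rewrite eq_sym; apply: a1 | apply: a12].
have P3 : par2 M x u (last c0 L3).
  apply: (keep_par cf ux xj0 (par2_r p1) (par3_3 p3) (par3_1 p3)).
  have [p pP] := chain_last_cons c0 c3 s3; rewrite inE => /orP pL.
  apply: (par2N pP); last exact: a12.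
  by case: pL => [/eqP->|pL]; [rewrite eq_sym; apply: a1 | apply: a13].
have := a23 _ _ l2 l3.
by rewrite (keep_par_uniq (par2_l p1) P2 P3) eqxx.
Qed.

(** [x] shares [c0] and [v1] with the end of [L2], and the first vertex of [L2] with the last core
    vertex; both would be kept. *)
Lemma fam2_no_leg3 c0 C v1 L2 L3 : fam2_at V' M' c0 C v1 L2 L3 ->
  C <> [::] -> x \in L3 -> False.
Proof.
move=> F nC xL; have [[a1 a2 a3 [a12 a13 a23]] [uC u2 u3]] := fam2_apart F.
case: F => vs [s2 s3] [p3 ch p1] [c2 c3] [//|e3].
have L3E : L3 = [:: x].
  by case: (L3) e3 xL => [|h []] //= _; rewrite inE => /eqP->.
rewrite L3E /= in p3 p1 c2 c3.
have lC := mem_last c0 C; have l2 := last_in c0 s2.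
case: c3 => xP' _.
have P2 : par2 M x u (last c0 L2).
  apply: (keep_par_common cf ux xj0 _ (par2_r xP') (par3_2 p3) (par3_3 p3)
             (par2_l p1) (par2_r p1)).
  by apply: a1; rewrite inE eqxx.
have sC : 0 < size C by case: (C) nC.
have [p pP pL] := chain_last_cons c0 ch sC.
have [z zL zP] := chain_hd c2 s2.
have Pc : par2 M x u (last c0 C).
  apply: (keep_par cf ux xj0 (par2_l xP') (par2_l zP) (par2_r zP)).
  apply: (par2N pP); first by rewrite eq_sym; apply: a3.
  by rewrite eq_sym; apply: a23.
have := a2 _ _ lC l2.
by rewrite (keep_par_uniq (par2_l xP') Pc P2) eqxx.
Qed.

Lemma fam2_fam c0 C v1 L2 L3 : fam2_at V M c0 C v1 L2 L3 -> fam V M.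
Proof. by move=> F; constructor 2; exists c0, C, v1, L2, L3. Qed.

Lemma fam2_expand c0 C v1 L2 L3 : fam2_at V' M' c0 C v1 L2 L3 -> 1 < size L2 -> fam V M.
Proof.
move=> F l2; have xV := x_in_V' cf ux.
have [[[_ LV]] [s2 s3] _ _ alt] := F; move: xV.
rewrite LV -cat_cons -[v1 :: _]cat1s !mem_cat => /or4P[xC|xL|xL|xL].
- suff e3 : size L3 = 1.
    by have [c0' [C' F']] := fam2_core F xC l2 e3; apply: fam2_fam F'.
  case: alt => // E; rewrite E in F xC; move: xC; rewrite inE => /eqP xc.
  apply/eqP; rewrite eqn_leq ?s2 ?s3 andbT leqNgt; apply/negP => l.
  exact: fam2_two F xc l2 l.
- by move: xL; rewrite inE => /eqP /(fam2_no_leaf F).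
- by have [L2' F'] := fam2_leg F xL; apply: fam2_fam F'.
- case: (C) F => [|h C'] F; last by case: (fam2_no_leg3 F _ xL).
  by have [L3' F'] := fam2_leg (fam2_swap F) xL; apply: fam2_fam F'.
Qed.

Lemma fam3_apart (W : {set T}) N c0 C b La Lz Lc : fam3_at W N c0 C b La Lz Lc ->
  [/\ apart (c0 :: C) [:: b], apart (c0 :: C) La, apart (c0 :: C) Lz & apart (c0 :: C) Lc] /\
  [/\ [/\ apart [:: b] La, apart [:: b] Lz & apart [:: b] Lc],
      [/\ apart La Lz, apart La Lc & apart Lz Lc] &
  [/\ uniq (c0 :: C), uniq La, uniq Lz & uniq Lc]].
Proof.
case=> [[+ _]] _ _ _ _.
rewrite -cat_cons -[b :: _]cat1s => /uniq_apart[uC] /uniq_apart[_] /uniq_apart[ua /uniq_apart[uz uc aa]].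
by move=> /apart_cat[a12 a13] /apart_cat[b1 /apart_cat[b2 b3]] /apart_cat[? /apart_cat[? /apart_cat[]]].
Qed.

Section Fam3.
Variables (c0 : T) (C : seq T) (b : T) (La Lz Lc : seq T).
Hypothesis F : fam3_at V' M' c0 C b La Lz Lc.

Lemma fam3_u : [/\ u \notin c0 :: C, u != b, u \notin La & u \notin Lz /\ u \notin Lc].
Proof.
case: F => vs _ _ _ _.
move: (u_notin vs); rewrite -cat_cons -[b :: _]cat1s !mem_cat.
by case/norP=> ? /norP[]; rewrite inE => ? /norP[? /norP[]].
Qed.

(** No leg needs to be long here: the parents of [c] are [b] and a vertex of [Lz] or [Lc], never in
    the core. *)
Lemma fam3_core_par : x \in c0 :: C -> par2 M x u (last c0 Lc).
Proof.
move=> xC; have [[aCb aCa aCz aCc] [[aba abz abc] [aaz aac azc] _]] := fam3_apart F.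
case: F => vs [sa sz sc] [p3 ch pb] [ca cz cc] alt.
have [z zL zP] := chain_hd ca sa.
apply: (core_expand cf ux xj0 ch xC (par3_3 p3) _ (par2_l zP) (par2_r zP)).
have [p pP] := chain_last_cons c0 cc sc; rewrite inE => /orP pL.
apply: (par2N pP); last by apply: aCb; rewrite ?inE.
by case: pL => [/eqP->|pL]; [apply: aCz; rewrite ?last_in | apply: aCc].
Qed.

Lemma fam3_core : x \in c0 :: C -> exists c0' C', fam3_at V M c0' C' b La Lz Lc.
Proof.
move=> xC; have xP := fam3_core_par xC.
have [[aCb aCa aCz aCc] [[aba abz abc] [aaz aac azc] [uC _ _ _]]] := fam3_apart F.
have [n0 nb na [nz nc]] := fam3_u.
case: F => vs [sa sz sc] [p3 ch pb] [ca cz cc] alt.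
(* With an empty core and a longer [La], the center does not point to [a] and would have to keep it
   besides [c]. *)
have ea : size La = 1.
  case: alt => // E; apply/eqP; rewrite eqn_leq sa andbT leqNgt; apply/negP => l.
  have [z zL zP] := chain_hd cz sz.
  have Pa : par2 M x u (last c0 La).
    apply: (core_expand cf ux xj0 (w := last c0 La) (C := C) (c0 := c0) _ xC (par3_1 p3) _ (par2_l zP) (par2_r zP)).
      by rewrite E.
    have [p pP pL] := chain_last c0 ca sa; apply: (par2N pP); last by apply: aCc; rewrite // last_in.
    by case: (La) pL l aCa => [|h [|h' L]] //= pL _; apply.
  have xc : x = c0 by move: xC; rewrite E inE => /eqP.
  have M'1 : M' (last c0 La) x by rewrite {2}xc (par3_1 p3).
  have := aac _ _ (last_in c0 sa) (last_in c0 sc).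
  by rewrite (keep_par_uniq M'1 Pa xP) eqxx.
have [c0' [C' [d1 d2 d3 d4]]] := core_grow cf ux p3 ch xC uC n0 xP.
have xb : x != b by apply: aCb; rewrite ?inE.
have xa := apart_notin aCa xC; have xz := apart_notin aCz xC; have xc := apart_notin aCc xC.
exists c0', C'; split=> //.
- by apply: perm_vertices vs _; [exact: (u_in_V cf ux) | perm_from d4].
- rewrite !(@last_default _ c0' c0) //; split=> //.
  by apply: (par2_keep ux) pb; rewrite eq_sym.
- rewrite d3 !(@last_default _ c0' c0) //.
  by split; [apply: (chain_keep ux) ca | apply: (chain_keep ux) cz | apply: (chain_keep ux) cc].
- by right.
Qed.

Lemma fam3_leg_a : x \in La -> exists La', fam3_at V M c0 C b La' Lz Lc.
Proof.
move=> xL; have [[aCb aCa aCz aCc] [[aba abz abc] [aaz aac azc] [uC ua uz uc]]] := fam3_apart F.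
have [n0 nb na [nz nc]] := fam3_u.
case: F => vs [sa sz sc] [p3 ch pb] [ca cz cc] alt.
have lC := mem_last c0 C; have lz := last_in c0 sz; have lc := last_in c0 sc.
have xP : par2 M x u (last c0 Lc).
  apply: (chain_expand cf ux xj0 ca xL _ (par3_1 p3) (par3_3 p3)).
  have [p pP] := chain_last_cons c0 cc sc; rewrite inE => /orP pL.
  apply: (par2N pP); last by rewrite eq_sym; apply: aba; rewrite ?inE.
  by case: pL => [/eqP->|pL]; [apply: aaz | apply: aac].
(* With a nonempty core, [x = a] would have to keep the last core vertex besides [c]. *)
have CE : C = [::].
  case: alt => // ea; case CE: C => [|h C'] //.
  have LaE : La = [:: x].
    by case: (La) ea xL => [|h' []] //= _; rewrite inE => /eqP->.
  rewrite LaE /= in p3 pb ca cz; case: ca => xP' _.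
  have sC : 0 < size C by rewrite CE.
  have [p pP pL] := chain_last_cons c0 ch sC.
  have [z zL zP] := chain_hd cz sz.
  have Pc : par2 M x u (last c0 C).
    apply: (keep_par cf ux xj0 (par2_l xP') (par2_l zP) (par2_r zP)).
    apply: (par2N pP); first by rewrite eq_sym; apply: aCa.
    exact: aac.
  have := aCc _ _ lC lc.
  by rewrite (keep_par_uniq (par2_l xP') Pc xP) eqxx.
have [L' [d1 d2 d3 d4]] := leg_grow cf ux ca xL ua na xP.
have xC := apart_notin (apart_sym aCa) xL.
have xb : x != b by rewrite eq_sym; apply: aba; rewrite ?inE.
have xz := apart_notin aaz xL; have xc := apart_notin aac xL.
move: n0 xC; rewrite !inE !negb_or => /andP[uc0 uC'] /andP[xc0 xC'].
exists L'; split.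
- by apply: perm_vertices vs _; [exact: (u_in_V cf ux) | perm_from d2].
- by rewrite d3.
- rewrite d4; split; first by apply: (par3_keep ux) p3; rewrite eq_sym.
    exact: (chain_keep ux) ch.
  by apply: (par2_keep ux) pb; rewrite eq_sym.
- by rewrite d4; split=> //; [apply: (chain_keep ux) cz | apply: (chain_keep ux) cc].
- by left.
Qed.

Lemma fam3_leg_z : x \in Lz -> exists Lz', fam3_at V M c0 C b La Lz' Lc.
Proof.
move=> xL; have [[aCb aCa aCz aCc] [[aba abz abc] [aaz aac azc] [uC ua uz uc]]] := fam3_apart F.
have [n0 nb na [nz nc]] := fam3_u.
case: F => vs [sa sz sc] [p3 ch pb] [ca cz cc] alt.
have lC := mem_last c0 C; have la := last_in c0 sa; have lc := last_in c0 sc.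
have xP : par2 M x u (last c0 La).
  apply: (chain_expand cf ux xj0 cz xL _ (par2_r pb) (par2_l pb)).
  have [p pP] := chain_last_cons c0 ca sa; rewrite inE => /orP pL.
  apply: (par2N pP); last exact: azc.
  by rewrite eq_sym; case: pL => [/eqP->|pL]; [apply: aCz | apply: aaz].
have [L' [d1 d2 d3 d4]] := leg_grow cf ux cz xL uz nz xP.
have xC := apart_notin (apart_sym aCz) xL.
have xb : x != b by rewrite eq_sym; apply: abz; rewrite ?inE.
have xa := apart_notin (apart_sym aaz) xL; have xc := apart_notin azc xL.
move: n0 xC; rewrite !inE !negb_or => /andP[uc0 uC'] /andP[xc0 xC'].
exists L'; split.
- by apply: perm_vertices vs _; [exact: (u_in_V cf ux) | perm_from d2].
- by rewrite d3.
- rewrite d4; split; first by apply: (par3_keep ux) p3; rewrite eq_sym.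
    exact: (chain_keep ux) ch.
  by apply: (par2_keep ux) pb; rewrite eq_sym.
- by rewrite d4; split=> //; [apply: (chain_keep ux) ca | apply: (chain_keep ux) cc].
- by [].
Qed.

Lemma fam3_leg_c : x \in Lc -> exists Lc', fam3_at V M c0 C b La Lz Lc'.
Proof.
move=> xL; have [[aCb aCa aCz aCc] [[aba abz abc] [aaz aac azc] [uC ua uz uc]]] := fam3_apart F.
have [n0 nb na [nz nc]] := fam3_u.
case: F => vs [sa sz sc] [p3 ch pb] [ca cz cc] alt.
have lC := mem_last c0 C; have la := last_in c0 sa; have lz := last_in c0 sz.
have xP : par2 M x u b.
  apply: (chain_expand cf ux xj0 cc xL _ (par3_3 p3) (par3_2 p3)).
  by apply: (par2N pb); rewrite eq_sym; [apply: aac | apply: azc].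
have [L' [d1 d2 d3 d4]] := leg_grow cf ux cc xL uc nc xP.
have xC := apart_notin (apart_sym aCc) xL.
have xb : x != b by rewrite eq_sym; apply: abc; rewrite ?inE.
have xa := apart_notin (apart_sym aac) xL; have xz := apart_notin (apart_sym azc) xL.
move: n0 xC; rewrite !inE !negb_or => /andP[uc0 uC'] /andP[xc0 xC'].
exists L'; split.
- by apply: perm_vertices vs _; [exact: (u_in_V cf ux) | perm_from d2].
- by rewrite d3.
- rewrite d4; split; first by apply: (par3_keep ux) p3; rewrite eq_sym.
    exact: (chain_keep ux) ch.
  by apply: (par2_keep ux) pb; rewrite eq_sym.
- by rewrite d4; split=> //; [apply: (chain_keep ux) ca | apply: (chain_keep ux) cz].
- by [].
Qed.

(** [b] shares [c0] with [a] and the first vertex of [Lc] with [z], and would keep both. *)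
Lemma fam3_no_leaf : x = b -> False.
Proof.
move=> xE; have [[aCb aCa aCz aCc] [[aba abz abc] [aaz aac azc] [uC ua uz uc]]] := fam3_apart F.
case: F => vs [sa sz sc] [p3 ch pb] [ca cz cc] alt.
rewrite -xE in p3 pb cc aCb aba abz abc.
have xx : x \in [:: x] by rewrite inE.
have lC := mem_last c0 C; have la := last_in c0 sa; have lz := last_in c0 sz; have lc := last_in c0 sc.
have Pa : par2 M x u (last c0 La).
  apply: (keep_par cf ux xj0 (par2_l pb) (par3_1 p3) (par3_2 p3)).
  have [p pP] := chain_last_cons c0 ca sa; rewrite inE => /orP pL.
  apply: (par2N pP); last exact: abc.
  by case: pL => [/eqP->|pL]; [rewrite eq_sym; apply: aCb | apply: aba].
have [z zL zP] := chain_hd cc sc.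
have Pz : par2 M x u (last c0 Lz).
  apply: (keep_par cf ux xj0 (par2_r pb) (par2_l zP) (par2_r zP)).
  have [p pP] := chain_last_cons c0 cz sz; rewrite inE => /orP pL.
  apply: (par2N pP); last exact: aba.
  by case: pL => [/eqP->|pL]; [rewrite eq_sym; apply: aCb | apply: abz].
have := aaz _ _ la lz.
by rewrite (keep_par_uniq (par2_l pb) Pa Pz) eqxx.
Qed.

Lemma fam3_expand : fam V M.
Proof.
have xV := x_in_V' cf ux; have [[[_ LV]] _ _ _ _] := F; move: xV.
suff: x \in V' -> exists c0 C b La Lz Lc, fam3_at V M c0 C b La Lz Lc.
  by move=> H /H; constructor 3.
rewrite LV -cat_cons -[b :: _]cat1s !mem_cat => /or4P[xC|xL|xL|/orP[]xL].
- by have [c0' [C' F']] := fam3_core xC; exists c0', C', b, La, Lz, Lc.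
- by move: xL; rewrite inE => /eqP /fam3_no_leaf.
- by have [L F'] := fam3_leg_a xL; exists c0, C, b, L, Lz, Lc.
- by have [L F'] := fam3_leg_z xL; exists c0, C, b, La, L, Lc.
- by have [L F'] := fam3_leg_c xL; exists c0, C, b, La, Lz, L.
Qed.

End Fam3.

(** Symmetry moves a leg of length at least two to the front; if there is none, the configuration is
    passed on to A or B. *)
Lemma fam_expand : fam V' M' -> fam V M.
Proof.
have one (L : seq T) : 0 < size L -> ~~ (1 < size L) -> exists v, L = [:: v].
  by case: L => [|v []] // _ _; exists v.
case=> [[c0 [C [L1 [L2 [L3 F]]]]]|[c0 [C [v1 [L2 [L3 F]]]]]|[c0 [C [b [La [Lz [Lc F]]]]]]|].
- have [_ [s1 s2 s3] _ _ alt] := F.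
  have [l1|l1] := boolP (1 < size L1); first exact: (fam1_expand cf ux xj0 F).
  have [v1 E1] := one _ s1 l1.
  have [l2|l2] := boolP (1 < size L2).
    case: alt => [E|[e2 _]]; last by rewrite e2 in l2.
    by rewrite E in F; apply: (fam1_expand cf ux xj0 (fam1_rot F)).
  have [v2 E2] := one _ s2 l2.
  have [l3|l3] := boolP (1 < size L3).
    case: alt => [E|[_ e2]]; last by rewrite e2 in l3.
    by rewrite E in F; apply: (fam1_expand cf ux xj0 (fam1_rot (fam1_rot F))).
  have [v3 E3] := one _ s3 l3; rewrite E1 E2 E3 in F.
  exact: (famA_expand cf ux xj0 (fam1_famA F)).
- have [_ [s2 s3] _ _ alt] := F.
  have [l2|l2] := boolP (1 < size L2); first exact: (fam2_expand F).
  have [v2 E2] := one _ s2 l2.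
  have [l3|l3] := boolP (1 < size L3).
    case: alt => [E|e2]; last by rewrite e2 in l3.
    by rewrite E in F; apply: (fam2_expand (fam2_swap F)).
  have [v3 E3] := one _ s3 l3; rewrite E2 E3 in F.
  exact: (famB_expand cf ux xj0 (fam2_famB F)).
- exact: fam3_expand F.
case=> -[] [c0 [C [v1 [v2 [v3 F]]]]]; first exact: (famA_expand cf ux xj0 F).
exact: (famB_expand cf ux xj0 F).
Qed.

End Growth2.

Theorem config_fam (T : finType) (V : {set T}) (M : rel T) j0 :
  config V M j0 -> fam V M.
Proof.
elim: {V}#|V| {-2}V (leqnn #|V|) M j0 => [|n IH] V le M j0 cf.
  by have := cfg_j0 cf; move: le; rewrite leqn0 cards_eq0 => /eqP->; rewrite inE.
case: (pickP [pred ux : T * T | (ux.2 != j0) && [forall j, M ux.1 j == (j == ux.2)]]) =>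
    [[u x] /= /andP[xj0 /forallP H]|no].
  have ux j : M u j = (j == x) by apply/eqP.
  apply: (fam_expand cf ux xj0); apply: IH (contract_config cf ux xj0).
  by have := card_contract cf ux; move: le => /[swap] ->.
have term u x : (forall j, M u j = (j == x)) -> x = j0.
  move=> H; have := no (u, x) => /=; case: eqP => //= _ /forallP[] j.
  by rewrite H.
have vs s : uniq s -> V = [set:: s] -> vertices V s.
  by move=> us ->; split=> // v; rewrite inE.
case: (pickP [pred v | [forall j, M v j == (j == j0)]]) => [v1 /forallP H|nl].
  have S1 j : M v1 j = (j == j0) by apply/eqP.
  have [v2 [v3 [us VE p3 tl]]] := terminal_leaf cf term S1.
  constructor 4; exists false, j0, [::], v1, v2, v3; split=> //.
  by apply: vs => //; rewrite VE; apply/setP => v; rewrite !inE -!orbA.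
have two v : v \in V -> (2 <= #|ch M v|)%N.
  move=> vV; rewrite ltnNge; apply/negP => le1; have [y vy] := cfg_ch cf vV.
  have : #|ch M v| == 1 by rewrite eqn_leq le1; apply/card_gt0P; exists y; rewrite inE.
  case/cards1P => z /setP Sz.
  have Sv j : M v j = (j == z) by have := Sz j; rewrite !inE.
  have := nl v => /= /forallP[] j; by rewrite Sv (term _ _ Sv).
case: (terminal_no_leaf cf two) => [[v1 [v2 [v3 [us VE p3 tl]]]]|].
  constructor 4; exists true, j0, [::], v1, v2, v3; split=> //.
  by apply: vs => //; rewrite VE; apply/setP => v; rewrite !inE -!orbA.
case=> a [b [c [z [us VE p3 [pa pz pc pb]]]]].
constructor 3; exists j0, [::], b, [:: a], [:: z], [:: c]; split=> //.
- have p : perm_eq (j0 :: [::] ++ b :: [:: a] ++ [:: z] ++ [:: c]) [:: j0; a; b; c; z].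
    by perm_count.
  split=> [|v]; first by rewrite (perm_uniq p).
  by rewrite (perm_mem p) VE !inE -!orbA.
- by left.
Qed.

(** * Stars with three legs *)

Section Realization.
Variable T : finType.
Implicit Types (V : {set T}) (M : rel T) (v w y z j : T) (L C : seq T).

(** A version of [iso_to] relative to [V], because contraction removes vertices while the ambient
    type stays fixed. *)
Definition iso_cfg V M (dec : T -> int) (G : pgraph) (f : T -> nat) :=
  [/\ {in V &, injective f}, pg_n G = #|V|, {in V, forall v, f v < pg_n G}%N,
      {in V &, forall v w, pg_adj G (f v) (f w) = adj M v w}
    & {in V, forall v, pg_dec G (f v) = dec v}].

Lemma vertices_card V L : vertices V L -> #|V| = size L.
Proof. by case=> uL LV; rewrite -(card_uniqP uL); apply: eq_card. Qed.

Lemma leg_nth (r : rel T) c0 A l B s k : s = A ++ l ++ B -> path r c0 l -> (k < size l)%N ->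
  r (if k == 0%N then c0 else nth c0 s (size A + k).-1) (nth c0 s (size A + k)).
Proof.
move=> sE /(pathP c0) H kl; have := H k kl.
have E m : (m < size l)%N -> nth c0 s (size A + m) = nth c0 l m.
  by move=> ml; rewrite sE nth_cat ltnNge leq_addr /= addKn nth_cat ml.
case: k kl => [|k] kl /=; first by rewrite E.
by rewrite addnS /= E ?(ltnW kl) // -addnS E.
Qed.

(** Only edges along the legs are required: they form a spanning tree, and [rooted_tree] excludes
    all others. Positions in the list give exactly the numbering of [star3]. *)
Lemma star_cfg V M j0 c0 l1 l2 l3 (dec : T -> int) :
  config V M j0 -> vertices V (c0 :: l1 ++ l2 ++ l3) ->
  (0 < size l1)%N -> (0 < size l2)%N -> (0 < size l3)%N ->
  path (adj M) c0 l1 -> path (adj M) c0 l2 -> path (adj M) c0 l3 ->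
  exists f, iso_cfg V M dec (star3 (dec c0) (map dec l1) (map dec l2) (map dec l3)) f.
Proof.
move=> cf vs p1 p2 p3 P1 P2 P3; have [uL LV] := vs.
set s := c0 :: l1 ++ l2 ++ l3 in uL LV *.
pose f v := index v s.
have sN : size s = (1 + size l1 + size l2 + size l3)%N by rewrite /s /= !size_cat; lia.
pose start i := [|| i == 1%N, i == (1 + size l1)%N | i == (1 + size l1 + size l2)%N].
pose pr i := if start i then 0%N else i.-1.
have K i : (0 < i < size s)%N -> adj M (nth c0 s (pr i)) (nth c0 s i).
  case/andP=> i0 iN.
  have [i1|i1] := leqP i (size l1).
    have kl : (i.-1 < size l1)%N by lia.
    have := leg_nth (erefl : s = [:: c0] ++ l1 ++ (l2 ++ l3)) P1 kl; rewrite [size _]/= add1n prednK //.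
    rewrite /pr /start; case: (i =P 1%N) => [->|H] //=.
    have -> : (i.-1 == 0)%N = false by lia.
    have -> : (i == (1 + size l1))%N = false by lia.
    by have -> : (i == (1 + size l1 + size l2))%N = false by lia.
  have [i2|i2] := leqP i (size l1 + size l2).
    have kl : (i - (1 + size l1) < size l2)%N by lia.
    have := leg_nth (erefl : s = (c0 :: l1) ++ l2 ++ l3) P2 kl; rewrite [size (_ :: _)]/= -add1n subnKC //.
    rewrite /pr /start; have -> : (i == 1)%N = false by lia.
    have -> : (i - (1 + size l1) == 0)%N = (i == (1 + size l1))%N by lia.
    have -> : (i == (1 + size l1 + size l2))%N = false by lia.
    by case: eqP.
  have kl : (i - (1 + size l1 + size l2) < size l3)%N by lia.
  have sE : s = (c0 :: l1 ++ l2) ++ l3 ++ [::] by rewrite cats0 /s /= -catA.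
  have := leg_nth sE P3 kl; rewrite [size (_ :: _)]/= size_cat.
  have -> : ((size l1 + size l2).+1 + (i - (1 + size l1 + size l2)))%N = i by lia.
  rewrite /pr /start; have -> : (i == 1)%N = false by lia.
  have -> : (i - (1 + size l1 + size l2) == 0)%N = (i == (1 + size l1 + size l2))%N by lia.
  have -> : (i == (1 + size l1))%N = false by lia.
  by case: eqP.
have fN v : v \in V -> (f v < size s)%N by rewrite LV index_mem.
have fK v : v \in V -> nth c0 s (f v) = v by rewrite LV => /nth_index->.
have c0V : c0 \in V by rewrite LV inE eqxx.
have f0 v : v \in V -> (f v == 0%N) = (v == c0).
  by move=> _; rewrite /f /s /= [v == c0]eq_sym; case: (c0 == v).
have prlt i : (0 < i)%N -> (pr i < i)%N by rewrite /pr; case: ifP => //; lia.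
have inV i : (i < size s)%N -> nth c0 s i \in V by rewrite LV; apply: mem_nth.
pose p v := nth c0 s (pr (f v)).
have fp v : v \in V -> v != c0 -> f (p v) = pr (f v).
  move=> vV v0; rewrite /f /p index_uniq //.
  by apply: ltn_trans (fN v vV); apply: prlt; rewrite lt0n f0.
have tree := @rooted_tree _ _ _ _ cf c0 p f c0V.
have {}tree : forall v w, v \in V -> w \in V -> v != w ->
    q M v w = ((v != c0) && (p v == w) || (w != c0) && (p w == v)) :> nat.
  apply: tree => v vV v0; have f0v : (0 < f v)%N by rewrite lt0n f0.
  have ltp := prlt _ f0v.
  split; first by apply: inV; apply: ltn_trans ltp (fN v vV).
    by rewrite fp.
  have := K (f v); rewrite f0v fN // => /(_ isT) /andP[_].
  by rewrite fK // qC.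
have peq v w : v \in V -> w \in V -> v != c0 -> (p v == w) = (pr (f v) == f w).
  move=> vV wV v0; rewrite -fp //; apply/eqP/eqP => [->//|E].
  rewrite -(fK w wV) -E fK //; apply: inV.
  by apply: ltn_trans (fN v vV); apply: prlt; rewrite lt0n f0.
exists f; split.
- by move=> v w vV wV E; rewrite -(fK v vV) E fK.
- by rewrite /= !size_map (vertices_card vs) sN.
- by move=> v vV; rewrite /= !size_map -sN fN.
- move=> v w vV wV; rewrite /= !size_map -sN !fN //= -!/(start _) -!/(pr _).
  rewrite /adj; have -> : (f v != f w) = (v != w).
    by congr negb; apply/eqP/eqP => [E|->//]; rewrite -(fK v vV) E fK.
  case: (eqVneq v w) => //= vw; rewrite tree // !f0 //.
  case: (eqVneq v c0) => v0; case: (eqVneq w c0) => w0 //=.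
  + by rewrite peq //; case: (_ == _).
  + by rewrite peq // orbF; case: (_ == _).
  + by rewrite !peq //; case: (_ == _); case: (_ == _).
move=> v vV /=; rewrite f0 //; case: (eqVneq v c0) => [->//|v0].
rewrite -!map_cat (nth_map c0); last first.
  by have := fN v vV; rewrite sN !size_cat -ltnS prednK ?lt0n ?f0 //; lia.
congr dec; rewrite -[RHS](fK v vV) /s.
by have : (0 < f v)%N by [rewrite lt0n f0]; case: (f v).
Qed.

Lemma star3_range c l1 l2 l3 a b : pg_adj (star3 c l1 l2 l3) a b ->
  (a < pg_n (star3 c l1 l2 l3))%N && (b < pg_n (star3 c l1 l2 l3))%N.
Proof. by rewrite /= => /and4P[-> ->]. Qed.

(** If [w] were also a predecessor, one vertex of [L] would have equal parents and be counted twice;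
    the hypothesis on [w] excludes this. *)
Lemma count_chain M y L w v : chain M y L w -> w \notin belast y L ->
  count (M v) L = (count_mem v (belast y L) + (w == v) * size L)%N.
Proof.
elim: L y => [|h L IH] y /=; first by rewrite muln0.
case=> hP c; rewrite inE negb_or => /andP[wy wL]; rewrite (IH h) // hP.
rewrite ![v == _]eq_sym mulnS.
have : ~~ ((y == v) && (w == v)) by apply: contraNN wy => /andP[/eqP-> /eqP->].
by case: (y == v); case: (w == v) => //= _; lia.
Qed.

Lemma card_ch V M j0 L v : config V M j0 -> vertices V L -> #|ch M v| = count (M v) L.
Proof.
move=> cf [uL LV]; rewrite -size_filter -(card_uniqP (filter_uniq _ uL)).
apply: eq_card => j; rewrite inE mem_filter -LV.
by case: (boolP (M v j)) => // /(cfg_sub cf)/andP[_ ->].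
Qed.

Lemma card_cm V M j0 L v w : config V M j0 -> vertices V L ->
  cm M v w = count (fun j => M v j && M w j) L.
Proof.
move=> cf [uL LV]; rewrite -size_filter -(card_uniqP (filter_uniq _ uL)).
apply: eq_card => j; rewrite !inE mem_filter -LV.
by case: (boolP (M v j)) => // /(cfg_sub cf)/andP[_ ->]; rewrite andbT.
Qed.

Section Adjacency.
Variables (V : {set T}) (M : rel T) (j0 : T).
Hypothesis cf : config V M j0.

Lemma M_neq v w : M v w -> v != w.
Proof. by apply: contraTneq => ->; rewrite (cfg_irr cf). Qed.

(** The arrow survives in [q] because the only possible common child is compensated by the reverse
    arrow. *)
Lemma adj_intro y x j : M y x -> (forall k, M y k -> M x k -> k = j /\ M x y) -> adj M y x.
Proof.
move=> yx H; have ne := M_neq yx; rewrite /adj ne /=.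
have := q_cm cf ne; rewrite yx.
have : (cm M y x <= M x y)%N; last by move: (M x y) (cm _ _ _) => [] /=; lia.
case: (boolP (M x y)) => [xy|nxy].
  apply: (@leq_trans #|[set j]|); last by rewrite cards1.
  apply/subset_leq_card/subsetP => k; rewrite !inE.
  by case/andP=> yk xk; have [-> _] := H k yk xk.
rewrite leqn0 cards_eq0; apply/eqP/setP => k; rewrite !inE; apply/negP => /andP[yk xk].
by have [_ xy] := H k yk xk; rewrite xy in nxy.
Qed.

Lemma adj_disjoint y x : M y x -> (forall k, M y k -> M x k -> False) -> adj M y x.
Proof. by move=> yx H; apply: (@adj_intro _ _ x yx) => k yk /(H k yk). Qed.

Lemma single_child y x k : #|ch M y| = 1 -> M y x -> M y k -> k = x.
Proof.
move/eqP/cards1P => [z /setP E] yx yk.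
have := E x; have := E k; rewrite !inE yx yk => /esym/eqP-> /esym/eqP->//.
Qed.

Lemma adj_single y x : #|ch M y| = 1 -> M y x -> adj M y x.
Proof.
move=> y1 yx; apply: adj_disjoint => // k yk xk.
by move: xk; rewrite (single_child y1 yx yk) (cfg_irr cf).
Qed.

Lemma chain_path y L w : chain M y L w ->
  (forall v, v \in belast y L -> #|ch M v| = 1) -> path (adj M) y L.
Proof.
elim: L y => //= h L IH y [hP c] H; apply/andP; split.
  by apply: adj_single (par2_l hP); apply: H; rewrite inE eqxx.
by apply: IH c _ => v vL; apply: H; rewrite inE vL orbT.
Qed.

End Adjacency.

Lemma chain_par_in M y L w v j : chain M y L w -> j \in L -> M v j ->
  v \in w :: belast y L.
Proof.
elim: L y => //= h L IH y [hP c]; rewrite [j \in _]inE => /orP[/eqP->|jL vj].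
  by rewrite hP !inE orbC => /orP[->|->]; rewrite ?orbT.
by have := IH h c jL vj; rewrite !inE => /orP[->//|->]; rewrite !orbT.
Qed.

Lemma chain_child M y h L w j : chain M y (h :: L) w -> uniq (y :: h :: L) ->
  y != w -> j \in h :: L -> M y j -> j = h.
Proof.
rewrite inE => -[_ c] /andP[yn _] yw /orP[/eqP//|jL] yj.
suff : (y == w) || (y \in h :: L) by rewrite (negbTE yw) (negbTE yn).
elim: L h c jL {yn} => //= h' L IH h [hP c]; rewrite inE => /orP[/eqP E|jL].
  by move: yj; rewrite E hP inE orbCA => /orP[->|->]; rewrite ?orbT.
by have := IH h' c jL; rewrite !inE => /or3P[] ->; rewrite ?orbT.
Qed.

End Realization.

Lemma iso_cfg_iso_to n (e : rel 'I_n) (d : 'I_n -> int) (M : rel 'I_n) (G : pgraph) (f : 'I_n -> nat) :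
  (forall u v, e u v = adj M u v) -> iso_cfg setT M d G f -> iso_to e d G.
Proof.
move=> eE [fi fn fl fa fd]; split; first by rewrite fn cardsT card_ord.
exists f; split.
- by move=> u v; apply: fi; rewrite inE.
- by move=> v; have := fl v (in_setT v); rewrite fn cardsT card_ord.
- by move=> u v; rewrite eE fa ?inE.
- by move=> v; rewrite fd ?inE.
Qed.

Lemma count_mem_rcons (T : eqType) (v x : T) (l : seq T) :
  count_mem v (rcons l x) = (count_mem v l + (x == v))%N.
Proof. by rewrite -cats1 count_cat /= addn0. Qed.

Lemma count_mem_gt0 (T : eqType) (v : T) (l : seq T) : v \in l -> (0 < count_mem v l)%N.
Proof. by rewrite -has_pred1 has_count. Qed.

(** Each equality test between vertices becomes an unknown bit, and all values are tried; the fact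
    that a vertex occurs once in the list discards the inconsistent ones. *)
Ltac eval_count := rewrite /= ?(count_cat, count_mem_rcons) /= ?(count_cat, count_mem_rcons) /= ?eqxx;
  repeat match goal with |- context [nat_of_bool (?a == ?b)] =>
     let e := fresh in move: (a == b) => e; destruct e; rewrite ?mul1n ?mul0n /= end;
  lia.

(** * The first family as stars: W and Lambda_{p,q,0} *)

Section Stars.
Variable T : finType.
Implicit Types (V : {set T}) (M : rel T) (v w y z j : T) (L C : seq T).

Definition dec M v : int := (- (#|ch M v|.+1)%:Z)%R.

Lemma map_dec M (l : seq T) : (forall v, v \in l -> #|ch M v| = 1) ->
  map (dec M) l = m2chain (size l).
Proof.
elim: l => //= h l IH H; rewrite IH => [|v vl]; last by apply: H; rewrite inE vl orbT.
by rewrite /dec H ?inE ?eqxx.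
Qed.

Lemma vertices_count V L v : vertices V L -> v \in V -> count_mem v L = 1.
Proof. by case=> uL LV vV; rewrite count_uniq_mem // -LV vV. Qed.

Section F1.
Variables (V : {set T}) (M : rel T) (j0 : T).
Hypothesis cf : config V M j0.

Lemma fam1_count c0 C l1 l2 l3 v1 v2 v3 v :
  fam1_at V M c0 C (rcons l1 v1) (rcons l2 v2) (rcons l3 v3) ->
  #|ch M v| = ([|| v1 == v, v2 == v | v3 == v] + (count_mem v (belast c0 C) + (v1 == v) * size C)
     + (count_mem v (last c0 C :: l1) + (v3 == v) * (size l1).+1)
     + (count_mem v (last c0 C :: l2) + (v1 == v) * (size l2).+1)
     + (count_mem v (last c0 C :: l3) + (v2 == v) * (size l3).+1))%N.
Proof.
move=> F; have [[a1 a2 a3 [a12 a13 a23]] [uC u1 u2 u3]] := fam1_apart F.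
case: F => vs; rewrite !last_rcons => _ [p3 ch] [c1 c2 c3] _.
have lC := mem_last c0 C.
have m1 : v1 \in rcons l1 v1 by rewrite mem_rcons mem_head.
have m2 : v2 \in rcons l2 v2 by rewrite mem_rcons mem_head.
have m3 : v3 \in rcons l3 v3 by rewrite mem_rcons mem_head.
have ni l w z : z \notin last c0 C :: rcons l w -> z \notin belast (last c0 C) (rcons l w).
  by rewrite belast_rcons -rcons_cons mem_rcons inE negb_or => /andP[].
rewrite (card_ch v cf vs) -cat_cons !count_cat /= p3 ![v == _]eq_sym.
rewrite (count_chain v ch); last first.
  by apply: contraNN (apart_notin (apart_sym a1) m1); rewrite lastI mem_rcons inE => ->; rewrite orbT.
rewrite (count_chain v c1); last first.
  by apply: ni; rewrite inE negb_or (apart_notin (apart_sym a13) m3) eq_sym (a3 _ _ lC m3).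
rewrite (count_chain v c2); last first.
  by apply: ni; rewrite inE negb_or (apart_notin a12 m1) eq_sym (a1 _ _ lC m1).
rewrite (count_chain v c3); last first.
  by apply: ni; rewrite inE negb_or (apart_notin a23 m2) eq_sym (a2 _ _ lC m2).
by rewrite !belast_rcons !size_rcons !addnA.
Qed.

Lemma core_child c0 C w k : chain M c0 C w -> uniq (c0 :: C) -> last c0 C != w ->
  ~~ M (last c0 C) c0 -> k \in c0 :: C -> ~~ M (last c0 C) k.
Proof.
move=> ch uC cw nc; rewrite inE => /orP[/eqP->//|kC]; apply/negP => ck.
have := chain_par_in ch kC ck; rewrite inE (negbTE cw) /=.
by apply/negP; move: uC; rewrite lastI rcons_uniq => /andP[].
Qed.

(** The children of the last core vertex are the first vertices of the legs. Among these [h1] can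
    point only to the one in [L2], and only if [h1] is the end [v1]; the arrow from [v1] to the last
    core vertex then compensates. *)
Lemma fam1_adj_head c0 C h1 L1 L2 L3 : fam1_at V M c0 C (h1 :: L1) L2 L3 ->
  M (last c0 (h1 :: L1)) (last c0 C) -> adj M (last c0 C) h1.
Proof.
move=> F; have [[a1 a2 a3 [a12 a13 a23]] [uC u1 u2 u3]] := fam1_apart F.
case: F => vs [s1 s2 s3] [p3 ch] [c1 c2 c3] _ v1c.
have [_ LV] := vs.
have lC := mem_last c0 C.
have l1 : last c0 (h1 :: L1) \in h1 :: L1 := last_in c0 s1.
have l2 := last_in c0 s2; have l3 := last_in c0 s3.
have h1L : h1 \in h1 :: L1 by rewrite inE eqxx.
have ne L z : apart (c0 :: C) L -> z \in L -> last c0 C != z by move=> a; apply: a.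
have core k := core_child (k := k) ch uC (ne _ _ a1 l1).
move: (last c0 C) c1 c2 c3 v1c lC ne core => ce c1 c2 c3 v1c lC ne core.
have [h2 [L2' E2]] : exists h L', L2 = h :: L' by case: (L2) s2 => // h L' _; exists h, L'.
have [h3 [L3' E3]] : exists h L', L3 = h :: L' by case: (L3) s3 => // h L' _; exists h, L'.
subst L2 L3.
have M1 : M ce h1 by case: c1 => /par2_l.
apply: (adj_intro cf (j := h2)) => // k ck hk.
have uy L : apart (c0 :: C) L -> uniq L -> uniq (ce :: L).
  by move=> a u; rewrite /= u andbT; apply: (apart_notin a lC).
have : k \in V by case/andP: (cfg_sub cf ck).
rewrite LV -cat_cons !mem_cat => /or4P[kC|k1|k2|k3].
- have nc : ~~ M ce c0 by rewrite p3 (negbTE (ne _ _ a1 l1)) (negbTE (ne _ _ a2 l2)) (negbTE (ne _ _ a3 l3)).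
  by have := core _ nc kC; rewrite ck.
- have E := chain_child c1 (uy _ a1 u1) (ne _ _ a3 l3) k1 ck.
  by move: hk; rewrite E (cfg_irr cf).
- have E := chain_child c2 (uy _ a2 u2) (ne _ _ a1 l1) k2 ck; split=> //.
  case: c2 => hP _; move: hk; rewrite E hP => /orP[/eqP E'|/eqP E'].
    by have := ne _ _ a1 h1L; rewrite E' eqxx.
  by rewrite E'.
have E := chain_child c3 (uy _ a3 u3) (ne _ _ a2 l2) k3 ck.
case: c3 => hP _; move: hk; rewrite E hP => /orP[/eqP E'|/eqP E'].
  by have := ne _ _ a1 h1L; rewrite E' eqxx.
by have := a12 _ _ h1L l2; rewrite E' eqxx.
Qed.

Lemma leg_path y l v w : chain M y (rcons l v) w -> (forall z, z \in l -> #|ch M z| = 1) ->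
  adj M y (head y (rcons l v)) -> path (adj M) y (rcons l v).
Proof.
case E: (rcons l v) => [|h L] //= [_ c] H ->; apply: (chain_path cf c) => z zL; apply: H.
by have := lastI h L; rewrite -E => /rcons_inj[-> _].
Qed.

Lemma dec_eq v k : #|ch M v| = k -> dec M v = (- (k.+1)%:Z)%R.
Proof. by rewrite /dec => ->. Qed.

Lemma perm_same_vertices L L' : vertices V L -> perm_eq L' L -> vertices V L'.
Proof. by case=> uL LV p; split=> [|v]; rewrite ?(perm_uniq p) ?LV ?(perm_mem p). Qed.

Lemma fam1_adj c0 C l1 L2 L3 v1 : fam1_at V M c0 C (rcons l1 v1) L2 L3 ->
  M v1 (last c0 C) -> adj M (last c0 C) (head (last c0 C) (rcons l1 v1)).
Proof.
case E: (rcons l1 v1) => [|h L] F vc /=; first by case: (l1) E.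
by apply: (fam1_adj_head F); rewrite -E last_rcons.
Qed.

(** The only child of [c0] is the next core vertex, whose parents are [c0] and [w], so nothing
    cancels the arrow from [v]. This attaches the one-vertex legs to the center. *)
Lemma adj_core c0 C' ce w v : #|ch M c0| = 1 -> chain M c0 (rcons C' ce) w ->
  M v c0 -> v != w -> adj M c0 v.
Proof.
move=> c1 ch vc vw; have [z zC zP] : exists2 z, z \in rcons C' ce & par2 M z c0 w.
  by apply: chain_hd ch _; rewrite size_rcons.
rewrite adjC; apply: (adj_disjoint cf vc) => k vk ck.
have E := single_child c1 (par2_l zP) ck.
by move: vk; rewrite E zP (negbTE vw) (negbTE (M_neq cf vc)).
Qed.

Lemma fam1_W c0 L1 L2 L3 : fam1_at V M c0 [::] L1 L2 L3 ->
  exists p q r f, iso_cfg V M (dec M) (Gamma_pqr p q r) f.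
Proof.
move=> F; have [_ [s1 s2 s3] _ _ _] := F.
case/lastP: L1 s1 F => // l1 v1 _; case/lastP: L2 s2 => // l2 v2 _.
case/lastP: L3 s3 => // l3 v3 _ F.
have cnt v := fam1_count v F; have [vs _ [p3 _] [c1 c2 c3] _] := F.
have U v := vertices_count (v := v) vs; have [_ LV] := vs.
have e1 v : v \in l1 -> #|ch M v| = 1.
  move=> vl; have := count_mem_gt0 vl; have vV : v \in V by rewrite LV inE !mem_cat !mem_rcons !inE vl !orbT.
  move: (cnt v) (U v vV); clear; eval_count.
have e2 v : v \in l2 -> #|ch M v| = 1.
  move=> vl; have := count_mem_gt0 vl; have vV : v \in V by rewrite LV inE !mem_cat !mem_rcons !inE vl !orbT.
  move: (cnt v) (U v vV); clear; eval_count.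
have e3 v : v \in l3 -> #|ch M v| = 1.
  move=> vl; have := count_mem_gt0 vl; have vV : v \in V by rewrite LV inE !mem_cat !mem_rcons !inE vl !orbT.
  move: (cnt v) (U v vV); clear; eval_count.
have ev1 : #|ch M v1| = ((size l2).+2)%N.
  have vV : v1 \in V by rewrite LV inE !mem_cat !mem_rcons !inE eqxx !orbT.
  move: (cnt v1) (U v1 vV); clear; eval_count.
have ev2 : #|ch M v2| = ((size l3).+2)%N.
  have vV : v2 \in V by rewrite LV inE !mem_cat !mem_rcons !inE eqxx !orbT.
  move: (cnt v2) (U v2 vV); clear; eval_count.
have ev3 : #|ch M v3| = ((size l1).+2)%N.
  have vV : v3 \in V by rewrite LV inE !mem_cat !mem_rcons !inE eqxx !orbT.
  move: (cnt v3) (U v3 vV); clear; eval_count.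
have ec : #|ch M c0| = 3.
  have vV : c0 \in V by rewrite LV inE eqxx.
  move: (cnt c0) (U c0 vV); clear; eval_count.
rewrite !last_rcons in p3.
have P1 : path (adj M) c0 (rcons l1 v1).
  by apply: leg_path c1 e1 _; apply: (fam1_adj F (par3_1 p3)).
have P2 : path (adj M) c0 (rcons l2 v2).
  by apply: leg_path c2 e2 _; apply: (fam1_adj (fam1_rot F) (par3_2 p3)).
have P3 : path (adj M) c0 (rcons l3 v3).
  by apply: leg_path c3 e3 _; apply: (fam1_adj (fam1_rot (fam1_rot F)) (par3_3 p3)).
(* The last two legs are exchanged: the end of a leg records the length of the next leg here, and of
   the preceding one in [Gamma_pqr]. *)
have vs' : vertices V (c0 :: rcons l1 v1 ++ rcons l3 v3 ++ rcons l2 v2).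
  by apply: perm_same_vertices vs _; perm_count.
have [f fP] : exists f, iso_cfg V M (dec M) (star3 (dec M c0) (map (dec M) (rcons l1 v1))
     (map (dec M) (rcons l3 v3)) (map (dec M) (rcons l2 v2))) f.
  by apply: (star_cfg _ cf vs'); rewrite ?size_rcons.
exists (size l2), (size l1), (size l3), f; suff -> : Gamma_pqr (size l2) (size l1) (size l3)
   = star3 (dec M c0) (map (dec M) (rcons l1 v1))
     (map (dec M) (rcons l3 v3)) (map (dec M) (rcons l2 v2)) by [].
rewrite !map_rcons -!cats1 !map_dec // (dec_eq ec) (dec_eq ev1) (dec_eq ev2) (dec_eq ev3).
rewrite /Gamma_pqr; congr (star3 _ (_ ++ [:: _]) (_ ++ [:: _]) (_ ++ [:: _])); lia.
Qed.

Lemma fam1_M c0 C L1 L2 L3 : fam1_at V M c0 C L1 L2 L3 -> C <> [::] ->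
  exists p q f, iso_cfg V M (dec M) (Lambda_pqr p.+1 q 0) f.
Proof.
move=> F nC; have [_ [s1 s2 s3] _ _ [//|[z2 z3]]] := F.
case/lastP: C nC F => // C ce _.
case/lastP: L1 s1 => // l1 v1 _; case: L2 z2 {s2} => // v2 [] // _.
case: L3 z3 {s3} => // v3 [] // _ F.
have cnt v := fam1_count (l2 := [::]) (l3 := [::]) v F; have [vs _ [p3 cC] [c1 c2 c3] _] := F.
have U v := vertices_count (v := v) vs; have [_ LV] := vs.
have e1 v : v \in l1 -> #|ch M v| = 1.
  move=> vl; have := count_mem_gt0 vl; have vV : v \in V by rewrite LV inE !mem_cat !mem_rcons !inE vl !orbT.
  by move: (cnt v) (U v vV); rewrite belast_rcons last_rcons; clear; eval_count.
have eC v : v \in c0 :: C -> #|ch M v| = 1.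
  move=> vl; have := count_mem_gt0 vl; have vV : v \in V.
    by rewrite LV -cat_cons -rcons_cons mem_cat mem_rcons [v \in ce :: _]inE vl orbT.
  by move: (cnt v) (U v vV); rewrite belast_rcons last_rcons; clear; eval_count.
have ev1 : #|ch M v1| = ((size C).+3)%N.
  have vV : v1 \in V by rewrite LV inE !mem_cat !mem_rcons !inE eqxx !orbT.
  by move: (cnt v1) (U v1 vV); rewrite belast_rcons last_rcons size_rcons; clear; eval_count.
have ev2 : #|ch M v2| = 2.
  have vV : v2 \in V by rewrite LV inE !mem_cat !mem_rcons !inE eqxx !orbT.
  by move: (cnt v2) (U v2 vV); rewrite belast_rcons last_rcons; clear; eval_count.
have ev3 : #|ch M v3| = ((size l1).+2)%N.
  have vV : v3 \in V by rewrite LV inE !mem_cat !mem_rcons !inE eqxx !orbT.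
  by move: (cnt v3) (U v3 vV); rewrite belast_rcons last_rcons; clear; eval_count.
have ece : #|ch M ce| = 3.
  have vV : ce \in V by rewrite LV inE !mem_cat !mem_rcons !inE eqxx !orbT.
  by move: (cnt ce) (U ce vV); rewrite belast_rcons last_rcons; clear; eval_count.
have ec : #|ch M c0| = 1 by apply: eC; rewrite inE eqxx.
have [[a1 a2 a3 [a12 a13 a23]] _] := fam1_apart F.
rewrite !last_rcons /= in p3 cC c1 c2 c3.
have m1 : v1 \in rcons l1 v1 by rewrite mem_rcons mem_head.
have A2 : adj M c0 v2.
  apply: adj_core ec cC (par3_2 p3) _.
  by rewrite eq_sym; apply: a12; rewrite ?inE.
have A3 : adj M c0 v3.
  apply: adj_core ec cC (par3_3 p3) _.
  by rewrite eq_sym; apply: a13; rewrite ?inE.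
have P : path (adj M) c0 (rcons C ce ++ rcons l1 v1).
  rewrite cat_path last_rcons; apply/andP; split.
    by apply: (chain_path cf cC) => v; rewrite belast_rcons => /eC.
  apply: leg_path c1 e1 _; have := fam1_adj F; rewrite last_rcons; apply.
  by apply: chain_sub_par cC _; rewrite mem_rcons mem_head.
have vs' : vertices V (c0 :: [:: v3] ++ [:: v2] ++ rcons C ce ++ rcons l1 v1).
  by apply: perm_same_vertices vs _; perm_count.
have [f fP] : exists f, iso_cfg V M (dec M) (star3 (dec M c0) (map (dec M) [:: v3])
     (map (dec M) [:: v2]) (map (dec M) (rcons C ce ++ rcons l1 v1))) f.
  by apply: (star_cfg _ cf vs'); rewrite /= ?A2 ?A3 // size_cat !size_rcons.
(* [C] now lacks its last vertex [ce], which carries the -4 between the two chains of -2. *)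
exists (size l1), (size C), f; move: fP; congr (iso_cfg _ _ _ _ _).
have eC' v : v \in C -> #|ch M v| = 1 by move=> vC; rewrite eC // inE vC orbT.
rewrite map_cat !map_rcons -!cats1 (map_dec e1) (map_dec eC').
rewrite /= (dec_eq ec) (dec_eq ev1) (dec_eq ev2) (dec_eq ev3) (dec_eq ece).
rewrite /Lambda_pqr /= -catA; congr (star3 _ [:: _] [:: _] (_ ++ [:: _] ++ _ ++ [:: _])); lia.
Qed.

End F1.
End Stars.

(** * The second family as stars: Delta_{0,q,r} and Lambda_{0,q,r} *)

Section Stars2.
Variable T : finType.
Implicit Types (v w y z j : T) (L C : seq T).
Variables (V : {set T}) (M : rel T) (j0 : T).
Hypothesis cf : config V M j0.

Lemma belast_rcons_notin y l w z : z \notin y :: rcons l w -> z \notin belast y (rcons l w).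
Proof. by rewrite belast_rcons -rcons_cons mem_rcons inE negb_or => /andP[]. Qed.

Lemma belast_core_notin c0 C z : z \notin c0 :: C -> z \notin belast c0 C.
Proof. by rewrite lastI mem_rcons inE negb_or => /andP[]. Qed.

Lemma fam2_count c0 C v1 l2 l3 v2 v3 v :
  fam2_at V M c0 C v1 (rcons l2 v2) (rcons l3 v3) ->
  #|ch M v| = ([|| v1 == v, v2 == v | v3 == v] + (count_mem v (belast c0 C) + (v2 == v) * size C)
     + ((v2 == v) || (v3 == v))
     + (count_mem v (last c0 C :: l2) + (v3 == v) * (size l2).+1)
     + (count_mem v (last c0 C :: l3) + (v2 == v) * (size l3).+1))%N.
Proof.
move=> F; have [[a1 a2 a3 [a12 a13 a23]] [uC u2 u3]] := fam2_apart F.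
case: F => vs; rewrite !last_rcons => _ [p3 ch p1] [c2 c3] _.
have lC := mem_last c0 C.
have m2 : v2 \in rcons l2 v2 by rewrite mem_rcons mem_head.
have m3 : v3 \in rcons l3 v3 by rewrite mem_rcons mem_head.
rewrite (card_ch v cf vs) -cat_cons !count_cat /= !count_cat p3 p1 ![v == _]eq_sym.
rewrite (count_chain v ch) ?(count_chain v c2) ?(count_chain v c3).
- by rewrite !belast_rcons !size_rcons !addnA.
- by apply: belast_rcons_notin; rewrite inE negb_or (apart_notin a23 m2) eq_sym (a2 _ _ lC m2).
- by apply: belast_rcons_notin; rewrite inE negb_or (apart_notin (apart_sym a23) m3) eq_sym (a3 _ _ lC m3).
- exact: belast_core_notin (apart_notin (apart_sym a2) m2).
Qed.

(** The only possible common child is the first vertex of [L3], shared when [h2] is the end of its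
    leg, and compensated by the assumed arrow. *)
Lemma fam2_adj_head c0 C v1 h2 L2 L3 : fam2_at V M c0 C v1 (h2 :: L2) L3 ->
  M (last c0 (h2 :: L2)) (last c0 C) -> adj M (last c0 C) h2.
Proof.
move=> F; have [[a1 a2 a3 [a12 a13 a23]] [uC u2 u3]] := fam2_apart F.
case: F => vs [s2 s3] [p3 ch p1] [c2 c3] _ v2c.
have [_ LV] := vs.
have lC := mem_last c0 C.
have l2 : last c0 (h2 :: L2) \in h2 :: L2 := last_in c0 s2.
have l3 := last_in c0 s3.
have h2L : h2 \in h2 :: L2 by rewrite inE eqxx.
have ne L z : apart (c0 :: C) L -> z \in L -> last c0 C != z by move=> a; apply: a.
have core k := core_child (k := k) ch uC (ne _ _ a2 l2).
move: (last c0 C) c2 c3 v2c lC ne core => ce c2 c3 v2c lC ne core.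
have [h3 [L3' E3]] : exists h L', L3 = h :: L' by case: (L3) s3 => // h L' _; exists h, L'.
subst L3.
have M1 : M ce h2 by case: c2 => /par2_l.
apply: (adj_intro cf (j := h3)) => // k ck hk.
have uy L : apart (c0 :: C) L -> uniq L -> uniq (ce :: L).
  by move=> a u; rewrite /= u andbT; apply: (apart_notin a lC).
have : k \in V by case/andP: (cfg_sub cf ck).
rewrite LV -cat_cons -[v1 :: _]cat1s !mem_cat => /or4P[kC|k1|k2|k3].
- have nc : ~~ M ce c0.
    by rewrite p3 (negbTE (ne _ v1 a1 _)) ?inE // (negbTE (ne _ _ a2 l2)) (negbTE (ne _ _ a3 l3)).
  by have := core _ nc kC; rewrite ck.
- move: k1 ck; rewrite inE => /eqP->.
  by rewrite p1 (negbTE (ne _ _ a2 l2)) (negbTE (ne _ _ a3 l3)).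
- have E := chain_child c2 (uy _ a2 u2) (ne _ _ a3 l3) k2 ck.
  by move: hk; rewrite E (cfg_irr cf).
have E := chain_child c3 (uy _ a3 u3) (ne _ _ a2 l2) k3 ck; split=> //.
case: c3 => hP _; move: hk; rewrite E hP => /orP[/eqP E'|/eqP E'].
  by have := ne _ _ a2 h2L; rewrite E' eqxx.
by rewrite E'.
Qed.

Lemma fam2_adj c0 C v1 l2 L3 v2 : fam2_at V M c0 C v1 (rcons l2 v2) L3 ->
  M v2 (last c0 C) -> adj M (last c0 C) (head (last c0 C) (rcons l2 v2)).
Proof.
case E: (rcons l2 v2) => [|h L] F vc /=; first by case: (l2) E.
by apply: (fam2_adj_head F); rewrite -E last_rcons.
Qed.

Lemma fam2_N c0 v1 L2 L3 : fam2_at V M c0 [::] v1 L2 L3 ->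
  exists p q r f, iso_cfg V M (dec M) (Delta_pqr p q r) f.
Proof.
move=> F; have [_ [s2 s3] _ _ _] := F.
case/lastP: L2 s2 F => // l2 v2 _.
case/lastP: L3 s3 => // l3 v3 _ F.
have cnt v := fam2_count v F; have [vs _ [p3 _ _] [c2 c3] _] := F.
have U v := vertices_count (v := v) vs; have [_ LV] := vs.
have e2 v : v \in l2 -> #|ch M v| = 1.
  move=> vl; have := count_mem_gt0 vl; have vV : v \in V by rewrite LV !inE !mem_cat !mem_rcons !inE vl !orbT.
  move: (cnt v) (U v vV); clear; eval_count.
have e3 v : v \in l3 -> #|ch M v| = 1.
  move=> vl; have := count_mem_gt0 vl; have vV : v \in V by rewrite LV !inE !mem_cat !mem_rcons !inE vl !orbT.
  move: (cnt v) (U v vV); clear; eval_count.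
have ev1 : #|ch M v1| = 1.
  have vV : v1 \in V by rewrite LV !inE !mem_cat !mem_rcons !inE eqxx !orbT.
  move: (cnt v1) (U v1 vV); clear; eval_count.
have ev2 : #|ch M v2| = ((size l3).+3)%N.
  have vV : v2 \in V by rewrite LV !inE !mem_cat !mem_rcons !inE eqxx !orbT.
  move: (cnt v2) (U v2 vV); clear; eval_count.
have ev3 : #|ch M v3| = ((size l2).+3)%N.
  have vV : v3 \in V by rewrite LV !inE !mem_cat !mem_rcons !inE eqxx !orbT.
  move: (cnt v3) (U v3 vV); clear; eval_count.
have ec : #|ch M c0| = 2.
  have vV : c0 \in V by rewrite LV inE eqxx.
  move: (cnt c0) (U c0 vV); clear; eval_count.
rewrite !last_rcons in p3.
have P1 : adj M c0 v1 by rewrite adjC; apply: (adj_single cf ev1 (par3_1 p3)).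
have P2 : path (adj M) c0 (rcons l2 v2).
  by apply: (leg_path cf c2 e2 _); apply: (fam2_adj F (par3_2 p3)).
have P3 : path (adj M) c0 (rcons l3 v3).
  by apply: (leg_path cf c3 e3 _); apply: (fam2_adj (fam2_swap F) (par3_3 p3)).
have vs' : vertices V (c0 :: [:: v1] ++ rcons l2 v2 ++ rcons l3 v3) by [].
have [f fP] : exists f, iso_cfg V M (dec M) (star3 (dec M c0) (map (dec M) [:: v1])
     (map (dec M) (rcons l2 v2)) (map (dec M) (rcons l3 v3))) f.
  by apply: (star_cfg _ cf vs'); rewrite /= ?P1 ?size_rcons.
exists 0, (size l2), (size l3), f; move: fP; congr (iso_cfg _ _ _ _ _).
rewrite !map_rcons -!cats1 (map_dec e2) (map_dec e3) /=.
rewrite (dec_eq ec) (dec_eq ev1) (dec_eq ev2) (dec_eq ev3).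
rewrite /Delta_pqr /=; congr (star3 _ _ (_ ++ [:: _]) (_ ++ [:: _])); lia.
Qed.

Lemma fam2_M c0 C v1 L2 L3 : fam2_at V M c0 C v1 L2 L3 -> C <> [::] ->
  exists q r f, iso_cfg V M (dec M) (Lambda_pqr 0 q r.+1) f.
Proof.
move=> F nC; have [_ [s2 s3] _ _ [//|z3]] := F.
case/lastP: C nC F => // C ce _.
case/lastP: L2 s2 => // l2 v2 _.
case: L3 z3 {s3} => // v3 [] // _ F.
have cnt v := fam2_count (l3 := [::]) v F; have [vs _ [p3 cC _] [c2 c3] _] := F.
have U v := vertices_count (v := v) vs; have [_ LV] := vs.
have e2 v : v \in l2 -> #|ch M v| = 1.
  move=> vl; have := count_mem_gt0 vl; have vV : v \in V by rewrite LV inE !mem_cat in_cons !mem_cat !mem_rcons !inE vl !orbT.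
  by move: (cnt v) (U v vV); rewrite belast_rcons last_rcons; clear; eval_count.
have eC v : v \in c0 :: C -> #|ch M v| = 1.
  move=> vl; have := count_mem_gt0 vl; have vV : v \in V.
    by rewrite LV -cat_cons -rcons_cons mem_cat mem_rcons [v \in ce :: _]inE vl orbT.
  by move: (cnt v) (U v vV); rewrite belast_rcons last_rcons; clear; eval_count.
have ev1 : #|ch M v1| = 1.
  have vV : v1 \in V by rewrite LV inE !mem_cat in_cons !mem_cat !mem_rcons !inE eqxx !orbT.
  by move: (cnt v1) (U v1 vV); rewrite belast_rcons last_rcons; clear; eval_count.
have ev2 : #|ch M v2| = ((size C).+4)%N.
  have vV : v2 \in V by rewrite LV inE !mem_cat in_cons !mem_cat !mem_rcons !inE eqxx !orbT.
  by move: (cnt v2) (U v2 vV); rewrite belast_rcons last_rcons size_rcons; clear; eval_count.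
have ev3 : #|ch M v3| = ((size l2).+3)%N.
  have vV : v3 \in V by rewrite LV inE !mem_cat in_cons !mem_cat !mem_rcons !inE eqxx !orbT.
  by move: (cnt v3) (U v3 vV); rewrite belast_rcons last_rcons; clear; eval_count.
have ece : #|ch M ce| = 2.
  have vV : ce \in V by rewrite LV inE !mem_cat in_cons !mem_cat !mem_rcons !inE eqxx !orbT.
  by move: (cnt ce) (U ce vV); rewrite belast_rcons last_rcons; clear; eval_count.
have ec : #|ch M c0| = 1 by apply: eC; rewrite inE eqxx.
have [[a1 a2 a3 [a12 a13 a23]] _] := fam2_apart F.
rewrite !last_rcons /= in p3 cC c2 c3.
have m2 : v2 \in rcons l2 v2 by rewrite mem_rcons mem_head.
have A1 : adj M c0 v1 by rewrite adjC; apply: (adj_single cf ev1 (par3_1 p3)).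
have A3 : adj M c0 v3.
  apply: (adj_core cf ec cC (par3_3 p3)).
  by rewrite eq_sym; apply: a23; rewrite ?inE.
have P : path (adj M) c0 (rcons C ce ++ rcons l2 v2).
  rewrite cat_path last_rcons; apply/andP; split.
    by apply: (chain_path cf cC) => v; rewrite belast_rcons => /eC.
  apply: (leg_path cf c2 e2); have := fam2_adj F; rewrite last_rcons; apply.
  by apply: chain_sub_par cC _; rewrite mem_rcons mem_head.
have vs' : vertices V (c0 :: [:: v1] ++ [:: v3] ++ rcons C ce ++ rcons l2 v2).
  by apply: perm_same_vertices vs _; perm_count.
have [f fP] : exists f, iso_cfg V M (dec M) (star3 (dec M c0) (map (dec M) [:: v1])
     (map (dec M) [:: v3]) (map (dec M) (rcons C ce ++ rcons l2 v2))) f.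
  by apply: (star_cfg _ cf vs'); rewrite /= ?A1 ?A3 // size_cat !size_rcons.
exists (size C), (size l2), f; move: fP; congr (iso_cfg _ _ _ _ _).
have eC' v : v \in C -> #|ch M v| = 1 by move=> vC; rewrite eC // inE vC orbT.
rewrite map_cat !map_rcons -!cats1 (map_dec e2) (map_dec eC').
rewrite /= (dec_eq ec) (dec_eq ev1) (dec_eq ev2) (dec_eq ev3) (dec_eq ece).
rewrite /Lambda_pqr /= -catA; congr (star3 _ [:: _] [:: _] (_ ++ _ :: _ ++ [:: _])); lia.
Qed.

End Stars2.

(** * The third family as stars: Delta and Lambda with positive parameters *)

Section Stars3.
Variable T : finType.
Implicit Types (v w y z j : T) (L C : seq T).
Variables (V : {set T}) (M : rel T) (j0 : T).
Hypothesis cf : config V M j0.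

Lemma fam3_count c0 C b la lz lc a z c v :
  fam3_at V M c0 C b (rcons la a) (rcons lz z) (rcons lc c) ->
  #|ch M v| = ([|| a == v, b == v | c == v] + (count_mem v (belast c0 C) + (c == v) * size C)
     + ((a == v) || (z == v))
     + (count_mem v (last c0 C :: la) + (c == v) * (size la).+1)
     + (count_mem v (last c0 C :: lz) + (a == v) * (size lz).+1)
     + (count_mem v (z :: lc) + (b == v) * (size lc).+1))%N.
Proof.
move=> F; have [[aCb aCa aCz aCc] [[aba abz abc] [aaz aac azc] [uC ua uz uc]]] := fam3_apart F.
case: F => vs; rewrite !last_rcons => _ [p3 ch pb] [ca cz cc] _.
have lC := mem_last c0 C.
have ma : a \in rcons la a by rewrite mem_rcons mem_head.
have mz : z \in rcons lz z by rewrite mem_rcons mem_head.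
have mc : c \in rcons lc c by rewrite mem_rcons mem_head.
have mb : b \in [:: b] by rewrite inE.
rewrite (card_ch v cf vs) -cat_cons !count_cat /= !count_cat p3 pb ![v == _]eq_sym.
rewrite (count_chain v ch) ?(count_chain v ca) ?(count_chain v cz) ?(count_chain v cc).
- by rewrite !belast_rcons !size_rcons !addnA.
- by apply: belast_rcons_notin; rewrite inE negb_or (apart_notin abc mb) (abz _ _ mb mz).
- by apply: belast_rcons_notin; rewrite inE negb_or (apart_notin aaz ma) eq_sym (aCa _ _ lC ma).
- by apply: belast_rcons_notin; rewrite inE negb_or (apart_notin (apart_sym aac) mc) eq_sym (aCc _ _ lC mc).
- exact: belast_core_notin (apart_notin (apart_sym aCc) mc).
Qed.

Section Edges.
Variables (c0 : T) (C : seq T) (b : T) (La Lz Lc : seq T).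
Hypothesis F : fam3_at V M c0 C b La Lz Lc.

Lemma fam3_mem k : k \in V -> [\/ k \in c0 :: C, k = b, k \in La | k \in Lz \/ k \in Lc].
Proof.
case: F => -[_ ->] _ _ _ _; rewrite -cat_cons -[b :: _]cat1s !mem_cat.
case/or4P => [|/[!inE]/eqP||/orP[]]; by [constructor 1|constructor 2|constructor 3|constructor 4; left|constructor 4; right].
Qed.

(** There is no third child, because [Lc] starts at the end of [Lz] and not at the core. *)
Lemma fam3_last_child k : M (last c0 C) k ->
  [\/ k = head c0 La | k = head c0 Lz].
Proof.
have [[aCb aCa aCz aCc] [[aba abz abc] [aaz aac azc] [uC ua uz uc]]] := fam3_apart F.
case: (F) => vs [sa sz sc] [p3 ch pb] [ca cz cc] _ ck.
have lC := mem_last c0 C.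
have lc := last_in c0 sc; have lz := last_in c0 sz; have la := last_in c0 sa.
have ne L y : apart (c0 :: C) L -> y \in L -> last c0 C != y by move=> A; apply: A.
have nb : last c0 C != b by apply: ne aCb _; rewrite inE.
have core := core_child (k := k) ch uC (ne _ _ aCc lc).
have uy L : apart (c0 :: C) L -> uniq L -> uniq (last c0 C :: L).
  by move=> A u; rewrite /= u andbT; apply: (apart_notin A lC).
case: (fam3_mem (k := k)) => [|kC|kb|ka|[kz|kc]].
- by case/andP: (cfg_sub cf ck).
- have nc : ~~ M (last c0 C) c0.
    by rewrite p3 (negbTE (ne _ _ aCa la)) (negbTE nb) (negbTE (ne _ _ aCc lc)).
  by move: (core nc kC); rewrite ck.
- by move: ck; rewrite kb pb (negbTE (ne _ _ aCa la)) (negbTE (ne _ _ aCz lz)).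
- left; move: ca ua ka uy; case: (La) aCa => // h L aCa ca ua ka uy.
  exact: chain_child ca (uy _ aCa ua) (ne _ _ aCc lc) ka ck.
- right; move: cz uz kz uy; case: (Lz) aCz => // h L aCz cz uz kz uy.
  exact: chain_child cz (uy _ aCz uz) (ne _ _ aCa la) kz ck.
have := chain_par_in cc kc ck; rewrite inE (negbTE nb) /= => H.
have : last c0 C \in last c0 Lz :: Lc by rewrite lastI mem_rcons inE H orbT.
by rewrite inE (negbTE (ne _ _ aCz lz)) (negbTE (apart_notin aCc lC)).
Qed.

(** The first vertices of [La] and [Lz] are joined by an arrow only if the former is the end [a];
    then the assumed arrow back to the core compensates. *)
Lemma fam3_adj_a : M (last c0 La) (last c0 C) -> adj M (last c0 C) (head c0 La).
Proof.
move=> ac; have [[aCb aCa aCz aCc] [[aba abz abc] [aaz aac azc] [uC ua uz uc]]] := fam3_apart F.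
case: (F) => vs [sa sz sc] [p3 ch pb] [ca cz cc] _.
have lC := mem_last c0 C.
have ha : head c0 La \in La by case: (La) sa => //= h L _; rewrite inE eqxx.
have caP : par2 M (head c0 La) (last c0 C) (last c0 Lc) by case: (La) sa ca => //= h L _ [].
have czP : par2 M (head c0 Lz) (last c0 C) (last c0 La) by case: (Lz) sz cz => //= h L _ [].
apply: (adj_intro cf (j := head c0 Lz) (par2_l caP)) => k /fam3_last_child[] -> ak.
  by rewrite (cfg_irr cf) in ak.
split=> //; move: ak; rewrite czP => /orP[/eqP E|/eqP->//].
by have := aCa _ _ lC ha; rewrite E eqxx.
Qed.

Lemma fam3_adj_z : adj M (last c0 C) (head c0 Lz).
Proof.
have [[aCb aCa aCz aCc] [[aba abz abc] [aaz aac azc] [uC ua uz uc]]] := fam3_apart F.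
case: (F) => vs [sa sz sc] [p3 ch pb] [ca cz cc] _.
have lC := mem_last c0 C.
have hz : head c0 Lz \in Lz by case: (Lz) sz => //= h L _; rewrite inE eqxx.
have caP : par2 M (head c0 La) (last c0 C) (last c0 Lc) by case: (La) sa ca => //= h L _ [].
have czP : par2 M (head c0 Lz) (last c0 C) (last c0 La) by case: (Lz) sz cz => //= h L _ [].
apply: (adj_disjoint cf (par2_l czP)) => k /fam3_last_child[] -> ak; last first.
  by rewrite (cfg_irr cf) in ak.
move: ak; rewrite caP => /orP[/eqP E|/eqP E].
  by have := aCz _ _ lC hz; rewrite E eqxx.
by have := azc _ _ hz (last_in c0 sc); rewrite E eqxx.
Qed.

Lemma fam3_adj_c : adj M (last c0 Lz) (head c0 Lc).
Proof.
have [[aCb aCa aCz aCc] [[aba abz abc] [aaz aac azc] [uC ua uz uc]]] := fam3_apart F.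
case: (F) => vs [sa sz sc] [p3 ch pb] [ca cz cc] _.
have lC := mem_last c0 C.
have bb : b \in [:: b] by rewrite inE.
have lc := last_in c0 sc; have lz := last_in c0 sz; have la := last_in c0 sa.
have hc : head c0 Lc \in Lc by case: (Lc) sc => //= h L _; rewrite inE eqxx.
have ccP : par2 M (head c0 Lc) (last c0 Lz) b by case: (Lc) sc cc => //= h L _ [].
have za : (last c0 Lz == last c0 La) = false by apply/negbTE; rewrite eq_sym; apply: aaz.
have zc : (last c0 Lz == last c0 Lc) = false by apply/negbTE; apply: azc.
have zb : (last c0 Lz == b) = false by apply/negbTE; rewrite eq_sym; apply: abz.
apply: (adj_disjoint cf (par2_l ccP)) => k zk hk.
case: (fam3_mem (k := k)) => [|kC|kb|ka|[kz|kc]].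
- by case/andP: (cfg_sub cf zk).
- move: kC zk; rewrite inE => /orP[/eqP->|kC zk]; first by rewrite p3 za zb zc.
  have := chain_par_in ch kC zk; rewrite inE zc /= => /mem_belast zC.
  by have := aCz _ _ zC lz; rewrite eqxx.
- move: hk; rewrite kb pb => /orP[] /eqP E.
    by have := aac _ _ la hc; rewrite E eqxx.
  by have := azc _ _ lz hc; rewrite E eqxx.
- have := chain_par_in ca ka zk; rewrite inE zc /= => /mem_belast.
  rewrite inE => /orP[/eqP E|E].
    by have := aCz _ _ lC lz; rewrite E eqxx.
  by have := aaz _ _ E lz; rewrite eqxx.
- have := chain_par_in cz kz zk; rewrite inE za /=.
  have : uniq (last c0 C :: Lz) by rewrite /= uz andbT; apply: (apart_notin aCz lC).
  rewrite lastI rcons_uniq => /andP[+ _].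
  by rewrite (last_default _ c0 sz) => /negbTE->.
have E : k = head c0 Lc.
  move: cc uc kc azc; case: (Lc) => // h L cc uc kc azc.
  apply: chain_child cc _ _ kc zk; last by rewrite zb.
  by rewrite cons_uniq uc (apart_notin azc lz).
by rewrite E (cfg_irr cf) in hk.
Qed.

(** Apart from [c0], the children of [b] are the vertices of [Lc], and [c0] points to none of
    them. *)
Lemma fam3_adj_b : adj M c0 b.
Proof.
have [[aCb aCa aCz aCc] [[aba abz abc] [aaz aac azc] [uC ua uz uc]]] := fam3_apart F.
case: (F) => vs [sa sz sc] [p3 ch pb] [ca cz cc] _.
have lC := mem_last c0 C; have c0C := mem_head c0 C.
have bb : b \in [:: b] by rewrite inE.
have lc := last_in c0 sc; have lz := last_in c0 sz; have la := last_in c0 sa.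
rewrite adjC; apply: (adj_disjoint cf (par3_2 p3)) => k bk ck.
have nbC y : y \in c0 :: C -> (b == y) = false.
  by move=> yC; apply/negbTE; rewrite eq_sym; apply: aCb.
have nbL L y : apart [:: b] L -> y \in L -> (b == y) = false by move=> A yL; apply/negbTE/A.
case: (fam3_mem (k := k)) => [|kC|kb|ka|[kz|kc]].
- by case/andP: (cfg_sub cf bk).
- move: kC; rewrite inE => /orP[/eqP E|kC]; first by rewrite E (cfg_irr cf) in ck.
  have := chain_par_in ch kC bk; rewrite inE (nbL _ _ abc lc) /= => /mem_belast bC.
  by have := nbC _ bC; rewrite eqxx.
- by rewrite kb (cfg_irr cf) in bk.
- have := chain_par_in ca ka bk; rewrite inE (nbL _ _ abc lc) /= => /mem_belast.
  rewrite inE => /orP[E|E]; first by rewrite (nbC _ lC) in E.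
  by have := nbL _ _ aba E; rewrite eqxx.
- have := chain_par_in cz kz bk; rewrite inE (nbL _ _ aba la) /= => /mem_belast.
  rewrite inE => /orP[E|E]; first by rewrite (nbC _ lC) in E.
  by have := nbL _ _ abz E; rewrite eqxx.
have := chain_par_in cc kc ck; rewrite inE => /orP[/eqP E|/mem_belast].
  by have := nbC _ c0C; rewrite E eqxx.
rewrite inE => /orP[/eqP E|E].
  by have := aCz _ _ c0C lz; rewrite -E eqxx.
by have := aCc _ _ c0C E; rewrite eqxx.
Qed.

End Edges.

Lemma fam3_N c0 b La Lz Lc : fam3_at V M c0 [::] b La Lz Lc ->
  exists p q r f, iso_cfg V M (dec M) (Delta_pqr p q r) f.
Proof.
move=> F; have [_ [sa sz sc] _ _ _] := F.
case/lastP: La sa F => // la a _; case/lastP: Lz sz => // lz z _.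
case/lastP: Lc sc => // lc c _ F.
have cnt v := fam3_count v F; have [vs _ [p3 _ _] [ca cz cc] _] := F.
have U v := vertices_count (v := v) vs; have [_ LV] := vs.
have mV v : (v \in V) = [|| v == c0, v == b, v == a, v \in la, v == z, v \in lz, v == c | v \in lc].
  by rewrite LV !inE !mem_cat !mem_rcons !inE -!orbA.
have ea v : v \in la -> #|ch M v| = 1.
  move=> vl; have := count_mem_gt0 vl; have vV : v \in V by rewrite mV vl !orbT.
  move: (cnt v) (U v vV); clear; eval_count.
have ez v : v \in lz -> #|ch M v| = 1.
  move=> vl; have := count_mem_gt0 vl; have vV : v \in V by rewrite mV vl !orbT.
  move: (cnt v) (U v vV); clear; eval_count.
have ecc v : v \in lc -> #|ch M v| = 1.
  move=> vl; have := count_mem_gt0 vl; have vV : v \in V by rewrite mV vl !orbT.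
  move: (cnt v) (U v vV); clear; eval_count.
have eb : #|ch M b| = ((size lc).+2)%N.
  have vV : b \in V by rewrite mV eqxx !orbT.
  move: (cnt b) (U b vV); clear; eval_count.
have eva : #|ch M a| = ((size lz).+3)%N.
  have vV : a \in V by rewrite mV eqxx !orbT.
  move: (cnt a) (U a vV); clear; eval_count.
have evz : #|ch M z| = 2.
  have vV : z \in V by rewrite mV eqxx !orbT.
  move: (cnt z) (U z vV); clear; eval_count.
have evc : #|ch M c| = ((size la).+2)%N.
  have vV : c \in V by rewrite mV eqxx !orbT.
  move: (cnt c) (U c vV); clear; eval_count.
have ec : #|ch M c0| = 2.
  have vV : c0 \in V by rewrite mV eqxx.
  move: (cnt c0) (U c0 vV); clear; eval_count.
have A1 := fam3_adj_a F; have A2 := fam3_adj_z F; have A3 := fam3_adj_c F.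
have A4 := fam3_adj_b F.
have hd d d' (l : seq T) x : head d (rcons l x) = head d' (rcons l x) by case: l.
rewrite !last_rcons /= in p3 ca cz cc A1 A2 A3.
have Pa : path (adj M) c0 (rcons la a).
  by apply: (leg_path cf ca ea); apply: A1 (par3_1 p3).
have Pz : path (adj M) c0 (rcons lz z ++ rcons lc c).
  rewrite cat_path last_rcons (leg_path cf cz ez) //=.
  by apply: (leg_path cf cc ecc); rewrite (hd _ c0).
have vs' : vertices V (c0 :: [:: b] ++ rcons la a ++ rcons lz z ++ rcons lc c) by [].
have [f fP] : exists f, iso_cfg V M (dec M) (star3 (dec M c0) (map (dec M) [:: b])
     (map (dec M) (rcons la a)) (map (dec M) (rcons lz z ++ rcons lc c))) f.
  by apply: (star_cfg _ cf vs'); rewrite /= ?A4 ?size_cat ?size_rcons.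
exists (size lc).+1, (size lz), (size la), f; move: fP; congr (iso_cfg _ _ _ _ _).
rewrite map_cat !map_rcons -!cats1 (map_dec ea) (map_dec ez) (map_dec ecc) /=.
rewrite (dec_eq ec) (dec_eq eb) (dec_eq eva) (dec_eq evz) (dec_eq evc).
rewrite /Delta_pqr /= -catA; congr (star3 _ [:: _] (_ ++ [:: _]) (_ ++ _ :: _ ++ [:: _])); lia.
Qed.

Lemma fam3_M c0 C b La Lz Lc : fam3_at V M c0 C b La Lz Lc -> C <> [::] ->
  exists p q r f, iso_cfg V M (dec M) (Lambda_pqr p.+1 q r.+1) f.
Proof.
move=> F nC; have [_ [sa sz sc] _ _ [//|ea]] := F.
case/lastP: C nC F => // C ce _.
case: La ea {sa} => // a [] // _.
case/lastP: Lz sz => // lz z _; case/lastP: Lc sc => // lc c _ F.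
have cnt v := fam3_count (la := [::]) v F; have [vs _ [p3 cC _] [ca cz cc] _] := F.
have U v := vertices_count (v := v) vs; have [_ LV] := vs.
have mV v : (v \in V) = [|| v \in c0 :: C, v == ce, v == b, v == a, v == z, v \in lz, v == c | v \in lc].
  rewrite LV inE mem_cat mem_rcons inE [v \in b :: _]inE !mem_cat !mem_rcons !inE -!orbA.
  by do !bool_congr.
have eC v : v \in c0 :: C -> #|ch M v| = 1.
  move=> vl; have := count_mem_gt0 vl; have vV : v \in V by rewrite mV vl.
  move: (cnt v) (U v vV); rewrite belast_rcons last_rcons; clear; eval_count.
have ez v : v \in lz -> #|ch M v| = 1.
  move=> vl; have := count_mem_gt0 vl; have vV : v \in V by rewrite mV vl !orbT.
  move: (cnt v) (U v vV); rewrite belast_rcons last_rcons; clear; eval_count.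
have ecc v : v \in lc -> #|ch M v| = 1.
  move=> vl; have := count_mem_gt0 vl; have vV : v \in V by rewrite mV vl !orbT.
  move: (cnt v) (U v vV); rewrite belast_rcons last_rcons; clear; eval_count.
have eb : #|ch M b| = ((size lc).+2)%N.
  have vV : b \in V by rewrite mV eqxx !orbT.
  move: (cnt b) (U b vV); rewrite belast_rcons last_rcons; clear; eval_count.
have eva : #|ch M a| = ((size lz).+3)%N.
  have vV : a \in V by rewrite mV eqxx !orbT.
  move: (cnt a) (U a vV); rewrite belast_rcons last_rcons; clear; eval_count.
have evz : #|ch M z| = 2.
  have vV : z \in V by rewrite mV eqxx !orbT.
  move: (cnt z) (U z vV); rewrite belast_rcons last_rcons; clear; eval_count.
have evc : #|ch M c| = ((size C).+3)%N.
  have vV : c \in V by rewrite mV eqxx !orbT.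
  move: (cnt c) (U c vV); rewrite belast_rcons last_rcons size_rcons; clear; eval_count.
have ece : #|ch M ce| = 2.
  have vV : ce \in V by rewrite mV eqxx !orbT.
  move: (cnt ce) (U ce vV); rewrite belast_rcons last_rcons; clear; eval_count.
have ec : #|ch M c0| = 1 by apply: eC; rewrite inE eqxx.
have [_ [_ [_ aac _] _]] := fam3_apart F.
have A2 := fam3_adj_z F; have A3 := fam3_adj_c F.
have A4 := fam3_adj_b F.
have hd d d' (l : seq T) x : head d (rcons l x) = head d' (rcons l x) by case: l.
rewrite !last_rcons /= in p3 cC ca cz cc A2 A3.
have Aa : adj M c0 a.
  apply: (adj_core cf ec cC (par3_1 p3)).
  by apply: aac; rewrite ?inE // mem_rcons mem_head.
have P : path (adj M) c0 (rcons C ce ++ rcons lz z ++ rcons lc c).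
  rewrite !cat_path !last_rcons; apply/and3P; split.
  - by apply: (chain_path cf cC) => v; rewrite belast_rcons => /eC.
  - by apply: (leg_path cf cz ez); rewrite (hd _ c0).
  - by apply: (leg_path cf cc ecc); rewrite (hd _ c0).
have vs' : vertices V (c0 :: [:: b] ++ [:: a] ++ rcons C ce ++ rcons lz z ++ rcons lc c).
  by apply: perm_same_vertices vs _; perm_count.
have [f fP] : exists f, iso_cfg V M (dec M) (star3 (dec M c0) (map (dec M) [:: b])
     (map (dec M) [:: a]) (map (dec M) (rcons C ce ++ rcons lz z ++ rcons lc c))) f.
  by apply: (star_cfg _ cf vs'); rewrite /= ?A4 ?Aa ?size_cat ?size_rcons.
exists (size lc), (size C), (size lz), f; move: fP; congr (iso_cfg _ _ _ _ _).
have eC' v : v \in C -> #|ch M v| = 1 by move=> vC; rewrite eC // inE vC orbT.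
rewrite !map_cat !map_rcons -!cats1 (map_dec eC') (map_dec ez) (map_dec ecc) /=.
rewrite (dec_eq ec) (dec_eq eb) (dec_eq eva) (dec_eq evz) (dec_eq evc) (dec_eq ece).
rewrite /Lambda_pqr /= -!catA.
congr (star3 _ [:: _] [:: _] (_ ++ _ :: _ ++ _ :: _ ++ [:: _])); lia.
Qed.

End Stars3.

(** * Blow-ups *)

(** A blow-up numbers its new vertex [pg_n G], so this number must not occur in the old
    adjacency. *)
Definition pg_wf (G : pgraph) :=
  forall a b, pg_adj G a b -> (a < pg_n G)%N && (b < pg_n G)%N.

Section Peeling.
Variable T : finType.
Implicit Types (V : {set T}) (M : rel T) (u v w x y z j D : T) (L C E : seq T).

(** During the blow-ups the last exceptional vertex has decoration -1; its true decoration [dec M x]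
    is restored only at the end. *)
Definition dec1 M x v : int := if v == x then (-1)%R else dec M v.

Lemma prox_par_in M E y L v j : prox M E y L -> j \in L -> M v j -> v \in E ++ belast y L.
Proof.
elim: L E y => //= h L IH E y [hP c]; rewrite inE => /orP[/eqP->|jL vj].
  case: hP => [->|[D DE ->]]; rewrite mem_cat inE; first by move=> ->; rewrite orbT.
  by case/orP=> [->|/eqP->]; rewrite ?DE ?orbT.
by have := IH _ _ c jL vj; rewrite !mem_cat !inE -orbA orbCA.
Qed.

Lemma prox_rconsE M E y L x : prox M E y L -> (par1 M x (last y L) \/
     exists2 D, D \in E ++ belast y L & par2 M x (last y L) D) -> prox M E y (rcons L x).
Proof.
elim: L E y => [|h L IH] E y /=; first by rewrite cats0; tauto.
case=> hP c xP; split=> //; apply: IH c _; case: xP => [|[D DE DP]]; [by left | right].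
by exists D => //; move: DE; rewrite !mem_cat !inE -orbA orbCA.
Qed.

Section Last.
Variables (b : bool) (V : {set T}) (M : rel T) (j0 c0 : T) (C : seq T) (v1 v2 v3 : T).
Hypotheses (cf : config V M j0) (F : famX_at b V M c0 C v1 v2 v3).
Let x := last c0 C.

Lemma famX_last_child j : j \in c0 :: C -> ~~ M x j.
Proof.
case: F => vs p3 pr _; have [uC A _] := fam_core_facts vs; have lC := mem_last c0 C.
have nv v : v \in [:: v1; v2; v3] -> x != v by apply: A.
rewrite inE => /orP[/eqP->|jC].
  by rewrite p3 !negb_or !nv // !inE eqxx ?orbT.
apply/negP => xj; have := prox_par_in pr jC xj; rewrite mem_cat => /orP[/nv|xB].
  by rewrite eqxx.
by have := belast_nlast uC xB; rewrite eqxx.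
Qed.

Lemma famX_tail_par w j : j \in [:: v1; v2; v3] -> M w j -> w \in x :: [:: v1; v2; v3].
Proof.
case: F => _ _ _; rewrite /tail !inE; case: (b) => -[q1 q2 q3] /or3P[] /eqP->;
  rewrite ?q1 ?q2 ?q3 => /orP[] ->; by rewrite ?orbT.
Qed.

(* The neighbours of the last exceptional vertex are its parents: each other
   arrow at x is compensated by exactly one common child. *)
Lemma famX_last_adj w : w \in V -> w != x -> adj M w x = M w x.
Proof.
move=> wV wx; have := q_cm cf wx; rewrite /adj wx /=.
case: (F) => vs p3 pr tl; have [uC A [n12 n13 n23]] := fam_core_facts vs.
have lC := mem_last c0 C.
have nv v : v \in [:: v1; v2; v3] -> x != v by apply: A.
have [x1 x2 x3] : [/\ x != v1, x != v2 & x != v3] by rewrite !nv // !inE eqxx ?orbT.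
rewrite (card_cm w x cf vs) -cat_cons count_cat.
have -> : count (fun j => M w j && M x j) (c0 :: C) = 0.
  apply/eqP; rewrite -leqn0 leqNgt -has_count; apply/hasPn => j jC.
  by rewrite negb_and famX_last_child ?orbT.
suff -> : count (fun j => M w j && M x j) [:: v1; v2; v3] = M x w.
  by move: (M w x) (M x w) (q M w x) => [] []; clear; lia.
move: wV; have [_ ->] := vs; rewrite -cat_cons mem_cat => /orP[wC|wv].
  rewrite (negbTE (famX_last_child wC)); have nw v : v \in [:: v1; v2; v3] -> (w == v) = false.
    by move=> vv; apply/negbTE; apply: A.
  have [w1 w2 w3] : [/\ (w == v1) = false, (w == v2) = false & (w == v3) = false].
    by rewrite !nw // !inE eqxx ?orbT.
  rewrite /=; move: tl; rewrite /tail; case: (b) => -[q1 q2 q3];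
    by rewrite q1 q2 q3 -/x (negbTE wx) ?w1 ?w2 ?w3.
have [y1 y2 y3] : [/\ v1 != x, v2 != x & v3 != x] by rewrite ![_ == x]eq_sym x1 x2 x3.
have [m12 m13 m23] : [/\ v2 != v1, v3 != v1 & v3 != v2].
  by rewrite ![_ == v1]eq_sym (eq_sym v3) n12 n13 n23.
have N := (negbTE x1, negbTE x2, negbTE x3, negbTE y1, negbTE y2, negbTE y3,
  (negbTE n12, negbTE n13, negbTE n23, negbTE m12, negbTE m13, negbTE m23)).
move: tl wv; rewrite /tail /= -/x !inE; case: (b) => -[q1 q2 q3] /or3P[] /eqP->;
  by rewrite !q1 !q2 !q3 !eqxx ?N.
Qed.

End Last.

(** Every vertex has a child, so all decorations other than that of [x] are at most -2; that [f]
    reaches every number follows by cardinality. *)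
Lemma unique_m1_last V M j0 x G f : config V M j0 -> x \in V ->
  iso_cfg V M (dec1 M x) G f -> unique_m1 G (f x).
Proof.
move=> cf xV [fi fn fl fa fd]; split; first exact: fl.
  by rewrite fd // /dec1 eqxx.
move=> k kn; have [v vV ->] : exists2 v, v \in V & k = f v.
  have u : uniq (map f (enum V)).
    by rewrite map_inj_in_uniq ?enum_uniq // => v w; rewrite !mem_enum; apply: fi.
  have sub : {subset map f (enum V) <= iota 0 (pg_n G)}.
    by move=> _ /mapP[v vV ->]; rewrite mem_iota /= add0n fl // -mem_enum.
  have sz : size (iota 0 (pg_n G)) <= size (map f (enum V)).
    by rewrite size_map size_iota fn -cardE.
  have [_ E] := uniq_min_size u sub sz.
  have : k \in map f (enum V) by rewrite E mem_iota.
  by case/mapP=> v; rewrite mem_enum; exists v.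
rewrite fd // /dec1; case: (eqVneq v x) => [->//|_] /eqP.
have [j vj] := cfg_ch cf vV.
have : (0 < #|ch M v|)%N by apply/card_gt0P; exists j; rewrite inE.
by rewrite /dec; clear; lia.
Qed.

Lemma star_wf c l1 l2 l3 : pg_wf (star3 c l1 l2 l3).
Proof. by move=> a b /star3_range. Qed.

Lemma blowup_vertex_wf G (u : nat) : pg_wf G -> (u < pg_n G)%N -> pg_wf (blowup_vertex G u).
Proof.
move=> wf un a b /=; case/or3P => [/wf/andP[] ? ?|/andP[/eqP-> /eqP->]|/andP[/eqP-> /eqP->]].
all: by apply/andP; split; lia.
Qed.

Lemma blowup_edge_wf G (u w : nat) : pg_wf G -> (u < pg_n G)%N -> (w < pg_n G)%N ->
  pg_wf (blowup_edge G u w).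
Proof.
move=> wf un wn a b /=; case/or3P => [/andP[/wf/andP[] ? ? _]|/andP[/eqP-> /orP[]/eqP->]|/andP[/eqP-> /orP[]/eqP->]].
all: by apply/andP; split; lia.
Qed.

Lemma famX_base b V M j0 c0 v1 v2 v3 : config V M j0 ->
  famX_at b V M c0 [::] v1 v2 v3 ->
  exists f, iso_cfg V M (dec1 M c0) (if b then T_a else T_b) f.
Proof.
move=> cf F; have [vs p3 _ tl] := F.
have [_ A [n12 n13 n23]] := fam_core_facts vs.
have nv v : v \in [:: v1; v2; v3] -> (v == c0) = false.
  by move=> H; apply/negbTE; rewrite eq_sym; apply: A => //; rewrite inE.
have [d1 d2 d3] : [/\ (v1 == c0) = false, (v2 == c0) = false & (v3 == c0) = false].
  by rewrite !nv // !inE eqxx ?orbT.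
have [_ LV] := vs.
have ad v : v \in [:: v1; v2; v3] -> adj M c0 v.
  move=> vv; rewrite adjC (famX_last_adj cf F) /=.
  - by move: vv; rewrite p3 !inE.
  - by rewrite LV inE vv orbT.
  - by rewrite nv.
have [A1 A2 A3] : [/\ adj M c0 v1, adj M c0 v2 & adj M c0 v3].
  by rewrite !ad // !inE eqxx ?orbT.
have nn : [/\ (v1 == v2) = false, (v1 == v3) = false & (v2 == v3) = false].
  by rewrite !(negbTE n12, negbTE n13, negbTE n23).
have [m12 m13 m23] := nn.
have m21 : (v2 == v1) = false by rewrite eq_sym.
have m31 : (v3 == v1) = false by rewrite eq_sym.
have m32 : (v3 == v2) = false by rewrite eq_sym.
case: b F tl => F /= [q1 q2 q3].
  have [f fP] := star_cfg (dec1 M c0) cf (vs : vertices V (c0 :: [:: v1] ++ [:: v2] ++ [:: v3]))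
     isT isT isT (introT andP (conj A1 isT)) (introT andP (conj A2 isT)) (introT andP (conj A3 isT)).
  exists f; move: fP; congr (iso_cfg _ _ _ _ _).
  rewrite /= /dec1 !eqxx d1 d2 d3 /dec !(card_ch _ cf vs) /= !p3 !q1 !q2 !q3.
  by rewrite !eqxx ?d1 ?d2 ?d3 ?m12 ?m13 ?m23 ?m21 ?m31 ?m32.
(* [T_b] lists the leaf of decoration -2 last, and this leaf is [v1]. *)
have vs' : vertices V (c0 :: [:: v2] ++ [:: v3] ++ [:: v1]).
  by apply: perm_same_vertices vs _; perm_count.
have [f fP] := star_cfg (dec1 M c0) cf vs'
     isT isT isT (introT andP (conj A2 isT)) (introT andP (conj A3 isT)) (introT andP (conj A1 isT)).
exists f; move: fP; congr (iso_cfg _ _ _ _ _).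
rewrite /= /dec1 !eqxx d1 d2 d3 /dec !(card_ch _ cf vs) /= !p3 !q1 !q2 !q3.
by rewrite !eqxx ?d1 ?d2 ?d3 ?m12 ?m13 ?m23 ?m21 ?m31 ?m32.
Qed.

(** * A single blow-up, read off from a contraction *)

Section Step.
Variables (V : {set T}) (M : rel T) (j0 u x : T).
Hypotheses (cf : config V M j0) (ux : forall j, M u j = (j == x)) (xj0 : x != j0).
Hypothesis adjx : forall w, w \in V -> w != x -> adj M w x = M w x.
Local Notation M' := (contract M u x).
Local Notation V' := (V :\ u).
Variables (G : pgraph) (f' : T -> nat).
Hypotheses (wf : pg_wf G) (iso : iso_cfg V' M' (dec1 M' x) G f').

(** The contraction calls the merged vertex [x], but after the blow-up the old -1 vertex is [u] and
    the new one is [x]. So [u] inherits the number of the merged vertex and [x] gets the new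
    number. *)
Definition relabel v := if v == x then pg_n G else if v == u then f' x else f' v.

(** The term [M v x] is the decrease of the decoration by one at the second end of a blown-up
    edge. *)
Lemma ch_contract v : v != u -> #|ch M v| = (#|ch M' v| + M v x)%N.
Proof.
move=> vu; have xu := ctr_xu cf ux.
rewrite -(sum_pred (M v)) -(sum_pred (M' v)).
have D (g : T -> nat) : (\sum_j g j = g x + (g u + \sum_(j | (j != x) && (j != u)) g j))%N.
  by rewrite (bigD1 x) //= (bigD1 u) //= eq_sym.
rewrite !D (M'xE cf ux) M'_u (eq_bigr (fun j => M' v j : nat)); first by clear; lia.
by move=> j /andP[jx ju]; rewrite (M'E ux).
Qed.

Lemma adj_contract v w : v != u -> v != x -> w != u -> w != x -> adj M' v w = adj M v w.
Proof.
move=> vu vx wu wx; rewrite /adj; case: (eqVneq v w) => //= vw.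
by rewrite (q_ctr cf ux xj0).
Qed.

Lemma adj_contract_x w : w \in V -> w != u -> w != x ->
  adj M' w x = adj M u w || M w x.
Proof.
move=> wV wu wx; rewrite -(adjx wV wx) /adj wx eq_sym wu /= (q_ctr_x cf ux) // addn_gt0 orbC.
by rewrite [q M w x]qC.
Qed.

(** Matches the deletion of the blown-up edge: by [q_u] a parent of [u] is not both its neighbour
    and a parent of [x]. *)
Lemma adj_u w : w != u -> w != x -> M w x -> adj M u w = false.
Proof.
move=> wu wx Mwx; have := q_u cf ux wu wx; have := Mxu_sub cf ux wu Mwx.
by rewrite /adj Mwx => ->; case: (q M u w) => [|k] /=; rewrite ?andbF // addn1.
Qed.

Lemma adj_ux : adj M u x.
Proof. by rewrite /adj eq_sym (ctr_xu cf ux) (q_ux cf ux). Qed.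

Lemma inV' v : v \in V -> v != u -> v \in V'.
Proof. by rewrite !inE => -> ->. Qed.

Lemma relabel_facts : let N := pg_n G in
  [/\ x \in V', forall v, v \in V' -> (f' v == N) = false,
      forall v w, v \in V' -> w \in V' -> (f' v == f' w) = (v == w),
      forall a, pg_adj G N a = false & forall a, pg_adj G a N = false].
Proof.
case: iso => fi fn fl fa fd; have xV' := x_in_V' cf ux; split=> //.
- by move=> v vV; have := fl v vV; case: eqP => // ->; rewrite ltnn.
- by move=> v w vV wV; apply/eqP/eqP => [/fi|->//]; apply.
- by move=> a; apply/negP => /wf; rewrite ltnn.
- by move=> a; apply/negP => /wf; rewrite ltnn andbF.
Qed.

Lemma adj_irr (N : rel T) v : adj N v v = false.
Proof. by rewrite /adj eqxx. Qed.

Lemma relabel_inj : {in V &, injective relabel}.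
Proof.
have [xV' nN fE _ _] := relabel_facts; rewrite /relabel => v w vV wV.
case: (eqVneq v x) => [->|vx]; case: (eqVneq w x) => [->|wx] //.
- by case: (eqVneq w u) => [_|wu] /esym/eqP; rewrite nN // ?inV'.
- by case: (eqVneq v u) => [_|wu] /eqP; rewrite nN // ?inV'.
case: (eqVneq v u) => [->|vu]; case: (eqVneq w u) => [->|wu] // /eqP.
- by rewrite fE // ?inV' // eq_sym (negbTE wx).
- by rewrite fE // ?inV' // (negbTE vx).
- by rewrite fE // ?inV' // => /eqP.
Qed.

Lemma relabel_lt : {in V, forall v, relabel v < (pg_n G).+1}%N.
Proof.
move=> v vV; rewrite /relabel; case: iso => _ _ fl _ _; have [xV' _ _ _ _] := relabel_facts.
case: eqP => // _; case: (eqVneq v u) => [_|vu]; apply: ltnW; rewrite ltnS fl //.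
exact: inV'.
Qed.

Lemma step_vertex : (forall w, M w x = (w == u)) ->
  iso_cfg V M (dec1 M x) (blowup_vertex G (f' x)) relabel.
Proof.
move=> p1; have [xV' nN fE aN Na] := relabel_facts; have [fi fn fl fa fd] := iso.
have xu := ctr_xu cf ux; have ux' : u != x by rewrite eq_sym.
have Nn v : v \in V' -> (pg_n G == f' v) = false by move=> vV; rewrite eq_sym nN.
split.
- exact: relabel_inj.
- by rewrite /= fn (card_contract cf ux).
- exact: relabel_lt.
- move=> v w vV wV /=; rewrite /relabel.
  have nx y : y \in V -> y != x -> y != u -> adj M y x = false.
    by move=> yV yx yu; rewrite adjx // p1 (negbTE yu).
  case: (eqVneq v x) => [->|vx]; case: (eqVneq w x) => [->|wx].
  + by rewrite adj_irr aN Nn // !andbF.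
  + case: (eqVneq w u) => [->|wu]; first by rewrite adjC adj_ux !eqxx orbT.
    rewrite adjC nx // aN eqxx /= Nn //= fE // ?inV' // (negbTE wx) //.
  + case: (eqVneq v u) => [->|vu]; first by rewrite adj_ux !eqxx !orbT.
    by rewrite nx // Na eqxx /= Nn //= fE // ?inV' // (negbTE vx) // andbF.
  case: (eqVneq v u) => [->|vu]; case: (eqVneq w u) => [->|wu].
  + by rewrite (adj_irr M) fa // adj_irr nN // !andbF.
  + rewrite fa // ?inV' // !nN // ?inV' //= adjC adj_contract_x // p1 (negbTE wu) orbF.
    by rewrite andbF orbF.
  + rewrite fa // ?inV' // !nN // ?inV' //= adj_contract_x // p1 (negbTE vu) orbF.
    by rewrite andbF orbF adjC.
  + by rewrite fa // ?inV' // !nN // ?inV' //= andbF orbF adj_contract.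
move=> v vV /=; rewrite /relabel /dec1.
case: (eqVneq v x) => [_|vx]; first by rewrite eqxx.
have ch1 : #|ch M u| = 1.
  by rewrite -(cards1 x); apply: eq_card => j; rewrite !inE ux.
case: (eqVneq v u) => [->|vu]; first by rewrite nN // eqxx fd // /dec1 eqxx /dec ch1.
rewrite nN ?inV' // fE // ?inV' // (negbTE vx) fd // ?inV' // /dec1 (negbTE vx).
by rewrite /dec ch_contract // p1 (negbTE vu) addn0.
Qed.

Lemma step_edge D : M' D x -> (forall w, M w x = (w == u) || (w == D)) ->
  [/\ D \in V', pg_adj G (f' x) (f' D) &
   iso_cfg V M (dec1 M x) (blowup_edge G (f' x) (f' D)) relabel].
Proof.
move=> Dx p2; have [xV' nN fE aN Na] := relabel_facts; have [fi fn fl fa fd] := iso.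
have xu := ctr_xu cf ux; have ux' : u != x by rewrite eq_sym.
have Nn v : v \in V' -> (pg_n G == f' v) = false by move=> vV; rewrite eq_sym nN.
have MDx : M D x by rewrite p2 eqxx orbT.
have Du : D != u by case/and3P: Dx.
have DX : D != x by apply: contraTneq MDx => ->; rewrite (cfg_irr cf).
have DV : D \in V by case/andP: (cfg_sub cf MDx).
have DV' : D \in V' by apply: inV'.
have aD : adj M' D x by rewrite adj_contract_x // MDx orbT.
have px w : w != u -> M w x = (w == D) by move=> wu; rewrite p2 (negbTE wu).
split=> //; first by rewrite fa // adjC.
split.
- exact: relabel_inj.
- by rewrite /= fn (card_contract cf ux).
- exact: relabel_lt.
- move=> v w vV wV /=; rewrite /relabel.
  case: (eqVneq v x) => [->|vx]; case: (eqVneq w x) => [->|wx].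
  + by rewrite adj_irr aN !Nn // !andbF.
  + rewrite aN eqxx /=; case: (eqVneq w u) => [->|wu]; first by rewrite adjC adj_ux eqxx.
    by rewrite adjC adjx // px // !Nn //= !fE // ?inV' // (negbTE wx) /= andbF orbF.
  + rewrite Na eqxx /=; case: (eqVneq v u) => [->|vu]; first by rewrite adj_ux eqxx orbT.
    by rewrite adjx // px // !Nn //= !fE // ?inV' // (negbTE vx) /= andbF.
  case: (eqVneq v u) => [->|vu]; case: (eqVneq w u) => [->|wu].
  + by rewrite (adj_irr M) fa // adj_irr nN // !andbF.
  + rewrite fa // ?inV' // !nN // ?inV' //= orbF !fE // ?inV' // eqxx (negbTE wx) /= andbF orbF.
    rewrite adjC adj_contract_x // px //.
    by case: (eqVneq w D) => [->|_]; rewrite ?orbF ?andbT // andbF adj_u.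
  + rewrite fa // ?inV' // !nN // ?inV' //= orbF !fE // ?inV' // eqxx (negbTE vx) /= andbT.
    rewrite adj_contract_x // px // [RHS]adjC.
    by case: (eqVneq v D) => [->|_]; rewrite ?orbF ?andbT // andbF adj_u.
  + rewrite fa // ?inV' // !nN // ?inV' //= orbF !fE // ?inV' // (negbTE vx) (negbTE wx) /= andbF andbT.
    by rewrite adj_contract.
move=> v vV /=; rewrite /relabel /dec1.
case: (eqVneq v x) => [_|vx]; first by rewrite eqxx.
have ch1 : #|ch M u| = 1.
  by rewrite -(cards1 x); apply: eq_card => j; rewrite !inE ux.
case: (eqVneq v u) => [->|vu]; first by rewrite nN // eqxx fd // /dec1 eqxx /dec ch1.
rewrite nN ?inV' // !fE // ?inV' // (negbTE vx) fd // ?inV' // /dec1 (negbTE vx) /=.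
rewrite /dec ch_contract // px //; case: (eqVneq v D) => _; clear; lia.
Qed.

End Step.

Lemma par_le3 V M j0 x : config V M j0 -> (exists2 u, M u x & par1 M x u) \/
  (exists u D, par2 M x u D) -> x != j0.
Proof.
move=> cf H; apply/eqP => E; have := cfg_par0 cf; rewrite -E => E3.
suff: (#|par M x| <= 2)%N by rewrite E3.
case: H => [[u _ H]|[u [D H]]].
  apply: (@leq_trans #|[set u]|); last by rewrite cards1.
  by apply/subset_leq_card/subsetP => w; rewrite !inE H.
apply: (@leq_trans #|[set u; D]|); last by rewrite cards2; case: (_ != _).
by apply/subset_leq_card/subsetP => w; rewrite !inE H.
Qed.

Lemma vertices_del V u L L' : vertices V L -> perm_eq L (u :: L') -> vertices (V :\ u) L'.
Proof.
case=> uL LV p; have := perm_uniq p; rewrite uL => /esym/andP[nu uL']; split=> // v.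
by rewrite !inE LV (perm_mem p) inE; case: (eqVneq v u) => [->|_] //=; rewrite (negbTE nu).
Qed.

(** The last blow-up is undone by contracting the predecessor [u] of the last core vertex [x]. The
    only child of [u] is [x], since no later core vertex exists and the tail has its parents among
    [x] and the [v1], [v2], [v3]. *)
Lemma famX_blowups b n V M j0 c0 C v1 v2 v3 : size C = n -> config V M j0 ->
  famX_at b V M c0 C v1 v2 v3 ->
  exists G f, [/\ blowups (if b then T_a else T_b) G, pg_wf G
    & iso_cfg V M (dec1 M (last c0 C)) G f].
Proof.
elim: n V M j0 c0 C => [|n IH] V M j0 c0 C.
  move/size0nil=> -> cf F; have [f fP] := famX_base cf F.
  exists (if b then T_a else T_b), f; split=> //; first exact: bl_refl.
  by case: b {F fP}; apply: star_wf.
case/lastP: C => // C x; rewrite size_rcons => -[szC] cf F.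
have := famX_last_adj cf F; rewrite last_rcons => adjx.
have := famX_tail_par F; rewrite last_rcons => tp.
have [vs p3 pr tl] := F; have [uC A _] := fam_core_facts vs.
rewrite last_rcons in tl; have [pr' xP] := prox_rcons pr.
pose u := last c0 C.
have uxM : M u x by case: xP => [->|[D _ ->]]; rewrite eqxx.
have uC1 : u \in c0 :: C by apply: mem_last.
have uCx : u \in c0 :: rcons C x by rewrite -rcons_cons mem_rcons inE uC1 orbT.
have xCx : x \in c0 :: rcons C x by rewrite -rcons_cons mem_rcons inE eqxx.
move: (uC); rewrite -rcons_cons rcons_uniq => /andP[xC uC'].
have ux' : u != x by apply: contraNneq xC => <-.
have ux j : M u j = (j == x).
  apply/idP/eqP => [uj|-> //]; have [_ jV] := andP (cfg_sub cf uj).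
  move: jV; have [_ ->] := vs; rewrite -cat_cons mem_cat -rcons_cons mem_rcons inE -orbA.
  case/or3P=> [/eqP//|jC|jv]; last first.
    have := tp _ _ jv uj; rewrite inE (negbTE ux') /= => H.
    by have := A _ _ uCx H; rewrite eqxx.
  move: jC; rewrite inE => /orP[/eqP E|jC].
    rewrite E p3 in uj; have : u \in [:: v1; v2; v3] by rewrite !inE.
    by move/(A _ _ uCx); rewrite eqxx.
  have := prox_par_in pr' jC uj; rewrite mem_cat => /orP[/(A _ _ uCx)|uB].
    by rewrite eqxx.
  by have := belast_nlast uC' uB; rewrite eqxx.
have xj0 : x != j0.
  by apply: (par_le3 cf); case: xP => [H|[D _ H]]; [left; exists u | right; exists u, D].
have cf' := contract_config cf ux xj0.
have xu := ctr_xu cf ux.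
have nj j : j \in [:: v1; v2; v3] -> j != x /\ j != u.
  by move=> jv; split; rewrite eq_sym; apply: A.
have [[v1x v1u] [v2x v2u] [v3x v3u]] : [/\ v1 != x /\ v1 != u, v2 != x /\ v2 != u & v3 != x /\ v3 != u].
  by split; apply: nj; rewrite !inE eqxx ?orbT.
have tl' : tail b (contract M u x) x v1 v2 v3.
  move: tl; rewrite /tail; case: (b) => -[q1 q2 q3]; split=> w; by rewrite (M'E ux) // ?q1 ?q2 ?q3.
have [c0' [C' [szC' lC' F']]] : exists c0' C', [/\ size C' = n, last c0' C' = x &
    famX_at b (V :\ u) (contract M u x) c0' C' v1 v2 v3].
  (* In the contracted core [x] stands in the place of [u]; if [u] was the first vertex, [x] is the
     whole core. *)
  case/lastP E: C szC => [|C2 u2] szC.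
    exists x, [::]; split=> //; split=> //.
      by apply: vertices_del vs _; rewrite E /u E; perm_count.
    by move=> w; rewrite (M'xE cf ux) /u E p3.
  have u2E : u2 = u by rewrite /u E last_rcons.
  have nC j : j \in c0 :: C2 -> j != x /\ j != u.
    move=> jC; split.
      by apply: contraNneq xC => <-; rewrite E -rcons_cons mem_rcons inE jC orbT.
    by move: uC'; rewrite E -rcons_cons rcons_uniq u2E => /andP[H _]; apply: contraNneq H => <-.
  exists c0, (rcons C2 x); split; rewrite ?last_rcons ?size_rcons //; last split.
  - by rewrite -szC size_rcons.
  - by apply: vertices_del vs _; rewrite E u2E -!cats1; perm_count.
  - by have [H1 H2] := nC c0 (mem_head _ _); move=> w; rewrite (M'E ux).
  - rewrite E in pr'; have [pr2 uP] := prox_rcons pr'.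
    apply: prox_rconsE.
      suff keep L EE y : (forall j, j \in L -> j != x /\ j != u) -> prox M EE y L ->
          prox (contract M u x) EE y L.
        by apply: keep pr2 => j jC; apply: nC; rewrite inE jC orbT.
      elim: L EE y => //= h L IHL EE y H [hP c].
      have [hx hu] := H h (mem_head _ _); split.
        by case: hP => [hP|[D DE hP]]; [left|right; exists D => //] => w; rewrite (M'E ux).
      by apply: IHL c => j jL; apply: H; rewrite inE jL orbT.
    rewrite u2E in uP; case: uP => [uP|[D DE uP]]; [left|right; exists D => //] => w.
      by rewrite (M'xE cf ux).
    by rewrite (M'xE cf ux).
  - by rewrite last_rcons.
have [G [f' [bG wf]]] := IH _ _ _ _ _ szC' cf' F'; rewrite lC' => iso.
have un := unique_m1_last cf' (x_in_V' cf ux) iso.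
have [fn fl] : pg_n G = #|V :\ u| /\ {in V :\ u, forall v, f' v < pg_n G}%N by case: iso.
have xl := fl x (x_in_V' cf ux).
case: (par_x_cases cf ux xj0) => [p1|[D Dx p2]].
  exists (blowup_vertex G (f' x)), (relabel u x G f'); split.
  - exact: bl_vertex.
  - exact: blowup_vertex_wf.
  - exact: (step_vertex cf ux xj0 adjx wf iso p1).
have [DV' aD iso'] := step_edge cf ux xj0 adjx wf iso Dx p2.
exists (blowup_edge G (f' x) (f' D)), (relabel u x G f'); split=> //.
- by apply: bl_edge => //; apply: fl.
- by apply: blowup_edge_wf => //; apply: fl.
Qed.

End Peeling.

(** * From embeddings to configurations *)

Section Redecoration.
Variable T : finType.

(** The origin of the final decorations -4 and -3: there are no children in the core, and the tail
    provides three or two. *)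
Lemma famX_last_ch b (V : {set T}) M j0 c0 C v1 v2 v3 : config V M j0 ->
  famX_at b V M c0 C v1 v2 v3 -> #|ch M (last c0 C)| = if b then 3 else 2.
Proof.
move=> cf F; have lc j := famX_last_child (j := j) F.
case: F => vs p3 pr tl; have [uC A [n12 n13 n23]] := fam_core_facts vs.
have lC := mem_last c0 C.
have nv v : v \in [:: v1; v2; v3] -> (last c0 C == v) = false.
  by move=> vv; apply/negbTE; apply: A.
have [x1 x2 x3] : [/\ (last c0 C == v1) = false, (last c0 C == v2) = false & (last c0 C == v3) = false].
  by rewrite !nv // !inE eqxx ?orbT.
rewrite (card_ch _ cf vs) -cat_cons count_cat.
have -> : count (M (last c0 C)) (c0 :: C) = 0.
  by apply/eqP; rewrite -leqn0 leqNgt -has_count; apply/hasPn => j /lc.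
move: tl; rewrite /tail /=; case: (b) => -[q1 q2 q3];
  by rewrite q1 q2 q3 ?eqxx ?x1 ?x2 ?x3 ?orbT.
Qed.

Lemma iso_cfg_redecorate (V : {set T}) (M : rel T) x G f : x \in V ->
  iso_cfg V M (dec1 M x) G f -> iso_cfg V M (dec M) (redecorate G (f x) (dec M x)) f.
Proof.
move=> xV [fi fn fl fa fd]; split=> // v vV /=.
case: (eqVneq (f v) (f x)) => [E|ne]; first by rewrite (fi _ _ vV xV E).
by rewrite fd // /dec1; case: (eqVneq v x) ne => // ->; rewrite eqxx.
Qed.

End Redecoration.

Section Embedding.
Variables (n : nat) (e : rel 'I_n) (d : 'I_n -> int) (phi : 'I_n -> 'I_n -> int).

Lemma count_index_coeffs i c : c != 0%R ->
  count_mem c (index_coeffs phi i) = #|[set v | phi v i == c]|.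
Proof.
move=> c0; rewrite /index_coeffs count_map count_filter -sum1_card.
rewrite -sum1_count [RHS]big_mkcond /= big_mkcond /= -big_enum /=.
rewrite !big_enum /=; apply: eq_bigr => v _; rewrite inE.
by case: eqP => //= ->; rewrite c0.
Qed.

Local Open Scope ring_scope.

Hypotheses (tr : is_plumbing_tree e) (mn : is_minimal d) (em : is_symplectic_embedding e d phi).
Variable i0 : 'I_n.
Hypotheses (t9 : index_type9 phi i0)
  (t47 : forall i, i != i0 -> index_type4 phi i \/ index_type7 phi i).

(** The three index types in a uniform form; [m] will be the number of parents. *)
Lemma coeffs_shape i : exists m, perm_eq (index_coeffs phi i) (1 :: nseq m (-1)) /\
  if i == i0 then m = 3%N else (0 < m <= 2)%N.
Proof.
case: (eqVneq i i0) => [->|/t47[H|H]]; [exists 3%N | exists 1%N | exists 2%N]; by split.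
Qed.

Lemma coeff_values v i : [|| phi v i == 0, phi v i == 1 | phi v i == -1].
Proof.
case: (eqVneq (phi v i) 0) => //= nz; have [m [p _]] := coeffs_shape i.
have : phi v i \in index_coeffs phi i.
  by apply: (map_f (fun v => phi v i)); rewrite mem_filter nz mem_enum.
by rewrite (perm_mem p) inE mem_nseq => /orP[->//|/andP[_ ->]]; rewrite orbT.
Qed.

Lemma card_coeff1 i : #|[set v | phi v i == 1]| = 1%N.
Proof.
have [m [/permP p _]] := coeffs_shape i.
by rewrite -count_index_coeffs // p /= count_nseq.
Qed.

Lemma card_coeffN1 i :
  if i == i0 then #|[set v | phi v i == -1%R]| = 3%N else (0 < #|[set v | phi v i == -1%R]| <= 2)%N.
Proof.
have [m [/permP p H]] := coeffs_shape i.
by rewrite -count_index_coeffs // p /= count_nseq /= mul1n add0n.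
Qed.

Lemma sum_Posz (F : 'I_n -> nat) : \sum_i (F i)%:Z = (\sum_i F i)%:Z.
Proof. by rewrite (big_morph Posz PoszD (erefl : 0%:Z = 0)). Qed.

(** For a coefficient [a] in {0, 1, -1} the sum [a + a^2] is 2 if [a = 1] and 0 otherwise, so
    adjunction allows exactly one coefficient 1. *)
Lemma card_row1 v : #|[set i | phi v i == 1]| = 1%N.
Proof.
have [_ _ /(_ v)] := em; rewrite /Qn -opprD -big_split /=.
have -> : \sum_(i < n) (phi v i * @Kvec n i + phi v i * phi v i) = (2 * #|[set i | phi v i == 1%R]|)%:Z.
  rewrite -(sum_pred (fun i => phi v i == 1)) big_distrr -sum_Posz /=.
  apply: eq_bigr => i _; rewrite /Kvec.
  by have := coeff_values v i => /or3P[] /eqP->.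
move=> /oppr_inj H; have {H} [] : (2 * #|[set i | phi v i == 1%R]|)%:Z = 2%:Z := H.
by move: #|[set i | phi v i == 1%R]|; clear; lia.
Qed.

(** Each row contains a single 1 by adjunction and each column by the index types; the columns give
    injectivity. *)
Lemma pivot : exists s : 'I_n -> 'I_n, injective s /\
  forall v i, (phi v i == 1) = (i == s v).
Proof.
have [s sP] : exists s : 'I_n -> 'I_n, forall v i, (phi v i == 1) = (i == s v).
  apply: (fin_all_exists (P := fun v s => forall i, (phi v i == 1) = (i == s))) => v.
  have /eqP/cards1P[i /setP E] := card_row1 v; exists i => j.
  by have := E j; rewrite !inE.
exists s; split=> // v w svw.
have /eqP/cards1P[y /setP E] := card_coeff1 (s v).
have := E v; rewrite !inE sP eqxx => /esym/eqP->.
by have := E w; rewrite !inE sP svw eqxx => /esym/eqP->.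
Qed.

Section Arrows.
Variable s : 'I_n -> 'I_n.
Hypotheses (s_inj : injective s) (sP : forall v i, (phi v i == 1) = (i == s v)).

(** Indices are renamed through [s], so that children and parents live in the same type. *)
Definition arrows : rel 'I_n := fun v w => phi v (s w) == -1.

Lemma phiE v w : phi v (s w) = (v == w)%:Z - (arrows v w)%:Z.
Proof.
have := sP v (s w); rewrite (inj_eq s_inj) eq_sym /arrows [w == v]eq_sym => <-.
by have /or3P[] := coeff_values v (s w) => /eqP->.
Qed.

Lemma arrows_irr : irreflexive arrows.
Proof.
move=> v; apply/negbTE/negP => /eqP H.
by have := sP v (s v); rewrite eqxx H.
Qed.

Lemma Qn_arrows v w : v != w ->
  Qn (phi v) (phi w) = (arrows v w + arrows w v)%N%:Z - (cm arrows v w)%:Z.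
Proof.
move=> vw; rewrite /Qn (reindex_inj s_inj) /= cmE.
have -> : (arrows v w + arrows w v)%N = (\sum_j ((w == j) * arrows v j + (v == j) * arrows w j))%N.
  rewrite big_split /= (bigD1 w) //= eqxx mul1n big1 ?addn0 => [|j jw].
    by rewrite (bigD1 v) //= eqxx mul1n big1 ?addn0 // => j jv; rewrite eq_sym (negbTE jv).
  by rewrite eq_sym (negbTE jw).
rewrite -!sum_Posz -sumrB -sumrN; apply: eq_bigr => j _.
rewrite !phiE; case: (eqVneq v j) => [E|_]; case: (eqVneq w j) => [E'|_]; rewrite ?mul1n ?mul0n.
- by rewrite E E' eqxx in vw.
all: by case: (arrows v j); case: (arrows w j).
Qed.

Lemma Qn_arrows_self v : Qn (phi v) (phi v) = dec arrows v.
Proof.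
rewrite /Qn (reindex_inj s_inj) /= /dec; congr (- _).
have -> : (#|ch arrows v|.+1 = \sum_j ((v == j) + arrows v j))%N.
  rewrite big_split /= (sum_pred (arrows v)) (bigD1 v) //= eqxx big1 ?addn0 ?add1n // => j jv.
  by rewrite eq_sym (negbTE jv).
rewrite -sum_Posz; apply: eq_bigr => j _; rewrite phiE.
by case: (eqVneq v j) => [<-|_]; rewrite ?arrows_irr //; case: (arrows v j).
Qed.

Lemma dec_arrows v : d v = dec arrows v.
Proof. by case: em => _ <- _; rewrite Qn_arrows_self. Qed.

Lemma edges_arrows v w : v != w ->
  (e v w + cm arrows v w = arrows v w + arrows w v)%N.
Proof.
move=> vw; case: em => /(_ v w vw); rewrite Qn_arrows // => H _ _.
by apply/eqP; rewrite -eqz_nat PoszD; move: H; case: (e v w) => H; lia.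
Qed.

Lemma adj_arrows v w : e v w = adj arrows v w.
Proof.
case: tr => _ [_ [irr _]]; rewrite /adj; case: (eqVneq v w) => [->|vw]; first by rewrite irr.
by rewrite /q -(edges_arrows vw) addnK; case: (e v w).
Qed.

Lemma card_par_arrows j : par arrows j = [set v | phi v (s j) == -1].
Proof. by apply/setP => v; rewrite !inE. Qed.

Lemma arrows_config j0 : s j0 = i0 -> config setT arrows j0.
Proof.
move=> sj0; split.
- by move=> v w _; rewrite !inE.
- exact: arrows_irr.
(* A vertex without children would have decoration -1: this is where minimality enters. *)
- move=> v _; have := mn v; rewrite dec_arrows /dec.
  case: (set_0Vmem (ch arrows v)) => [->|[j]]; first by rewrite cards0.
  by rewrite inE; exists j.
- by move=> v w vw; rewrite -(edges_arrows vw) leq_addl.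
- by rewrite inE.
- by have := card_coeffN1 (s j0); rewrite {1}sj0 eqxx card_par_arrows.
- move=> j _ jj0; have := card_coeffN1 (s j); rewrite card_par_arrows.
  by rewrite -{1}sj0 (inj_eq s_inj) (negbTE jj0).
- move=> v w _ _; case: tr => _ [_ [_ [c _]]].
  by rewrite -(eq_connect adj_arrows) c.
Qed.

End Arrows.

Lemma iso_to_dec M G f : (forall v w, e v w = adj M v w) -> (forall v, d v = dec M v) ->
  iso_cfg setT M (dec M) G f -> iso_to e d G.
Proof.
move=> eE dE [fi fn fl fa fd]; apply: (iso_cfg_iso_to eE (f := f)); split=> //.
by move=> v vV; rewrite fd // dE.
Qed.

End Embedding.

Local Open Scope ring_scope.

Theorem theorem3p14 (n : nat) (e : rel 'I_n) (d : 'I_n -> int)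
    (phi : 'I_n -> 'I_n -> int) :
  is_plumbing_tree e -> is_minimal d ->
  is_symplectic_embedding e d phi ->
  (exists i0 : 'I_n, index_type9 phi i0 /\
     forall i : 'I_n, i != i0 -> index_type4 phi i \/ index_type7 phi i) ->
  in_W e d \/ in_N e d \/ in_M e d \/ in_A e d \/ in_B e d.
Proof.
move=> tr mn em [i0 [t9 t47]].
have [s [s_inj sP]] := pivot em t9 t47.
(* [g] inverts [s]; the role of [j0] is played by [g i0], the vertex whose coefficient at the type
   (9) index is 1. *)
have [g _ gK] := injF_bij s_inj.
have cf := arrows_config tr mn em t9 t47 s_inj sP (gK i0).
have eE := adj_arrows tr em t9 t47 s_inj sP.
have dE := dec_arrows em t9 t47 s_inj sP.
set M := arrows phi s in cf eE dE.
have isoE G f : iso_cfg setT M (dec M) G f -> iso_to e d G := iso_to_dec eE dE.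
have X b c0 C v1 v2 v3 : famX_at b setT M c0 C v1 v2 v3 ->
    exists G u, [/\ blowups (if b then T_a else T_b) G, unique_m1 G u
      & iso_to e d (redecorate G u (if b then -4 else -3))].
  move=> F; have [G [f [bG _ iG]]] := famX_blowups erefl cf F.
  have cV : last c0 C \in [set: 'I_n] by rewrite inE.
  exists G, (f (last c0 C)); split=> //; first exact: unique_m1_last cf cV iG.
  apply: (isoE _ f); have := iso_cfg_redecorate cV iG.
  by rewrite (dec_eq (famX_last_ch cf F)); case: (b).
case: (config_fam cf) => [[c0 [C [L1 [L2 [L3 F]]]]]|[c0 [C [v1 [L2 [L3 F]]]]]|[c0 [C [b [La [Lz [Lc F]]]]]]|].
- case: C F => [|h C] F.
    by have [p [q [r [f /isoE]]]] := fam1_W cf F; left; exists p, q, r.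
  have [//|p [q [f /isoE H]]] := fam1_M cf F.
  by right; right; left; exists p.+1, q, 0%N.
- case: C F => [|h C] F.
    by have [p [q [r [f /isoE]]]] := fam2_N cf F; right; left; exists p, q, r.
  have [//|q [r [f /isoE H]]] := fam2_M cf F.
  by right; right; left; exists 0%N, q, r.+1.
- case: C F => [|h C] F.
    by have [p [q [r [f /isoE]]]] := fam3_N cf F; right; left; exists p, q, r.
  have [//|p [q [r [f /isoE H]]]] := fam3_M cf F.
  by right; right; left; exists p.+1, q, r.+1.
case=> b [c0 [C [v1 [v2 [v3 F]]]]]; have H := X _ _ _ _ _ _ F.
by right; right; right; case: (b) H; [left | right].
Qed.
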